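(* Given an annotated process $P$ and a sorting $\Gamma$, it is decidable whether there is a typing $\Delta$ such that $\Gamma \vdash P \rhd \Delta$. If such a typing $\Delta$ exists, there is an algorithm to build one.
   Context: Setting: a probabilistic multiparty session process calculus. Processes are $P,Q ::= c[r]\oplus_{i\in I}\langle p_i:l_i(v_i);P_i\rangle$ (probabilistic selection towards role $r$, $I\neq\emptyset$, distinct labels $l_i$, probabilities $p_i$) $\mid c[r]\,\&_{i\in I}\{l_i(x_i);P_i\}$ (branching from role $r$) $\mid (\nu s)P \mid \mathsf{def}\ D\ \mathsf{in}\ P \mid X(\tilde v) \mid \mathbf{0} \mid P\mid Q$, with declarations $D ::= X(\tilde x)=P$, channels $c ::= x \mid s[r]$, and base values $v$. Imprecise probabilities are intervals $\delta=[d_1,d_2]$ with $0\le d_1\le d_2\le 1$. Global types $G ::= r_1\to r_2:\{\delta_i:l_i(S_i).G_i\}_{i\in I} \mid \mu t.G \mid t \mid \mathsf{end}$; local types $T ::= r\oplus_{i\in I}\delta_i:!l_i\langle S_i\rangle.T_i \mid r\,\&_{i\in I}?l_i(S_i).T_i \mid \mu t.T \mid t \mid \mathsf{end}$, with sorts $S$ being base types; $G\upharpoonright r$ is the standard projection of a global type onto role $r$ (selection for the sender, branching for the receiver, and the common projection of all continuations for other roles; undefined otherwise). A sorting is $\Gamma ::= \emptyset \mid \Gamma,x:S \mid \Gamma,X:\tilde S\tilde T$ and a typing is $\Delta ::= \emptyset \mid \Delta,\{s[r_i]:T_i\}_{i\in I}$ (with disjoint union $\Delta,\Delta'$). The judgement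 $\Gamma\vdash P\rhd\Delta$ (''under sorting $\Gamma$, process $P$ has typing $\Delta$'') is given by the rules: (TVar) $\Gamma,x:S\vdash x:S$; (TVal) $\Gamma\vdash v:S$; (TSelect) from $\forall i.\,\Gamma\vdash v_i:S_i$, $\forall i.\,\Gamma\vdash P_i\rhd\Delta,c:T_i$, $\sum_{i\in I}p_i=1$ and $p_i\in\delta_i$, infer $\Gamma\vdash c[r]\oplus_{i\in I}\langle p_i:l_i(v_i);P_i\rangle\rhd\Delta,c:r\oplus_{i\in I}\delta_i:!l_i\langle S_i\rangle.T_i$; (TBranch) from $\forall i.\,\Gamma,x_i:S_i\vdash P_i\rhd\Delta,c:T_i$ infer $\Gamma\vdash c[r]\,\&_{i\in I}\{l_i(x_i);P_i\}\rhd\Delta,c:r\,\&_{i\in I}?l_i(S_i).T_i$; (TEnd) if $\Delta$ contains only $\mathsf{end}$ then $\Gamma\vdash\mathbf{0}\rhd\Delta$; (TConc) from $\Gamma\vdash P\rhd\Delta$ and $\Gamma\vdash Q\rhd\Delta'$ infer $\Gamma\vdash P\mid Q\rhd\Delta,\Delta'$; (TRes) from $pid(G)=|I|$, $\forall i.\,G\upharpoonright r_i=T_i$ and $\Gamma\vdash P\rhd\Delta,\{s[r_i]:T_i\}_{i\in I}$ infer $\Gamma\vdash(\nu s)P\rhd\Delta$; (TDef) from $\Gamma,x:\tilde S,X:\tilde S T_1\ldots T_n\vdash P\rhd c_1:T_1,\ldots,c_n:T_n$ and $\Gamma,X:\tilde S T_1\ldots T_n\vdash Q\rhd\Delta$ infer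 $\Gamma\vdash \mathsf{def}\ X(\tilde x c_1\ldots c_n)=P\ \mathsf{in}\ Q\rhd\Delta$; (TCall) from $\Gamma\vdash\tilde v:\tilde S$ and $\Delta$ containing only $\mathsf{end}$ infer $\Gamma,X:\tilde S T_1\ldots T_n\vdash X(\tilde v c_1\ldots c_n)\rhd\Delta,c_1:T_1,\ldots,c_n:T_n$. An annotated process is a process whose bound names carry their types, e.g. $(\nu s:G)P$ and $s?(x:S)P$; annotated processes are typed by the evident annotated versions of the rules above (e.g. for $(\nu s:G)P$ the types $T_i$ of $s[r_i]$ are obtained as $G\upharpoonright r_i$). *)

(* Defs.v *)
From Stdlib Require List.
From HB Require Import structures.
From mathcomp Require Import all_boot all_order all_algebra.
Set Implicit Arguments.
Unset Strict Implicit.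
Unset Printing Implicit Defensive.
Import Order.TTheory GRing.Theory Num.Theory.
Local Open Scope nat_scope.

Notation Forall2 := List.Forall2.

(* Names.  Roles and labels are global names.  Everything that can be bound
   (value variables, channel variables, process variables, sessions, recursion
   variables of types) is a de Bruijn index, each kind in its own index space,
   so that terms are identified up to renaming of bound names. *)
Definition role := nat.
Definition label := nat.

Inductive chan :=
| CVar of nat
| CRole of nat & role.     (* CRole s r is s[r] *)

Definition chan_code (c : chan) : nat + nat * nat :=
  match c with CVar x => inl x | CRole s r => inr (s, r) end.
Definition chan_decode (u : nat + nat * nat) : chan :=
  match u with inl x => CVar x | inr (s, r) => CRole s r end.
Lemma chan_codeK : cancel chan_code chan_decode. Proof. by case. Qed.
HB.instance Definition _ := Equality.copy chan (can_type chan_codeK).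

(* There are countably many base types, and the values of each base type are
   numbered: VLit S k is value number k of base type S. *)
Definition sort := nat.

Inductive value :=
| VVar of nat
| VLit of sort & nat.

(* Probabilities are rational, so that a process is a finite object. *)
Definition prob := {p : rat | (0 <= p <= 1)%R}.

Record iprob := IProb {
  ilo : rat;
  ihi : rat;
  iprobP : [&& 0 <= ilo, ilo <= ihi & ihi <= 1]%R }.

Definition in_iprob (p : prob) (d : iprob) : bool :=
  (ilo d <= sval p <= ihi d)%R.

(* A family indexed by labels is an association list; a well-formed one is
   nonempty and has distinct labels. *)
Definition fam (A : Type) := seq (label * A).

Definition wf_fam (A : Type) (bs : fam A) : bool :=
  (0 < size bs) && uniq [seq b.1 | b <- bs].

Fixpoint assoc (K : eqType) (V : Type) (k : K) (s : seq (K * V)) : option V :=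
  if s is (k', v) :: s' then if k == k' then Some v else assoc k s' else None.

Definition opt_rel (A : Type) (R : A -> A -> Prop) (u v : option A) : Prop :=
  match u, v with
  | Some x, Some y => R x y
  | None, None => True
  | _, _ => False
  end.

(* Two association lists represent R-related finite partial maps. *)
Definition map_rel (K : eqType) (V : Type) (R : V -> V -> Prop)
    (s t : seq (K * V)) : Prop :=
  forall k, opt_rel R (assoc k s) (assoc k t).

Inductive gtype :=
| GMsg of role & role & fam (iprob * sort * gtype)
| GMu of gtype
| GVar of nat
| GEnd.

Inductive ltype :=
| LSel of role & fam (iprob * sort * ltype)
| LBra of role & fam (sort * ltype)
| LMu of ltype
| LVar of nat
| LEnd.

(* [gunguarded n G]: variable n occurs in G under no communication. *)
Fixpoint gunguarded (n : nat) (G : gtype) : bool :=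
  match G with
  | GMsg _ _ _ | GEnd => false
  | GMu G' => gunguarded n.+1 G'
  | GVar m => m == n
  end.

Fixpoint lunguarded (n : nat) (T : ltype) : bool :=
  match T with
  | LSel _ _ | LBra _ _ | LEnd => false
  | LMu T' => lunguarded n.+1 T'
  | LVar m => m == n
  end.

Fixpoint gclosed (k : nat) (G : gtype) : bool :=
  match G with
  | GMsg _ _ bs => all (fun b => gclosed k b.2.2) bs
  | GMu G' => gclosed k.+1 G'
  | GVar n => n < k
  | GEnd => true
  end.

(* Recursion variables below k, contractive recursions, well-formed families. *)
Fixpoint wf_gtype (k : nat) (G : gtype) : bool :=
  match G with
  | GMsg p q bs => [&& p != q, wf_fam bs & all (fun b => wf_gtype k b.2.2) bs]
  | GMu G' => ~~ gunguarded 0 G' && wf_gtype k.+1 G'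
  | GVar n => n < k
  | GEnd => true
  end.

Fixpoint wf_ltype (k : nat) (T : ltype) : bool :=
  match T with
  | LSel _ bs => wf_fam bs && all (fun b => wf_ltype k b.2.2) bs
  | LBra _ bs => wf_fam bs && all (fun b => wf_ltype k b.2.2) bs
  | LMu T' => ~~ lunguarded 0 T' && wf_ltype k.+1 T'
  | LVar n => n < k
  | LEnd => true
  end.

Fixpoint llift (d k : nat) (T : ltype) : ltype :=
  match T with
  | LSel r bs => LSel r [seq (b.1, (b.2.1, llift d k b.2.2)) | b <- bs]
  | LBra r bs => LBra r [seq (b.1, (b.2.1, llift d k b.2.2)) | b <- bs]
  | LMu T' => LMu (llift d k.+1 T')
  | LVar n => LVar (if n < k then n else n + d)
  | LEnd => LEnd
  end.

Fixpoint lsubst (k : nat) (U T : ltype) : ltype :=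
  match T with
  | LSel r bs => LSel r [seq (b.1, (b.2.1, lsubst k U b.2.2)) | b <- bs]
  | LBra r bs => LBra r [seq (b.1, (b.2.1, lsubst k U b.2.2)) | b <- bs]
  | LMu T' => LMu (lsubst k.+1 U T')
  | LVar n => if n < k then LVar n else if n == k then llift k 0 U else LVar n.-1
  | LEnd => LEnd
  end.

Definition is_mu (T : ltype) : bool := if T is LMu _ then true else false.

(* [unfolds T U]: unfolding the leading recursions of T yields U. *)
Inductive unfolds : ltype -> ltype -> Prop :=
| unfolds_head T : ~~ is_mu T -> unfolds T T
| unfolds_mu T U : unfolds (lsubst 0 (LMu T) T) U -> unfolds (LMu T) U.

Definition same_head (R : ltype -> ltype -> Prop) (T U : ltype) : Prop :=
  match T, U with
  | LSel r bs, LSel r' bs' =>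
      r = r' /\ map_rel (fun x y => x.1 = y.1 /\ R x.2 y.2) bs bs'
  | LBra r bs, LBra r' bs' =>
      r = r' /\ map_rel (fun x y => x.1 = y.1 /\ R x.2 y.2) bs bs'
  | LVar m, LVar n => m = n
  | LEnd, LEnd => True
  | _, _ => False
  end.

Definition bisimulation (R : ltype -> ltype -> Prop) : Prop :=
  forall T U, R T U ->
    exists T' U', [/\ unfolds T T', unfolds U U' & same_head R T' U'].

(* Equality of local types.  Types are equi-recursive (mu t.T is not
   distinguished from its unfolding) and their branches form families indexed
   by labels, without order: two types are equal when they denote the same,
   possibly infinite, tree.  Free recursion variables are leaves of the tree. *)
Definition type_eq (T U : ltype) : Prop :=
  exists R, bisimulation R /\ R T U.

Fixpoint roles (G : gtype) : seq role :=
  match G with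
  | GMsg p q bs => p :: q :: flatten [seq roles b.2.2 | b <- bs]
  | GMu G' => roles G'
  | GVar _ | GEnd => [::]
  end.

Definition pid (G : gtype) : seq role := undup (roles G).

(* [proj G r T] is G|r = T.  It is a relation because projection is partial and
   because the continuations of a message not involving r must have the same
   projection in the sense of type_eq.  A recursion is erased for a role r
   foreign to it, unless it mentions an outer recursion variable, through which
   r may be reached again. *)
Inductive proj : gtype -> role -> ltype -> Prop :=
| proj_send p q bs Ts :
    Forall2 (fun b T => proj b.2.2 p T) bs Ts ->
    proj (GMsg p q bs) p
      (LSel q [seq (x.1.1, (x.1.2.1, x.2)) | x <- zip bs Ts])
| proj_recv p q bs Ts :
    Forall2 (fun b T => proj b.2.2 q T) bs Ts ->
    proj (GMsg p q bs) q
      (LBra p [seq (x.1.1, (x.1.2.1.2, x.2)) | x <- zip bs Ts])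
| proj_other p q r bs T Ts :
    r <> p -> r <> q ->
    Forall2 (fun b U => proj b.2.2 r U) bs (T :: Ts) ->
    List.Forall (type_eq T) Ts ->
    proj (GMsg p q bs) r T
| proj_mu r G T :
    (r \in pid G) || ~~ gclosed 0 (GMu G) ->
    proj G r T -> proj (GMu G) r (LMu T)
| proj_mu_end r G :
    r \notin pid G -> gclosed 0 (GMu G) -> proj (GMu G) r LEnd
| proj_var r n : proj (GVar n) r (LVar n)
| proj_end r : proj GEnd r LEnd.

(* Annotated processes.  A branch l(x:S);P binds value variable 0 in P;
   PNew G P, that is (nu s:G)P, binds session 0 in P.
   PDef Ss Ts P Q is def X(x:Ss, c:Ts) = P in Q: it binds process variable 0 in
   P and Q, the first |Ss| value variables and the first |Ts| channel variables
   in P.  PCall X vs cs is X(vs cs). *)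
Inductive proc :=
| PSel of chan & role & fam ((prob * value) * proc)
| PBra of chan & role & fam (sort * proc)
| PNew of gtype & proc
| PDef of seq sort & seq ltype & proc & proc
| PCall of nat & seq value & seq chan
| PNil
| PPar of proc & proc.

Fixpoint wf_proc (P : proc) : bool :=
  match P with
  | PSel _ _ bs => wf_fam bs && all (fun b => wf_proc b.2.2) bs
  | PBra _ _ bs => wf_fam bs && all (fun b => wf_proc b.2.2) bs
  | PNew G P' => wf_gtype 0 G && wf_proc P'
  | PDef _ Ts P' Q => [&& all (wf_ltype 0) Ts, wf_proc P' & wf_proc Q]
  | PCall _ _ _ | PNil => true
  | PPar P' Q => wf_proc P' && wf_proc Q
  end.

Record sorting := Sorting {
  svals : seq sort;                         (* x : S *)
  sprocs : seq (seq sort * seq ltype) }.    (* X : S1 .. Sm T1 .. Tn *)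

Definition wf_sorting (Gam : sorting) : bool :=
  all (fun X => all (wf_ltype 0) X.2) (sprocs Gam).

Definition add_vals (Ss : seq sort) (Gam : sorting) : sorting :=
  Sorting (Ss ++ svals Gam) (sprocs Gam).

Definition add_proc (Ss : seq sort) (Ts : seq ltype) (Gam : sorting) : sorting :=
  Sorting (svals Gam) ((Ss, Ts) :: sprocs Gam).

(* A typing is a finite map from channels to types.  [Del, c : T] is
   (c, T) :: Del and [Del, Del'] is Del ++ Del', with distinct keys. *)
Definition typing := seq (chan * ltype).

Definition dom (Del : typing) : seq chan := [seq x.1 | x <- Del].

Definition wf_typing (Del : typing) : bool :=
  uniq (dom Del) && all (fun x => wf_ltype 0 x.2) Del.

Definition only_end (Del : typing) : Prop :=
  List.Forall (fun x => x.2 = LEnd) Del.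

Definition eq_typing : typing -> typing -> Prop := map_rel type_eq.

Definition shift_chan (c : chan) : chan :=
  match c with CVar x => CVar x | CRole s r => CRole s.+1 r end.

(* Del seen under a session binder. *)
Definition shift (Del : typing) : typing :=
  [seq (shift_chan x.1, x.2) | x <- Del].

Inductive has_sort (Gam : sorting) : value -> sort -> Prop :=
| TVar x S : onth (svals Gam) x = Some S -> has_sort Gam (VVar x) S
| TVal S k : has_sort Gam (VLit S k) S.

(* TEq only expresses that types are taken up to type_eq and that typings are
   finite maps rather than lists.  In TRes, pid(G) = |I| is read: the r_i
   enumerate without repetition the participants of G. *)
Inductive typed : sorting -> proc -> typing -> Prop :=
| TSelect Gam Del c r (bs : fam ((prob * value) * proc))
    (ts : fam (iprob * sort * ltype)) :
    [seq b.1 | b <- bs] = [seq t.1 | t <- ts] ->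
    Forall2 (fun b t => has_sort Gam b.2.1.2 t.2.1.2) bs ts ->
    Forall2 (fun b t => typed Gam b.2.2 ((c, t.2.2) :: Del)) bs ts ->
    (\sum_(b <- bs) sval b.2.1.1 = 1)%R ->
    Forall2 (fun b t => in_iprob b.2.1.1 t.2.1.1) bs ts ->
    typed Gam (PSel c r bs) ((c, LSel r ts) :: Del)
| TBranch Gam Del c r (bs : fam (sort * proc)) (ts : fam (sort * ltype)) :
    [seq b.1 | b <- bs] = [seq t.1 | t <- ts] ->
    Forall2 (fun b t => b.2.1 = t.2.1) bs ts ->
    Forall2 (fun b t => typed (add_vals [:: t.2.1] Gam) b.2.2
                          ((c, t.2.2) :: Del)) bs ts ->
    typed Gam (PBra c r bs) ((c, LBra r ts) :: Del)
| TEnd Gam Del :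
    only_end Del -> uniq (dom Del) -> typed Gam PNil Del
| TConc Gam P Q Del Del' :
    typed Gam P Del -> typed Gam Q Del' -> uniq (dom (Del ++ Del')) ->
    typed Gam (PPar P Q) (Del ++ Del')
| TRes Gam G P Ts Del :
    Forall2 (proj G) (pid G) Ts ->
    typed Gam P
      (shift Del ++ [seq (CRole 0 x.1, x.2) | x <- zip (pid G) Ts]) ->
    typed Gam (PNew G P) Del
| TDef Gam Ss Ts P Q Del :
    typed (add_vals Ss (add_proc Ss Ts Gam)) P
      [seq (CVar x.1, x.2) | x <- zip (iota 0 (size Ts)) Ts] ->
    typed (add_proc Ss Ts Gam) Q Del ->
    typed Gam (PDef Ss Ts P Q) Del
| TCall Gam X vs cs Ss Ts Del :
    onth (sprocs Gam) X = Some (Ss, Ts) ->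
    Forall2 (has_sort Gam) vs Ss ->
    size cs = size Ts ->
    only_end Del ->
    uniq (dom (Del ++ zip cs Ts)) ->
    typed Gam (PCall X vs cs) (Del ++ zip cs Ts)
| TEq Gam P Del Del' :
    typed Gam P Del -> eq_typing Del Del' -> wf_typing Del' ->
    typed Gam P Del'.

(* Model of computation: Jones's language F (N. D. Jones, "Computability and
   Complexity from a Programming Perspective"), a Turing-complete first-order
   functional language over binary trees.  An expression e is evaluated with
   respect to the body f of the function being defined and its argument x;
   ERec e is a recursive call of that function on e, and EApp g e calls on e
   the function whose body is g.  Nil is false, every other tree is true. *)
Inductive tree := Nil | Cons of tree & tree.

Definition hd (t : tree) : tree := if t is Cons a _ then a else Nil.
Definition tl (t : tree) : tree := if t is Cons _ b then b else Nil.

Inductive expr :=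
| EArg
| ENil
| ECons of expr & expr
| EHd of expr
| ETl of expr
| EIf of expr & expr & expr
| ERec of expr
| EApp of expr & expr.

Inductive eval (f : expr) (x : tree) : expr -> tree -> Prop :=
| eval_arg : eval f x EArg x
| eval_nil : eval f x ENil Nil
| eval_cons e1 e2 t1 t2 :
    eval f x e1 t1 -> eval f x e2 t2 -> eval f x (ECons e1 e2) (Cons t1 t2)
| eval_hd e t : eval f x e t -> eval f x (EHd e) (hd t)
| eval_tl e t : eval f x e t -> eval f x (ETl e) (tl t)
| eval_if_true e e1 e2 a b t :
    eval f x e (Cons a b) -> eval f x e1 t -> eval f x (EIf e e1 e2) t
| eval_if_false e e1 e2 t :
    eval f x e Nil -> eval f x e2 t -> eval f x (EIf e e1 e2) t
| eval_rec e y t : eval f x e y -> eval f y f t -> eval f x (ERec e) t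
| eval_app g e y t : eval f x e y -> eval g y g t -> eval f x (EApp g e) t.

(* The program f terminates on input x with output y. *)
Definition run (f : expr) (x y : tree) : Prop := eval f x f y.

(* Q is decidable on the inputs satisfying D, represented through enc. *)
Definition decidable_on (A : Type) (enc : A -> tree) (D Q : A -> Prop) : Prop :=
  exists f : expr, forall a, D a ->
    (Q a /\ run f (enc a) (Cons Nil Nil)) \/ (~ Q a /\ run f (enc a) Nil).

Fixpoint enc_nat (n : nat) : tree :=
  if n is n'.+1 then Cons Nil (enc_nat n') else Nil.

Definition enc_seq (A : Type) (enc : A -> tree) (s : seq A) : tree :=
  foldr (fun a t => Cons (enc a) t) Nil s.

(* Used on nonnegative rationals only. *)
Definition enc_rat (q : rat) : tree :=
  Cons (enc_nat `|numq q|) (enc_nat `|denq q|).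

Definition enc_iprob (d : iprob) : tree :=
  Cons (enc_rat (ilo d)) (enc_rat (ihi d)).

Definition enc_chan (c : chan) : tree :=
  match c with
  | CVar x => Cons (enc_nat 0) (enc_nat x)
  | CRole s r => Cons (enc_nat 1) (Cons (enc_nat s) (enc_nat r))
  end.

Definition enc_value (v : value) : tree :=
  match v with
  | VVar x => Cons (enc_nat 0) (enc_nat x)
  | VLit B k => Cons (enc_nat 1) (Cons (enc_nat B) (enc_nat k))
  end.

Definition enc_fam (A B : Type) (encA : A -> tree) (encB : B -> tree) :
    fam (A * B) -> tree :=
  enc_seq (fun b => Cons (enc_nat b.1) (Cons (encA b.2.1) (encB b.2.2))).

Definition enc_isort (x : iprob * sort) : tree :=
  Cons (enc_iprob x.1) (enc_nat x.2).

Fixpoint enc_gtype (G : gtype) : tree :=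
  match G with
  | GMsg p q bs =>
      Cons (enc_nat 0)
        (Cons (enc_nat p) (Cons (enc_nat q) (enc_fam enc_isort enc_gtype bs)))
  | GMu G' => Cons (enc_nat 1) (enc_gtype G')
  | GVar n => Cons (enc_nat 2) (enc_nat n)
  | GEnd => Cons (enc_nat 3) Nil
  end.

Fixpoint enc_ltype (T : ltype) : tree :=
  match T with
  | LSel r bs => Cons (enc_nat 0) (Cons (enc_nat r) (enc_fam enc_isort enc_ltype bs))
  | LBra r bs => Cons (enc_nat 1) (Cons (enc_nat r) (enc_fam enc_nat enc_ltype bs))
  | LMu T' => Cons (enc_nat 2) (enc_ltype T')
  | LVar n => Cons (enc_nat 3) (enc_nat n)
  | LEnd => Cons (enc_nat 4) Nil
  end.

Definition enc_pvalue (x : prob * value) : tree :=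
  Cons (enc_rat (sval x.1)) (enc_value x.2).

Fixpoint enc_proc (P : proc) : tree :=
  match P with
  | PSel c r bs =>
      Cons (enc_nat 0)
        (Cons (enc_chan c) (Cons (enc_nat r) (enc_fam enc_pvalue enc_proc bs)))
  | PBra c r bs =>
      Cons (enc_nat 1)
        (Cons (enc_chan c) (Cons (enc_nat r) (enc_fam enc_nat enc_proc bs)))
  | PNew G P' => Cons (enc_nat 2) (Cons (enc_gtype G) (enc_proc P'))
  | PDef Ss Ts P' Q =>
      Cons (enc_nat 3)
        (Cons (Cons (enc_seq enc_nat Ss) (enc_seq enc_ltype Ts))
              (Cons (enc_proc P') (enc_proc Q)))
  | PCall X vs cs =>
      Cons (enc_nat 4)
        (Cons (enc_nat X) (Cons (enc_seq enc_value vs) (enc_seq enc_chan cs)))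
  | PNil => Cons (enc_nat 5) Nil
  | PPar P' Q => Cons (enc_nat 6) (Cons (enc_proc P') (enc_proc Q))
  end.

Definition enc_sorting (Gam : sorting) : tree :=
  Cons (enc_seq enc_nat (svals Gam))
    (enc_seq (fun X => Cons (enc_seq enc_nat X.1) (enc_seq enc_ltype X.2))
       (sprocs Gam)).

Definition enc_input (x : sorting * proc) : tree :=
  Cons (enc_sorting x.1) (enc_proc x.2).

Definition enc_typing (Del : typing) : tree :=
  enc_seq (fun x => Cons (enc_chan x.1) (enc_ltype x.2)) Del.

(* Main.v *)
From Stdlib Require List.
From HB Require Import structures.
From mathcomp Require Import all_boot all_order all_algebra.
From mathcomp Require Import zify.
Require Import Defs.
Set Implicit Arguments.
Unset Strict Implicit.
Unset Printing Implicit Defensive.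
Import Order.TTheory GRing.Theory Num.Theory.
Local Open Scope nat_scope.

(* The sorting fixes the types of all process variables and sessions, so the
   typings of P form a product: whether T is a possible type for a channel d
   can be checked by recursion on P independently of the other channels.  Only
   the intervals of a free channel are not determined by P.  Descending into P
   along d gives a finite tree whose leaves are annotated types; the trees
   coming from different branches are merged by preferring annotated leaves,
   and giving the remaining nodes the interval [0, 1] yields a type for d
   whenever d has one.  Equality of recursive types is decided by bounded
   unfolding, since a type has finitely many reachable subterms.

   For the model of computation, one program scheme suffices: a function with
   F a = body a (map F (kids a)) and kids of smaller measure is computable when
   body and kids are. *)

(** The rule for parallel composition splits the typing, but the split is forced: a channel used by
    one component goes to it, and a channel used by neither must be ended. This is what allows
    channels to be treated one at a time, without search. The interval [[0, 1]] is harmless because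
    a selection only requires an interval to contain one probability. It can be wrong only where
    another branch of the process hands the same channel to an annotated type, since all
    continuations of a prefix on a different channel must give that channel one type; there the
    annotated intervals are forced. Preferring annotated leaves is then safe: if a type [T] for the
    channel exists, such a leaf equals the corresponding subtree of [T], which already passes the
    check. The candidate is computed without knowing [T] and means nothing when there is no [T], so
    it is checked afterwards. For equality of types, the set of pairs of reachable subterms that
    agree to depth [n] shrinks as [n] grows. It can shrink strictly at most once per pair, so the
    product of the two sizes is a sufficient depth. *)

(** * Lists, association lists and families *)

Lemma allIn (A : Type) (p : pred A) (s : seq A) :
  reflect (forall x, List.In x s -> p x) (all p s).
Proof.
elim: s => [|x s IHs] /=; first by apply: ReflectT.
apply: (iffP andP) => [[px /IHs ps] y [<-//|/ps]//|ps]; split.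
  by apply: ps; left.
by apply/IHs => y sy; apply: ps; right.
Qed.

Lemma In_mem (A : eqType) (x : A) (s : seq A) : List.In x s <-> x \in s.
Proof.
elim: s => //= y s IHs; rewrite inE -(rwP orP) IHs.
by split => -[]; [left; apply/eqP|right|move/eqP->; left|right].
Qed.

Lemma In_map (A B : Type) (f : A -> B) (s : seq A) (y : B) :
  List.In y (map f s) <-> exists2 x, List.In x s & y = f x.
Proof.
elim: s => [|x s IHs] /=; first by split => [|[]].
rewrite IHs; split=> [[<-|[z sz ->]]|[z [<-|sz] ->]].
- by exists x => //; left.
- by exists z => //; right.
- by left.
- by right; exists z.
Qed.

Lemma In_flatten (A : Type) (ss : seq (seq A)) (y : A) :
  List.In y (flatten ss) <-> exists2 s, List.In s ss & List.In y s.
Proof.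
elim: ss => [|s ss IHs] /=; first by split => [|[]].
rewrite List.in_app_iff IHs; split=> [[sy|[t st ty]]|[t [<-|st] ty]].
- by exists s => //; left.
- by exists t => //; right.
- by left.
- by right; exists t.
Qed.

Lemma eq_map_In (A B : Type) (f g : A -> B) (s : seq A) :
  List.Forall (fun x => f x = g x) s -> map f s = map g s.
Proof. by elim=> //= x s' -> _ ->. Qed.

Section Assoc.
Variables (K : eqType) (V : Type).
Implicit Type s : seq (K * V).

Lemma assoc_In k v s : assoc k s = Some v -> List.In (k, v) s.
Proof. by elim: s => //= -[k' v'] s IHs; case: eqP => [<- [<-]|_ /IHs]; [left|right]. Qed.

Lemma In_assoc k v s : uniq (map fst s) -> List.In (k, v) s -> assoc k s = Some v.
Proof.
elim: s => //= -[k' v'] s IHs /= /andP[k's us] [[-> ->]|kvs]; first by rewrite eqxx.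
case: eqP k's => [<-|_ _]; last exact: IHs.
by have/In_mem-> : List.In k (map fst s) by apply/In_map; exists (k, v).
Qed.

Lemma assoc_mem k s : (k \in map fst s) = isSome (assoc k s).
Proof. by elim: s => //= -[k' v'] s IHs; rewrite inE IHs; case: eqP. Qed.

Lemma assoc_memP k s : reflect (exists v, assoc k s = Some v) (k \in map fst s).
Proof.
by rewrite assoc_mem; case: (assoc k s) => [v|]; constructor; [exists v|case].
Qed.

Lemma assoc_cat k s t :
  assoc k (s ++ t) = if assoc k s is Some v then Some v else assoc k t.
Proof. by elim: s => //= -[k' v'] s IHs; case: eqP. Qed.

Lemma assoc_filter (p : pred K) k s :
  assoc k [seq x <- s | p x.1] = if p k then assoc k s else None.
Proof.
elim: s => [|[k' v'] s IHs] /=; first by case: ifP.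
by case: (boolP (p k')) => [|/negPf] pk' /=; rewrite IHs; case: eqP => [->|]; rewrite ?pk'.
Qed.

End Assoc.

Lemma assoc_map (K : eqType) (V W : Type) (f : K -> V -> W) k (s : seq (K * V)) :
  assoc k [seq (x.1, f x.1 x.2) | x <- s] = omap (f k) (assoc k s).
Proof. by elim: s => //= -[k' v'] s IHs /=; case: eqP => [->|]. Qed.

Lemma assoc_mapv (K : eqType) (V W : Type) (f : V -> W) k (s : seq (K * V)) :
  assoc k [seq (x.1, f x.2) | x <- s] = omap f (assoc k s).
Proof. exact: (assoc_map (fun _ => f)). Qed.

(** Only labels occurring in one of the two families are tested, which makes the comparison of
    finite maps a finite one. *)
Definition fam_rel (A B : Type) (e : A -> B -> bool) (s : fam A) (t : fam B) : bool :=
  all (fun l => if assoc l s is Some x then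
                  if assoc l t is Some y then e x y else false
                else false) (map fst s ++ map fst t).

Lemma fam_relP (A B : Type) (e : A -> B -> bool) (s : fam A) (t : fam B) :
  reflect (forall l, match assoc l s, assoc l t with
                     | Some x, Some y => e x y | None, None => true
                     | _, _ => false end) (fam_rel e s t).
Proof.
apply: (iffP allP) => h l; have := h l; rewrite mem_cat !assoc_mem.
  by case: (assoc l s) => [x|]; case: (assoc l t) => [y|] //= h'; exact: h'.
by case: (assoc l s) => [x|]; case: (assoc l t).
Qed.

(** * Lifting and substitution in local types *)

(** The generated principle gives no induction hypothesis for the types nested in a list of
    branches. *)
Fixpoint ltype_nest_ind (P : ltype -> Prop)
  (Hsel : forall r bs, List.Forall (fun b => P b.2.2) bs -> P (LSel r bs))
  (Hbra : forall r bs, List.Forall (fun b => P b.2.2) bs -> P (LBra r bs))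
  (Hmu : forall T, P T -> P (LMu T)) (Hvar : forall n, P (LVar n)) (Hend : P LEnd)
  (T : ltype) : P T :=
  match T with
  | LSel r bs => Hsel r bs
      ((fix go (s : fam (iprob * sort * ltype)) : List.Forall (fun b => P b.2.2) s :=
         match s with
         | [::] => List.Forall_nil _
         | b :: s' => List.Forall_cons b (ltype_nest_ind Hsel Hbra Hmu Hvar Hend b.2.2) (go s')
         end) bs)
  | LBra r bs => Hbra r bs
      ((fix go (s : fam (sort * ltype)) : List.Forall (fun b => P b.2.2) s :=
         match s with
         | [::] => List.Forall_nil _
         | b :: s' => List.Forall_cons b (ltype_nest_ind Hsel Hbra Hmu Hvar Hend b.2.2) (go s')
         end) bs)
  | LMu T' => Hmu T' (ltype_nest_ind Hsel Hbra Hmu Hvar Hend T')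
  | LVar n => Hvar n
  | LEnd => Hend
  end.

Ltac famIH IH := first [congr LSel | congr LBra]; rewrite -?map_comp; apply: eq_map_In;
  apply: List.Forall_impl IH => -[? [? ?]] /= -> //.

Lemma llift0 k T : llift 0 k T = T.
Proof.
elim/ltype_nest_ind: T k => /= [r bs IH|r bs IH|T IH|n|] k //.
- congr LSel; rewrite -[RHS]map_id; apply: eq_map_In.
  by apply: List.Forall_impl IH => -[? [? ?]] /= -> //.
- congr LBra; rewrite -[RHS]map_id; apply: eq_map_In.
  by apply: List.Forall_impl IH => -[? [? ?]] /= -> //.
- by rewrite IH.
- by rewrite addn0 if_same.
Qed.

Lemma llift_llift i j n k T : k <= j <= k + n ->
  llift i j (llift n k T) = llift (i + n) k T.
Proof.
elim/ltype_nest_ind: T j k => /= [r bs IH|r bs IH|T IH|m|] j k h //.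
- by famIH IH; lia.
- by famIH IH; lia.
- by rewrite IH //; lia.
- congr LVar; case: (ltnP m k) => mk; first by have -> : m < j by lia.
  have -> : (m + n < j) = false by lia.
  lia.
Qed.

(** The lifting opens a gap of [n.+1] indices at [k]. Substituting at an index of the gap meets no
    occurrence and narrows the gap by one. *)
Lemma lsubst_llift i k n U T : k <= i <= k + n ->
  lsubst i U (llift n.+1 k T) = llift n k T.
Proof.
elim/ltype_nest_ind: T i k => /= [r bs IH|r bs IH|T IH|m|] i k h //.
- by famIH IH; lia.
- by famIH IH; lia.
- by rewrite IH //; lia.
- case: (ltnP m k) => mk; first by have -> : m < i by lia.
  have -> : (m + n.+1 < i) = false by lia.
  have -> : (m + n.+1 == i) = false by lia.
  by congr LVar; lia.
Qed.

Lemma llift_lsubst i j k U T : j <= k ->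
  lsubst (i + k) U (llift i j T) = llift i j (lsubst k U T).
Proof.
elim/ltype_nest_ind: T j k => /= [r bs IH|r bs IH|T IH|m|] j k h //.
- by famIH IH.
- by famIH IH.
- by rewrite -addnS IH.
- case: (ltngtP m k) => mk /=.
  + case: (ltnP m j) => mj; first by have -> : m < i + k by lia.
    by have -> : m + i < i + k by lia.
  + have -> : m < j = false by lia.
    have -> : m.-1 < j = false by lia.
    have -> : m + i < i + k = false by lia.
    have -> : (m + i == i + k) = false by lia.
    by congr LVar; lia.
  + have -> : m < j = false by lia.
    have -> : m + i < i + k = false by lia.
    have -> : (m + i == i + k) by lia.
    by rewrite llift_llift //; lia.
Qed.

(** The usual exchange of two substitutions. It makes unfolding commute with the substitution for an
    enclosing recursion, as [clos_step] requires. *)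
Lemma lsubst_lsubst i k U M T :
  lsubst (i + k) M (lsubst i U T) = lsubst i (lsubst k M U) (lsubst (i + k).+1 M T).
Proof.
elim/ltype_nest_ind: T i => /= [r bs IH|r bs IH|T IH|m|] i //.
- by famIH IH.
- by famIH IH.
- by rewrite -addSn IH.
- case: (ltngtP m i) => mi /=.
  + have -> : m < i + k by lia.
    have -> : m < (i + k).+1 by lia.
    by rewrite /= mi.
  + case: (ltngtP m (i + k).+1) => mik /=.
    * have -> : m.-1 < i + k by lia.
      have -> : m < i = false by lia.
      by have -> : (m == i) = false by lia.
    * have -> : m.-1 < i + k = false by lia.
      have -> : (m.-1 == i + k) = false by lia.
      have -> : m.-1 < i = false by lia.
      by have -> : (m.-1 == i) = false by lia.
    * have -> : m.-1 < i + k = false by lia.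
      have -> : (m.-1 == i + k) by lia.
      by rewrite lsubst_llift //; lia.
  + have -> : m < (i + k).+1 by lia.
    by rewrite /= mi ltnn eqxx llift_lsubst.
Qed.

(** * Unfolding leading recursions by a function *)

Definition lstep (T : ltype) : ltype := if T is LMu U then lsubst 0 T U else T.

Fixpoint mus (T : ltype) : nat := if T is LMu U then (mus U).+1 else 0.

(** Total version of [unfolds]. For a contractive type each step removes one leading recursion and
    adds none, so [mus T] steps reach the head. For any other type the result is still a recursion,
    which signals that no unfolding exists. *)
Definition unf (T : ltype) : ltype := iter (mus T) lstep T.

(* [noncontr k T]: T is mu^n.t with t bound by one of these recursions or by
   one of k enclosing ones. *)
Fixpoint noncontr (k : nat) (T : ltype) : bool :=
  match T with LMu U => noncontr k.+1 U | LVar m => m < k | _ => false end.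

Lemma noncontr_llift d k i T : noncontr i T -> noncontr (k + i) (llift d i T).
Proof.
elim/ltype_nest_ind: T i => //= [T IH|n] i; first by rewrite -addnS; exact: IH.
by move=> ni; rewrite ni; lia.
Qed.

Lemma noncontr_lsubst k U T :
  noncontr 0 U -> noncontr k.+1 T -> noncontr k (lsubst k U T).
Proof.
move=> hU; elim/ltype_nest_ind: T k => //= [T IH|n] k; first exact: IH.
by case: (ltngtP n k) => [||->] //= *; [lia|have := @noncontr_llift k k 0 U hU; rewrite addn0].
Qed.

(** New leading recursions could only appear if [U] landed directly under those of [T], that is, if
    the head variable were the substituted one. *)
Lemma mus_lsubst k U T : ~~ noncontr k.+1 T -> mus (lsubst k U T) = mus T.
Proof.
elim/ltype_nest_ind: T k => //= [T IH|n] k h; first by rewrite IH.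
by case: (ltngtP n k) h => //; lia.
Qed.

Lemma contr_lsubst k U T : ~~ noncontr k.+1 T -> ~~ noncontr k (lsubst k U T).
Proof.
elim/ltype_nest_ind: T k => //= [T IH|n] k h; first exact: IH.
by case: (ltngtP n k) h => /=; lia.
Qed.

Lemma noncontr_step T : noncontr 0 T -> noncontr 0 (lstep T).
Proof. by case: T => //= T h; apply: noncontr_lsubst. Qed.


(** Unfolding preserves non-contractiveness, and at level 0 only a recursion can be non-contractive,
    since a variable would need an index below 0. *)
Lemma noncontr_unf T : noncontr 0 T -> is_mu (unf T).
Proof.
move=> h; suff: noncontr 0 (unf T) by case: (unf T).
by rewrite /unf; elim: (mus T) => //= n; exact: noncontr_step.
Qed.

Lemma unf_step T : ~~ noncontr 0 T -> unf (lstep T) = unf T.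
Proof.
by case: T => //= T h; rewrite /unf mus_lsubst // -[RHS]/(iter (mus T).+1 lstep (LMu T)) iterSr.
Qed.

Lemma unf_nmu T : ~~ is_mu T -> unf T = T.
Proof. by case: T. Qed.

Lemma unf_contr T : ~~ noncontr 0 T -> unfolds T (unf T).
Proof.
move En: (mus T) => n; elim: n T En => [|n IHn].
  by case=> //= *; apply: unfolds_head.
case=> // T [En] h; have h' := @contr_lsubst 0 (LMu T) T h.
by apply: unfolds_mu; rewrite -(unf_step h); apply: IHn; rewrite //= mus_lsubst.
Qed.

Lemma unfoldsP T U : unfolds T U <-> ~~ is_mu U /\ U = unf T.
Proof.
split=> [|[nU eU]]; last first.
  rewrite eU; apply: unf_contr; apply: contra nU => /noncontr_unf.
  by rewrite -eU.
have contr X Y : unfolds X Y -> ~~ noncontr 0 X.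
  elim=> {X Y} [[]//|X Y _]; apply: contra; exact: (@noncontr_step (LMu X)).
elim=> {T U} [T nT|T U hU [nU eU]]; split=> //; first by rewrite unf_nmu.
rewrite eU -[LHS]/(unf (lstep (LMu T))) unf_step //.
exact: contra (@noncontr_step (LMu T)) (contr _ _ hU).
Qed.

(** * Deciding equality of local types *)

Definition labels (T : ltype) : seq label :=
  match T with LSel _ bs => map fst bs | LBra _ bs => map fst bs | _ => [::] end.

(** Meaningful for labels of [T] only; elsewhere [LEnd] is a filler that keeps the function
    total. *)
Definition child (l : label) (T : ltype) : ltype :=
  match T with
  | LSel _ bs => if assoc l bs is Some x then x.2 else LEnd
  | LBra _ bs => if assoc l bs is Some x then x.2 else LEnd
  | _ => LEnd
  end.

Definition iprob_eqb (d d' : iprob) : bool := (ilo d == ilo d') && (ihi d == ihi d').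

Lemma iprob_eqP d d' : reflect (d = d') (iprob_eqb d d').
Proof.
case: d d' => [a b p] [a' b' p']; apply: (iffP idP) => [/andP[/= /eqP ea /eqP eb]|->]; last by rewrite /iprob_eqb !eqxx.
by move: p'; rewrite -ea -eb => p'; rewrite (bool_irrelevance p p').
Qed.

(* [ei] compares the intervals. *)
Definition headg (ei : rel iprob) (T U : ltype) : bool :=
  match T, U with
  | LSel r bs, LSel r' bs' =>
      (r == r') && fam_rel (fun x y => ei x.1.1 y.1.1 && (x.1.2 == y.1.2)) bs bs'
  | LBra r bs, LBra r' bs' => (r == r') && fam_rel (fun x y => x.1 == y.1) bs bs'
  | LVar m, LVar n => m == n
  | LEnd, LEnd => true
  | _, _ => false
  end.

Definition headeq := headg iprob_eqb.

(** Separates a Boolean test on the heads from the demand on the children. In this form the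
    bisimulation condition can be iterated by a program. *)
Lemma same_headP (R : ltype -> ltype -> Prop) T U :
  same_head R T U <->
  headeq T U /\ forall l, l \in labels T -> R (child l T) (child l U).
Proof.
case: T U => [r bs|r bs|T|m|] [r' bs'|r' bs'|U|n|] //=; try by split=> [[]|[]].
- split=> [[<- h]|[/andP[/eqP<- /fam_relP h] h']].
    split=> [|l /assoc_memP [x ex]].
      rewrite eqxx; apply/fam_relP => l; have := h l; rewrite /opt_rel.
      case: (assoc l bs) => [[[d S] T]|]; case: (assoc l bs') => [[[d' S'] T']|] //= [[-> ->] _].
      by rewrite eqxx andbT; apply/iprob_eqP.
    by have := h l; rewrite /opt_rel ex; case: (assoc l bs') => [y []|].
  split=> // l; have := h l; have := h' l; rewrite assoc_mem.
  case: (assoc l bs) => [[[d S] T]|]; case: (assoc l bs') => [[[d' S'] T']|] //= hR.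
  by move=> /andP[/iprob_eqP-> /eqP->]; split => //; apply: hR.
- split=> [[<- h]|[/andP[/eqP<- /fam_relP h] h']].
    split=> [|l /assoc_memP [x ex]].
      rewrite eqxx; apply/fam_relP => l; have := h l; rewrite /opt_rel.
      by case: (assoc l bs) => [[S T]|]; case: (assoc l bs') => [[S' T']|] //= [-> _].
    by have := h l; rewrite /opt_rel ex; case: (assoc l bs') => [y []|].
  split=> // l; have := h l; have := h' l; rewrite assoc_mem.
  case: (assoc l bs) => [[S T]|]; case: (assoc l bs') => [[S' T']|] //= hR.
  by move=> /eqP->; split => //; apply: hR.
- by split=> [->|[/eqP]].
Qed.

(** The finite approximations of bisimilarity: agreement of the two trees down to depth [n]. *)
Fixpoint teqn (n : nat) (T U : ltype) : bool :=
  if n is n'.+1 then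
    headeq (unf T) (unf U) &&
    all (fun l => teqn n' (child l (unf T)) (child l (unf U))) (labels (unf T))
  else true.

Lemma teqnS n T U : teqn n.+1 T U -> teqn n T U.
Proof.
elim: n T U => // n IHn T U /andP[h /allP a]; apply/andP; split=> //.
by apply/allP => l /a /IHn.
Qed.

Lemma teqn_leq m n T U : m <= n -> teqn n T U -> teqn m T U.
Proof. by move/subnK<-; elim: (n - m) => // k IHk /teqnS. Qed.

Lemma headeq_nmu T U : headeq T U -> ~~ is_mu T /\ ~~ is_mu U.
Proof. by case: T U => [??|??|?|?|] []. Qed.

Lemma type_eq_teqn n T U : type_eq T U -> teqn n T U.
Proof.
case=> R [bR]; elim: n T U => // n IHn T U /bR [T' [U' [/unfoldsP [_ ->] /unfoldsP [_ ->]]]].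
by move=> /same_headP [hh hR] /=; rewrite hh; apply/allP => l /hR /IHn.
Qed.

(* Everything reachable from [T] by unfolding and descending into branches lies
   in [clos T]. *)
Fixpoint clos (T : ltype) : seq ltype :=
  T :: match T with
       | LSel _ bs => flatten [seq clos b.2.2 | b <- bs]
       | LBra _ bs => flatten [seq clos b.2.2 | b <- bs]
       | LMu T' => map (lsubst 0 T) (clos T')
       | _ => [::]
       end.

Fixpoint lsize (T : ltype) : nat :=
  match T with
  | LSel _ bs => (sumn [seq lsize b.2.2 | b <- bs]).+1
  | LBra _ bs => (sumn [seq lsize b.2.2 | b <- bs]).+1
  | LMu T' => (lsize T').+1
  | _ => 1
  end.

(** This is the purpose of [lsize]: it bounds the number of reachable subterms, hence the depth used
    in [teqb]. *)
Lemma size_clos T : size (clos T) = lsize T.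
Proof.
elim/ltype_nest_ind: T => //= [r bs IH|r bs IH|T IH]; last by rewrite size_map IH.
- by rewrite size_flatten /shape -map_comp; congr (sumn _).+1; apply: eq_map_In.
- by rewrite size_flatten /shape -map_comp; congr (sumn _).+1; apply: eq_map_In.
Qed.

Lemma clos_self T : List.In T (clos T).
Proof. by case: T => *; left. Qed.

Lemma child_In_sel l r bs : l \in map fst bs ->
  exists2 x, List.In (l, x) bs & child l (LSel r bs) = x.2.
Proof. by case/assoc_memP => x ex; exists x; [apply: assoc_In|rewrite /= ex]. Qed.

Lemma child_In_bra l r bs : l \in map fst bs ->
  exists2 x, List.In (l, x) bs & child l (LBra r bs) = x.2.
Proof. by case/assoc_memP => x ex; exists x; [apply: assoc_In|rewrite /= ex]. Qed.

Lemma child_lsubst l k M T : l \in labels T ->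
  child l (lsubst k M T) = lsubst k M (child l T).
Proof.
by case: T => //= r bs /assoc_memP [x ex]; rewrite ex;
  rewrite (assoc_mapv (fun b => (b.1, lsubst k M b.2))) ex.
Qed.

Lemma clos_child l T U : List.In U (clos T) -> l \in labels U ->
  List.In (child l U) (clos T).
Proof.
elim/ltype_nest_ind: T U => [r bs /List.Forall_forall IH|r bs /List.Forall_forall IH|T IH|n|] U.
- move=> /= [<- /child_In_sel -/(_ r) [x xbs ->]|/In_flatten[_ /In_map [b bbs ->] Ub] lU].
    right; apply/In_flatten; exists (clos x.2); last exact: clos_self.
    by apply/In_map; exists (l, x).
  right; apply/In_flatten; exists (clos b.2.2); last exact: IH lU.
  by apply/In_map; exists b.
- move=> /= [<- /child_In_bra -/(_ r) [x xbs ->]|/In_flatten[_ /In_map [b bbs ->] Ub] lU].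
    right; apply/In_flatten; exists (clos x.2); last exact: clos_self.
    by apply/In_map; exists (l, x).
  right; apply/In_flatten; exists (clos b.2.2); last exact: IH lU.
  by apply/In_map; exists b.
- move=> /= [<- //|/In_map [V VT ->] lV]; right; apply/In_map.
  (* If [V] were a variable, the substitution would produce a recursion or a variable, and neither
     has labels. *)
  have lV' : l \in labels V.
    by case: V VT lV => //= [r bs|r bs|[|n]]; rewrite ?llift0 // -?map_comp.
  by exists (child l V); [apply: IH|apply: child_lsubst].
- by case=> // <-.
- by case=> // <-.
Qed.

Lemma clos_step T U : List.In U (clos T) -> List.In (lstep U) (clos T).
Proof.
elim/ltype_nest_ind: T U => [r bs /List.Forall_forall IH|r bs /List.Forall_forall IH|T IH|n|] U.
- move=> /= [<-|/In_flatten[_ /In_map [b bbs ->] Ub]]; first by left.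
  by right; apply/In_flatten; exists (clos b.2.2); [apply/In_map; exists b|apply: IH].
- move=> /= [<-|/In_flatten[_ /In_map [b bbs ->] Ub]]; first by left.
  by right; apply/In_flatten; exists (clos b.2.2); [apply/In_map; exists b|apply: IH].
(* Serves the case where [V] is the variable of this recursion: the substitution turns it back into
   [LMu T], whose unfolding is the type in question. *)
- have TT : List.In (lsubst 0 (LMu T) T) (clos (LMu T)).
    by right; apply/In_map; exists T => //; exact: clos_self.
  move=> [<- //|/In_map [V VT ->]].
  have VT' : List.In (lsubst 0 (LMu T) V) (clos (LMu T)) by right; apply/In_map; exists V.
  case: V VT VT' => [r bs|r bs|V|[|n]|] VT VT' //; last by rewrite /= llift0.
  (* For an inner recursion, unfold it before substituting for the outer one; the two operations
     commute. *)
  right; apply/In_map; exists (lsubst 0 (LMu V) V); first exact: (IH (LMu V)).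
  by rewrite -[0 in RHS]addn0 lsubst_lsubst.
- by case=> // <-; left.
- by case=> // <-; left.
Qed.

Lemma clos_unf T U : List.In U (clos T) -> List.In (unf U) (clos T).
Proof. by rewrite /unf => UT; elim: (mus U) => //= n; exact: clos_step. Qed.

(** Turns a stable count of related pairs into a stable relation. *)
Lemma sub_count_eq (A : Type) (p q : pred A) (s : seq A) :
  (forall x, q x -> p x) -> count q s = count p s ->
  forall x, List.In x s -> p x -> q x.
Proof.
move=> qp; elim: s => //= y s IHs h; have := sub_count qp s => hs.
have := qp y => hy; case qy: (q y) hy h => hy h x [<-|xs] px //; move: h.
- by rewrite hy // => /addnI h; exact: IHs.
- by rewrite px; lia.
- by move=> h; apply: IHs => //; lia.
Qed.

(** Every step before stabilisation lowers the value by at least one, which is possible at most [N]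
    times. *)
Lemma stable_count (c : nat -> nat) N :
  c 0 <= N -> (forall n, c n.+1 <= c n) -> exists2 n, n <= N & c n.+1 = c n.
Proof.
elim: N c => [|N IHN] c c0 dc; first by exists 0 => //; have := dc 0; lia.
case: (eqVneq (c 1) (c 0)) => [e|ne]; first by exists 0.
have [||n nN e] := IHN (c \o succn); [|by move=> n; exact: dc|by exists n.+1].
by have := dc 0 => /=; lia.
Qed.

(** The depth is the number of pairs formed from [clos T] and [clos U]. *)
Definition teqb (T U : ltype) : bool := teqn (lsize T * lsize U) T U.

Lemma teqbP T U : reflect (type_eq T U) (teqb T U).
Proof.
apply: (iffP idP) => [h|]; last exact: type_eq_teqn.
pose L := [seq (X, Y) | X <- clos T, Y <- clos U].
(* Count the pairs that agree to depth [n]. At a depth where the count does not drop, agreement to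
   depth [n] already implies agreement to depth [n.+1], so this relation, restricted to reachable
   pairs, is a bisimulation. *)
have [||n nN en] := @stable_count (fun n => count (fun p => teqn n p.1 p.2) L) (size L).
- exact: count_size.
- by move=> n; apply: sub_count => p; exact: teqnS.
have inL X Y : List.In X (clos T) -> List.In Y (clos U) -> List.In (X, Y) L.
  move=> hX hY; apply/In_flatten; exists [seq (X, Z) | Z <- clos U]; apply/In_map.
    by exists X.
  by exists Y.
have sub := sub_count_eq (fun p => @teqnS n p.1 p.2) en.
exists (fun X Y => [/\ List.In X (clos T), List.In Y (clos U) & teqn n X Y]); split.
  move=> X Y [hX hY /(sub (X, Y) (inL _ _ hX hY)) /andP[hh /allP ha]].
  exists (unf X), (unf Y); have [mX mY] := headeq_nmu hh.
  split; try exact/unfoldsP; apply/same_headP; split=> // l lX.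
  split; [apply: clos_child lX|apply: clos_child|exact: ha]; try exact: clos_unf.
  move: hh lX; case: (unf X) (unf Y) => [r bs|r bs|?|?|] [r' bs'|r' bs'|?|?|] //=;
  by move=> /andP[_ /fam_relP /(_ l)]; rewrite !assoc_mem; case: (assoc l bs); case: (assoc l bs').
split; try exact: clos_self.
(* The stable depth is at most the number of pairs, which is the depth that [teqb] tests. *)
by apply: teqn_leq h; rewrite -!size_clos -(size_allpairs pair).
Qed.

Lemma type_eqP T U : type_eq T U <-> forall n, teqn n T U.
Proof. by split=> [h n|h]; [exact: type_eq_teqn|apply/teqbP/h]. Qed.

(** * Well-formed types and the laws of [type_eq] *)

Lemma wf_ltype_weaken k m T : k <= m -> wf_ltype k T -> wf_ltype m T.
Proof.
elim/ltype_nest_ind: T k m => //= [r bs|r bs|T IH|n] => [/List.Forall_forall IH|/List.Forall_forall IH||] k m km.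
- by case/andP=> -> /allIn h; apply/allIn => b bb; apply: IH (h b bb).
- by case/andP=> -> /allIn h; apply/allIn => b bb; apply: IH (h b bb).
- by case/andP=> -> /=; apply: IH.
- by move=> h; apply: leq_trans km.
Qed.

Lemma wf_lunguarded k n T : k <= n -> wf_ltype k T -> lunguarded n T = false.
Proof.
elim/ltype_nest_ind: T k n => //= [T IH|m] k n kn.
  by case/andP=> _; exact: IH.
by move=> mk; apply/eqP; lia.
Qed.

Lemma wf_llift k d T : wf_ltype k T -> llift d k T = T.
Proof.
elim/ltype_nest_ind: T k => //= [r bs|r bs|T IH|n] => [/List.Forall_forall IH|/List.Forall_forall IH||] k.
- case/andP=> _ /allIn h; congr LSel; rewrite -[RHS]map_id; apply: eq_map_In.
  by apply/List.Forall_forall => -[? [? ?]] bb /=; rewrite (IH _ bb _ (h _ bb)).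
- case/andP=> _ /allIn h; congr LBra; rewrite -[RHS]map_id; apply: eq_map_In.
  by apply/List.Forall_forall => -[? [? ?]] bb /=; rewrite (IH _ bb _ (h _ bb)).
- by case/andP=> _ /IH ->.
- by move=> ->.
Qed.

Lemma wf_lsubst_id k U T : wf_ltype k T -> lsubst k U T = T.
Proof.
elim/ltype_nest_ind: T k => //= [r bs|r bs|T IH|n] => [/List.Forall_forall IH|/List.Forall_forall IH||] k.
- case/andP=> _ /allIn h; congr LSel; rewrite -[RHS]map_id; apply: eq_map_In.
  by apply/List.Forall_forall => -[? [? ?]] bb /=; rewrite (IH _ bb _ (h _ bb)).
- case/andP=> _ /allIn h; congr LBra; rewrite -[RHS]map_id; apply: eq_map_In.
  by apply/List.Forall_forall => -[? [? ?]] bb /=; rewrite (IH _ bb _ (h _ bb)).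
- by case/andP=> _ /IH ->.
- by move=> ->.
Qed.

Lemma lunguarded_lsubst n k U T : n <= k -> wf_ltype 0 U ->
  lunguarded n (lsubst k.+1 U T) = lunguarded n T.
Proof.
move=> nk wU; elim/ltype_nest_ind: T n k nk => //= [T IH|m] n k nk; first exact: IH.
case: (ltngtP m k.+1) => //= mk; first by apply/eqP/eqP; lia.
rewrite (wf_llift _ wU) (wf_lunguarded _ wU) //; apply/esym/eqP; lia.
Qed.

Lemma wf_lsubst k U T : wf_ltype 0 U -> wf_ltype k.+1 T -> wf_ltype k (lsubst k U T).
Proof.
move=> wU; elim/ltype_nest_ind: T k => //= [r bs|r bs|T IH|m] => [/List.Forall_forall IH|/List.Forall_forall IH||] k.
- rewrite /wf_fam size_map -map_comp; case/andP=> /andP[-> /= ->] /allIn h.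
  by apply/allIn => _ /In_map[b bb ->]; apply: IH (h b bb).
- rewrite /wf_fam size_map -map_comp; case/andP=> /andP[-> /= ->] /allIn h.
  by apply/allIn => _ /In_map[b bb ->]; apply: IH (h b bb).
- by case/andP=> h /IH ->; rewrite lunguarded_lsubst // h.
- case: (ltngtP m k) => //= mk h; first by lia.
  by rewrite (wf_llift _ wU); apply: wf_ltype_weaken wU.
Qed.

Lemma wf_unf T : wf_ltype 0 T -> wf_ltype 0 (unf T).
Proof.
rewrite /unf => wT; elim: (mus T) => //= n; case: (iter _ _ _) => //= U.
by move=> wU; have /andP[_ wU'] := wU; apply: wf_lsubst.
Qed.

Lemma wf_child l T : wf_ltype 0 T -> wf_ltype 0 (child l T).
Proof.
case: T => //= r bs /andP[_ /allIn h]; case E: (assoc l bs) => [x|] //;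
  exact: (h _ (assoc_In E)).
Qed.

(** The head variable of a non-contractive [T] is bound by a recursion with no communication in
    between. That recursion is an enclosing one, since a leading recursion of [T] itself would
    violate well-formedness. *)
Lemma wf_noncontr k j T : wf_ltype k T -> noncontr j T ->
  exists2 n, n < j & lunguarded n T.
Proof.
elim/ltype_nest_ind: T k j => //= [T IH|m] k j; last by exists m.
case/andP=> h wT /(IH _ _ wT) [[|n] nj u]; first by rewrite u in h.
by exists n.
Qed.

Lemma wf_contr T : wf_ltype 0 T -> ~~ noncontr 0 T.
Proof. by move=> wT; apply/negP => /(wf_noncontr wT) []. Qed.

Lemma headeq_refl T : ~~ is_mu T -> headeq T T.
Proof.
by case: T => //= r bs _; rewrite eqxx; apply/fam_relP => l;
  case: (assoc l bs) => // -[[? ?] ?] /=; rewrite ?eqxx ?andbT //; apply/iprob_eqP.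
Qed.

Lemma headeq_sym T U : headeq T U -> headeq U T.
Proof.
case: T U => [r bs|r bs|T|m|] [r' bs'|r' bs'|U|n|] //=; last by rewrite eq_sym.
  case/andP=> /eqP-> /fam_relP h; rewrite eqxx; apply/fam_relP => l; have := h l.
  case: (assoc l bs) => [[[d S] T]|]; case: (assoc l bs') => [[[d' S'] T']|] //=.
  by case/andP=> /iprob_eqP-> /eqP->; rewrite eqxx andbT; apply/iprob_eqP.
case/andP=> /eqP-> /fam_relP h; rewrite eqxx; apply/fam_relP => l; have := h l.
by case: (assoc l bs) => [[S T]|]; case: (assoc l bs') => [[S' T']|] //= /eqP->.
Qed.

Lemma headeq_trans U T V : headeq T U -> headeq U V -> headeq T V.
Proof.
case: T U V => [r bs|r bs|T|m|] [r' bs'|r' bs'|U|n|] [r2 bs2|r2 bs2|V|p|] //=;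
  last by move/eqP->.
  case/andP=> /eqP-> /fam_relP h /andP[/eqP-> /fam_relP h'].
  rewrite eqxx; apply/fam_relP => l; move: (h l) (h' l).
  case: (assoc l bs) (assoc l bs') (assoc l bs2) => [[[d S] T]|] [[[d' S'] T']|] [[[d2 S2] T2]|] //=.
  by case/andP=> /iprob_eqP-> /eqP->.
case/andP=> /eqP-> /fam_relP h /andP[/eqP-> /fam_relP h'].
rewrite eqxx; apply/fam_relP => l; move: (h l) (h' l).
by case: (assoc l bs) (assoc l bs') (assoc l bs2) => [[S T]|] [[S' T']|] [[S2 T2]|] //= /eqP->.
Qed.

Lemma headeq_labels T U : headeq T U -> labels T =i labels U.
Proof.
by case: T U => [r bs|r bs|?|?|] [r' bs'|r' bs'|?|?|] //= /andP[_ /fam_relP h] l;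
  have := h l; rewrite !assoc_mem; case: (assoc l bs); case: (assoc l bs').
Qed.

(** The fixed-point equation of equality. With it, the laws below follow by induction on the depth,
    without exhibiting bisimulations. *)
Lemma type_eqE T U : type_eq T U <->
  headeq (unf T) (unf U) /\
  forall l, l \in labels (unf T) -> type_eq (child l (unf T)) (child l (unf U)).
Proof.
split=> [/type_eqP h|[hh hc]].
  split; first by have /andP[] := h 1.
  by move=> l lT; apply/type_eqP => n; have /andP[_ /allP/(_ l lT)] := h n.+1.
apply/type_eqP => -[//|n] /=; rewrite hh; apply/allP => l /hc.
exact: type_eq_teqn.
Qed.

(** Well-formedness provides contractiveness: a type without an unfolding is not even equal to
    itself. *)
Lemma type_eq_refl T : wf_ltype 0 T -> type_eq T T.
Proof.
move=> wT; apply/type_eqP => n; elim: n T wT => //= n IHn T wT; apply/andP; split.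
  by apply: headeq_refl; have /unf_contr/unfoldsP [] := wf_contr wT.
by apply/allP => l _; apply/IHn/wf_child/wf_unf.
Qed.

Lemma type_eq_sym T U : type_eq T U -> type_eq U T.
Proof.
move=> h; apply/type_eqP => n; elim: n T U h => //= n IHn T U /type_eqE [hh hc].
rewrite headeq_sym //; apply/allP => l; rewrite -(headeq_labels hh) => /hc; exact: IHn.
Qed.

Lemma type_eq_trans U T V : type_eq T U -> type_eq U V -> type_eq T V.
Proof.
move=> h h'; apply/type_eqP => n; elim: n T U V h h' => //= n IHn T U V /type_eqE [hh hc] /type_eqE [hh' hc'].
rewrite (headeq_trans hh hh'); apply/allP => l lT; apply: IHn (hc _ lT) (hc' _ _).
by rewrite -(headeq_labels hh).
Qed.

Lemma type_eq_unf T : wf_ltype 0 T -> type_eq T (unf T).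
Proof.
move=> wT; apply/type_eqE; have /unf_contr/unfoldsP [mT _] := wf_contr wT.
rewrite (unf_nmu mT); split=> [|l _]; first exact: headeq_refl.
exact/type_eq_refl/wf_child/wf_unf.
Qed.

(** The bound variable does not occur in the closed type [T], so unfolding [LMu T] gives [T]. This
    allows [LMu] to be used as a marker that does not change the tree. *)
Lemma type_eq_mu T : wf_ltype 0 T -> type_eq (LMu T) T.
Proof.
move=> wT; have wM : wf_ltype 0 (LMu T).
  by rewrite /= (wf_lunguarded _ wT) // (wf_ltype_weaken _ wT).
apply/type_eqE; rewrite -(unf_step (wf_contr wM)) /= (wf_lsubst_id _ wT).
by apply/type_eqE/type_eq_refl.
Qed.

(** * Projection *)

Fixpoint gtype_nest_ind (P : gtype -> Prop)
  (Hmsg : forall p q bs, List.Forall (fun b => P b.2.2) bs -> P (GMsg p q bs))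
  (Hmu : forall G, P G -> P (GMu G)) (Hvar : forall n, P (GVar n)) (Hend : P GEnd)
  (G : gtype) : P G :=
  match G with
  | GMsg p q bs => Hmsg p q bs
      ((fix go (s : fam (iprob * sort * gtype)) : List.Forall (fun b => P b.2.2) s :=
         match s with
         | [::] => List.Forall_nil _
         | b :: s' => List.Forall_cons b (gtype_nest_ind Hmsg Hmu Hvar Hend b.2.2) (go s')
         end) bs)
  | GMu G' => Hmu G' (gtype_nest_ind Hmsg Hmu Hvar Hend G')
  | GVar n => Hvar n
  | GEnd => Hend
  end.

Definition sequence (A : Type) (s : seq (option A)) : option (seq A) :=
  foldr (fun x acc => if x is Some a then if acc is Some t then Some (a :: t) else None
                      else None) (Some [::]) s.

Lemma sequenceP (A B : Type) (f : A -> option B) s t :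
  sequence (map f s) = Some t <-> Forall2 (fun x y => f x = Some y) s t.
Proof.
elim: s t => [|x s IHs] t /=.
  by split=> [[<-]|h]; [constructor|inversion h].
split=> [|h]; last first.
  inversion_clear h as [|? y ? t' fx]; rewrite fx.
  by have /IHs -> : Forall2 (fun x y => f x = Some y) s t' by [].
case E: (f x) => [y|] //; case E': (sequence _) => [t'|] // [<-].
by constructor=> //; apply/IHs.
Qed.

Definition proj_msg (p q r : role) (bs : fam (iprob * sort * gtype)) (Ts : seq ltype) :
    option ltype :=
  if r == p then Some (LSel q [seq (x.1.1, (x.1.2.1, x.2)) | x <- zip bs Ts])
  else if r == q then Some (LBra p [seq (x.1.1, (x.1.2.1.2, x.2)) | x <- zip bs Ts])
  else if Ts is T :: Ts' then if all (teqb T) Ts' then Some T else None else None.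

Fixpoint projf (G : gtype) (r : role) : option ltype :=
  match G with
  | GMsg p q bs =>
      obind (proj_msg p q r bs) (sequence [seq projf b.2.2 r | b <- bs])
  | GMu G' =>
      if (r \in pid G') || ~~ gclosed 0 (GMu G') then omap LMu (projf G' r) else Some LEnd
  | GVar n => Some (LVar n)
  | GEnd => Some LEnd
  end.

Lemma Forall_teqb T Ts : List.Forall (type_eq T) Ts <-> all (teqb T) Ts.
Proof.
elim: Ts => [|U Ts IH] /=; first by split.
split=> [h|/andP[/teqbP h /IH]]; last by constructor.
by inversion_clear h; rewrite (introT (teqbP _ _)) //; apply/IH.
Qed.

(** Projection is functional although continuations are compared up to [type_eq], because
    [proj_other] returns the projection of the first branch itself. Well-formedness gives distinct
    sender and receiver, so the order of the tests in [proj_msg] is immaterial. *)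
Lemma projP k G r T : wf_gtype k G -> proj G r T <-> projf G r = Some T.
Proof.
elim/gtype_nest_ind: G k T => [p q bs /List.Forall_forall IH|G IH|n|] k T /=.
- case/and3P=> npq _ /allIn wbs.
  have seqE Ts : Forall2 (fun b U => proj b.2.2 r U) bs Ts <->
                 sequence [seq projf b.2.2 r | b <- bs] = Some Ts.
    rewrite sequenceP; elim: bs IH wbs Ts => [|b bs IHbs] IH wbs Ts.
      by split=> h; inversion h; constructor.
    have [H1 H2] : (forall U, proj b.2.2 r U <-> projf b.2.2 r = Some U) /\
        (forall Ts, Forall2 (fun b U => proj b.2.2 r U) bs Ts <->
           Forall2 (fun x y => projf x.2.2 r = Some y) bs Ts).
      split; first by move=> U; apply: (IH _ _ k); [left|apply: wbs; left].
      by apply: IHbs => [x xb|x xb]; [apply: IH; right|apply: wbs; right].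
    by split=> h; inversion_clear h; constructor; try exact/H1; exact/H2.
  split=> [h|].
    inversion h as [p0 q0 bs0 Ts e1|p0 q0 bs0 Ts e1|p0 q0 r0 bs0 T0 Ts rp rq hf hT| | | |]; subst.
    + by have /seqE -> := e1; rewrite /= /proj_msg eqxx.
    + by have /seqE -> := e1; rewrite /= /proj_msg eqxx eq_sym (negPf npq).
    + have /seqE -> := hf; rewrite /= /proj_msg.
      move/eqP/negPf: rp => ->; move/eqP/negPf: rq => ->.
      by have /Forall_teqb -> := hT.
  case E: (sequence _) => [Ts|] //=; have /seqE hTs := E.
  rewrite /proj_msg; case: eqP => [er|rp]; first by move=> [<-]; subst; apply: proj_send.
  case: eqP => [er|rq]; first by move=> [<-]; subst; apply: proj_recv.
  case: Ts {E} hTs => // T0 Ts hTs; case: ifP => // /Forall_teqb hT [<-].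
  exact: proj_other hT.
- case/andP=> _ wG; split=> [h|].
    inversion_clear h as [| | |? ? T' c hp|? ? np c| |].
      by move: c => /= ->; have /(IH _ _ wG) -> := hp.
    by move: c; rewrite (negPf np) /= => ->.
  case: ifP => [c|/norP[np]].
    case E: (projf G r) => [U|] //= [<-]; apply: proj_mu => //.
    by apply/(IH _ _ wG).
  by rewrite negbK => c [<-]; apply: proj_mu_end.
- by split=> [h|[<-]]; [inversion h|constructor].
- by split=> [h|[<-]]; [inversion h|constructor].
Qed.

(** * Checking a process one channel at a time *)

Fixpoint proc_nest_ind (P : proc -> Prop)
  (Hsel : forall c r bs, List.Forall (fun b => P b.2.2) bs -> P (PSel c r bs))
  (Hbra : forall c r bs, List.Forall (fun b => P b.2.2) bs -> P (PBra c r bs))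
  (Hnew : forall G Q, P Q -> P (PNew G Q))
  (Hdef : forall Ss Ts Q R, P Q -> P R -> P (PDef Ss Ts Q R))
  (Hcall : forall X vs cs, P (PCall X vs cs)) (Hnil : P PNil)
  (Hpar : forall Q R, P Q -> P R -> P (PPar Q R)) (Q : proc) : P Q :=
  let rec := proc_nest_ind Hsel Hbra Hnew Hdef Hcall Hnil Hpar in
  match Q with
  | PSel c r bs => Hsel c r bs
      ((fix go (s : fam ((prob * value) * proc)) : List.Forall (fun b => P b.2.2) s :=
         match s with
         | [::] => List.Forall_nil _
         | b :: s' => List.Forall_cons b (rec b.2.2) (go s')
         end) bs)
  | PBra c r bs => Hbra c r bs
      ((fix go (s : fam (sort * proc)) : List.Forall (fun b => P b.2.2) s :=
         match s with
         | [::] => List.Forall_nil _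
         | b :: s' => List.Forall_cons b (rec b.2.2) (go s')
         end) bs)
  | PNew G Q => Hnew G Q (rec Q)
  | PDef Ss Ts Q R => Hdef Ss Ts Q R (rec Q) (rec R)
  | PCall X vs cs => Hcall X vs cs
  | PNil => Hnil
  | PPar Q R => Hpar Q R (rec Q) (rec R)
  end.

Definition unshift_chan (c : chan) : option chan :=
  match c with
  | CVar x => Some (CVar x)
  | CRole 0 _ => None
  | CRole s.+1 r => Some (CRole s r)
  end.

(** The body of a definition contributes nothing: it may use only the parameters of the definition,
    a condition enforced by [def_ok]. *)
Fixpoint fc (P : proc) : seq chan :=
  match P with
  | PSel c _ bs => c :: flatten [seq fc b.2.2 | b <- bs]
  | PBra c _ bs => c :: flatten [seq fc b.2.2 | b <- bs]
  | PNew _ P' => pmap unshift_chan (fc P')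
  | PDef _ _ _ Q => fc Q
  | PCall _ _ cs => cs
  | PNil => [::]
  | PPar P' Q => fc P' ++ fc Q
  end.

Definition vsort (Gam : sorting) (v : value) : option sort :=
  match v with VVar x => onth (svals Gam) x | VLit B _ => Some B end.

Definition sel_head (Gam : sorting) (r : role) (bs : fam ((prob * value) * proc))
    (T : ltype) : bool :=
  if T is LSel r' ts then
    (r == r') &&
    fam_rel (fun x y => (vsort Gam x.1.2 == Some y.1.2) && in_iprob x.1.1 y.1.1) bs ts
  else false.

Definition bra_head (r : role) (bs : fam (sort * proc)) (T : ltype) : bool :=
  if T is LBra r' ts then (r == r') && fam_rel (fun x y => x.1 == y.1) bs ts
  else false.

Definition call_types (Gam : sorting) (X : nat) : seq ltype :=
  if onth (sprocs Gam) X is Some x then x.2 else [::].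

(* [check Gam P d T]: P may be typed with T for the channel d, all other
   channels being ignored. *)
Fixpoint check (Gam : sorting) (P : proc) (d : chan) (T : ltype) : bool :=
  match P with
  | PSel c r bs =>
      ((c == d) ==> sel_head Gam r bs (unf T)) &&
      all (fun b => check Gam b.2.2 d (if c == d then child b.1 (unf T) else T)) bs
  | PBra c r bs =>
      ((c == d) ==> bra_head r bs (unf T)) &&
      all (fun b => check (add_vals [:: b.2.1] Gam) b.2.2 d
                      (if c == d then child b.1 (unf T) else T)) bs
  | PNew _ P' => check Gam P' (shift_chan d) T
  | PDef Ss Ts _ Q => check (add_proc Ss Ts Gam) Q d T
  | PCall X _ cs => teqb T (odflt LEnd (assoc d (zip cs (call_types Gam X))))
  | PNil => teqb T LEnd
  | PPar P' Q => if d \in fc Q then check Gam Q d T else check Gam P' d T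
  end.

(** The annotation [G] determines the types of the new channels, so they are checked here once and
    for all. The second conjunct forbids using a role of the session that does not take part in [G],
    as such a channel would have no type. *)
Definition new_ok (Gam : sorting) (G : gtype) (P : proc) : bool :=
  all (fun r => if projf G r is Some T then wf_ltype 0 T && check Gam P (CRole 0 r) T
                else false) (pid G) &&
  all (fun c => if c is CRole 0 r then r \in pid G else true) (fc P).

Definition def_ok (Gam : sorting) (Ts : seq ltype) (P : proc) : bool :=
  all (fun c => if c is CVar x then x < size Ts else false) (fc P) &&
  all (fun x => check Gam P (CVar x.1) x.2) (zip (iota 0 (size Ts)) Ts).

Definition call_ok (Gam : sorting) (X : nat) (vs : seq value) (cs : seq chan) : bool :=
  if onth (sprocs Gam) X is Some x then
    [&& size cs == size x.2, uniq cs, size vs == size x.1 &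
        all (fun y => vsort Gam y.1 == Some y.2) (zip vs x.1)]
  else false.

(* The part of typability that does not depend on the types of the free
   channels. *)
Fixpoint ok (Gam : sorting) (P : proc) : bool :=
  match P with
  | PSel _ _ bs =>
      (\sum_(b <- bs) sval b.2.1.1 == 1)%R && all (fun b => ok Gam b.2.2) bs
  | PBra _ _ bs => all (fun b => ok (add_vals [:: b.2.1] Gam) b.2.2) bs
  | PNew G P' => new_ok Gam G P' && ok Gam P'
  | PDef Ss Ts P' Q =>
      [&& def_ok (add_vals Ss (add_proc Ss Ts Gam)) Ts P',
          ok (add_vals Ss (add_proc Ss Ts Gam)) P' & ok (add_proc Ss Ts Gam) Q]
  | PCall X vs cs => call_ok Gam X vs cs
  | PNil => true
  | PPar P' Q => [&& all (fun c => c \notin fc Q) (fc P'), ok Gam P' & ok Gam Q]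
  end.

Lemma has_sortP Gam v S : has_sort Gam v S <-> vsort Gam v = Some S.
Proof.
split=> [[x S' //|S' k //]|]; case: v => [x|S' k] /=; first exact: TVar.
by case=> <-; exact: TVal.
Qed.

Lemma shift_chanK d : unshift_chan (shift_chan d) = Some d.
Proof. by case: d. Qed.

Lemma mem_fc_new d s : (d \in pmap unshift_chan s) = (shift_chan d \in s).
Proof.
rewrite mem_pmap; apply/mapP/idP => [[[x|[|i] r]] //= h [->] //|h].
by exists (shift_chan d); rewrite ?shift_chanK.
Qed.

Lemma sel_headP Gam r bs T :
  sel_head Gam r bs T ->
  map fst bs =i labels T /\
  exists2 ts, T = LSel r ts &
    forall l x, assoc l bs = Some x -> exists y,
    [/\ assoc l ts = Some y, vsort Gam x.1.2 = Some y.1.2 & in_iprob x.1.1 y.1.1].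
Proof.
case: T => //= r' ts /andP[/eqP<- /fam_relP h]; split=> [l|].
  by have := h l; rewrite !assoc_mem; case: (assoc l bs); case: (assoc l ts).
exists ts => // l x ex; have := h l; rewrite ex.
by case: (assoc l ts) => [y|] // /andP[/eqP hs hp]; exists y.
Qed.

Lemma bra_headP r bs T :
  bra_head r bs T ->
  map fst bs =i labels T /\
  exists2 ts, T = LBra r ts &
    forall l x, assoc l bs = Some x -> exists2 y, assoc l ts = Some y & x.1 = y.1.
Proof.
case: T => //= r' ts /andP[/eqP<- /fam_relP h]; split=> [l|].
  by have := h l; rewrite !assoc_mem; case: (assoc l bs); case: (assoc l ts).
exists ts => // l x ex; have := h l; rewrite ex.
by case: (assoc l ts) => [y|] // /eqP; exists y.
Qed.

Lemma sel_head_eq Gam r bs T U : headeq T U -> sel_head Gam r bs T -> sel_head Gam r bs U.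
Proof.
case: T U => // r1 ts [] //= r2 us /andP[/eqP<- /fam_relP h] /andP[-> /fam_relP h'].
apply/fam_relP => l; move: (h l) (h' l).
case: (assoc l bs) (assoc l ts) (assoc l us) => [[[p v] P]|] [[[d S] T]|] [[[d' S'] T']|] //=.
by case/andP=> /iprob_eqP-> /eqP->.
Qed.

Lemma bra_head_eq r bs T U : headeq T U -> bra_head r bs T -> bra_head r bs U.
Proof.
case: T U => // r1 ts [] //= r2 us /andP[/eqP<- /fam_relP h] /andP[-> /fam_relP h'].
apply/fam_relP => l; move: (h l) (h' l).
by case: (assoc l bs) (assoc l ts) (assoc l us) => [[S P]|] [[S1 T1]|] [[S2 T2]|] //= /eqP->.
Qed.

Lemma In_fst (K : eqType) (V : Type) (x : K * V) (s : seq (K * V)) :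
  List.In x s -> x.1 \in map fst s.
Proof. by move=> xs; apply/In_mem/In_map; exists x. Qed.

(** [check] inspects a type only through its unfolded head, its children and [teqb], all of which
    respect [type_eq]. This is what accommodates the rule [TEq]. *)
Lemma check_eq Gam P d T U : type_eq T U -> check Gam P d T -> check Gam P d U.
Proof.
elim/proc_nest_ind: P Gam d T U =>
  [c r bs|c r bs|G P IH|Ss Ts P Q IHP IHQ|X vs cs||P Q IHP IHQ] /=;
  [move=> /List.Forall_forall IH|move=> /List.Forall_forall IH|..] => Gam d T U TU.
- case/andP=> h /allIn a; have [hh hc] := (type_eqE T U).1 TU.
  have -> : (c == d) ==> sel_head Gam r bs (unf U).
    by apply/implyP => /(implyP h); apply: sel_head_eq.
  apply/allIn => b bb; apply: IH (a b bb) => //.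
  case: eqP h => // _ /= /sel_headP[hl _]; apply: hc.
  by rewrite -hl; apply: In_fst.
- case/andP=> h /allIn a; have [hh hc] := (type_eqE T U).1 TU.
  have -> : (c == d) ==> bra_head r bs (unf U).
    by apply/implyP => /(implyP h); apply: bra_head_eq.
  apply/allIn => b bb; apply: IH (a b bb) => //.
  case: eqP h => // _ /= /bra_headP[hl _]; apply: hc.
  by rewrite -hl; apply: In_fst.
- exact: IH.
- exact: IHQ.
- by move=> /teqbP h; apply/teqbP; apply: type_eq_trans h; apply: type_eq_sym.
- by move=> /teqbP h; apply/teqbP; apply: type_eq_trans h; apply: type_eq_sym.
- by case: ifP => _; [apply: IHQ|apply: IHP].
Qed.

Lemma all_const (A : Type) (s : seq A) (b : bool) : 0 < size s -> all (fun _ => b) s = b.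
Proof. by case: s => //= x s _; case: b => //=; apply/allIn. Qed.

Lemma eq_all_In (A : Type) (p q : pred A) (s : seq A) :
  (forall x, List.In x s -> p x = q x) -> all p s = all q s.
Proof.
by elim: s => //= x s IHs h; rewrite h ?IHs //; [move=> y ys; apply: h; right|left].
Qed.

Lemma mem_flatten_In (A : Type) (K : eqType) (f : A -> seq K) x b (bs : seq A) :
  List.In b bs -> x \in f b -> x \in flatten (map f bs).
Proof.
by move=> bb xb; apply/In_mem/In_flatten; exists (f b); [apply/In_map; exists b|apply/In_mem].
Qed.

Lemma mem_flattenP (A : Type) (K : eqType) (f : A -> seq K) x (bs : seq A) :
  x \in flatten (map f bs) -> exists2 b, List.In b bs & x \in f b.
Proof.
by move/In_mem/In_flatten => [_ /In_map[b bb ->] /In_mem]; exists b.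
Qed.

Lemma assoc_zip_notin (K : eqType) (V : Type) k (s : seq K) (t : seq V) :
  k \notin s -> assoc k (zip s t) = None.
Proof.
by elim: s t => [|x s IHs] [|y t] //=; rewrite inE negb_or => /andP[/negPf-> /IHs].
Qed.

Lemma check_notin Gam P d T : wf_proc P -> d \notin fc P -> check Gam P d T = teqb T LEnd.
Proof.
elim/proc_nest_ind: P Gam d T =>
  [c r bs|c r bs|G P IH|Ss Ts P Q IHP IHQ|X vs cs||P Q IHP IHQ] /=;
  [move=> /List.Forall_forall IH|move=> /List.Forall_forall IH|..] => Gam d T.
- case/andP=> /andP[nbs _] /allIn wP; rewrite inE negb_or eq_sym => /andP[/negPf cd dbs].
  rewrite cd /= -[RHS](all_const _ nbs); apply: eq_all_In => b bb; apply: IH => //; first exact: wP.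
  by apply: contra dbs; exact: (mem_flatten_In (f := fun b => fc b.2.2) bb).
- case/andP=> /andP[nbs _] /allIn wP; rewrite inE negb_or eq_sym => /andP[/negPf cd dbs].
  rewrite cd /= -[RHS](all_const _ nbs); apply: eq_all_In => b bb; apply: IH => //; first exact: wP.
  by apply: contra dbs; exact: (mem_flatten_In (f := fun b => fc b.2.2) bb).
- by case/andP=> _ wP dP; apply: IH => //; rewrite -mem_fc_new.
- by case/and3P=> _ _ wQ; apply: IHQ.
- by move=> _ dcs; rewrite assoc_zip_notin.
- by [].
- case/andP=> wP wQ; rewrite mem_cat negb_or => /andP[dP dQ].
  by rewrite (negPf dQ) IHP.
Qed.

(** * From typing derivations to per-channel checks *)

Section TypedInd.
Variable P : sorting -> proc -> typing -> Prop.
Hypothesis Hsel : forall Gam Del c r (bs : fam ((prob * value) * proc))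
    (ts : fam (iprob * sort * ltype)),
  [seq b.1 | b <- bs] = [seq t.1 | t <- ts] ->
  Forall2 (fun b t => has_sort Gam b.2.1.2 t.2.1.2) bs ts ->
  Forall2 (fun b t => P Gam b.2.2 ((c, t.2.2) :: Del)) bs ts ->
  (\sum_(b <- bs) sval b.2.1.1 = 1)%R ->
  Forall2 (fun b t => in_iprob b.2.1.1 t.2.1.1) bs ts ->
  P Gam (PSel c r bs) ((c, LSel r ts) :: Del).
Hypothesis Hbra : forall Gam Del c r (bs : fam (sort * proc)) (ts : fam (sort * ltype)),
  [seq b.1 | b <- bs] = [seq t.1 | t <- ts] ->
  Forall2 (fun b t => b.2.1 = t.2.1) bs ts ->
  Forall2 (fun b t => P (add_vals [:: t.2.1] Gam) b.2.2 ((c, t.2.2) :: Del)) bs ts ->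
  P Gam (PBra c r bs) ((c, LBra r ts) :: Del).
Hypothesis Hend : forall Gam Del, only_end Del -> uniq (dom Del) -> P Gam PNil Del.
Hypothesis Hconc : forall Gam Q R Del Del', P Gam Q Del -> P Gam R Del' ->
  uniq (dom (Del ++ Del')) -> P Gam (PPar Q R) (Del ++ Del').
Hypothesis Hres : forall Gam G Q Ts Del, Forall2 (proj G) (pid G) Ts ->
  P Gam Q (shift Del ++ [seq (CRole 0 x.1, x.2) | x <- zip (pid G) Ts]) ->
  P Gam (PNew G Q) Del.
Hypothesis Hdef : forall Gam Ss Ts Q R Del,
  P (add_vals Ss (add_proc Ss Ts Gam)) Q
    [seq (CVar x.1, x.2) | x <- zip (iota 0 (size Ts)) Ts] ->
  P (add_proc Ss Ts Gam) R Del -> P Gam (PDef Ss Ts Q R) Del.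
Hypothesis Hcall : forall Gam X vs cs Ss Ts Del,
  onth (sprocs Gam) X = Some (Ss, Ts) -> Forall2 (has_sort Gam) vs Ss ->
  size cs = size Ts -> only_end Del -> uniq (dom (Del ++ zip cs Ts)) ->
  P Gam (PCall X vs cs) (Del ++ zip cs Ts).
Hypothesis Heq : forall Gam Q Del Del', P Gam Q Del -> eq_typing Del Del' ->
  wf_typing Del' -> P Gam Q Del'.

(** Also reaches the derivations nested inside [Forall2] in [TSelect] and [TBranch]. *)
Fixpoint typed_nest_ind Gam Q Del (h : typed Gam Q Del) : P Gam Q Del :=
  match h in typed Gam Q Del return P Gam Q Del with
  | TSelect Gam Del c r bs ts el hs ht sum1 hp => Hsel r el hs
      ((fix go s t (h : Forall2 (fun b t => typed Gam b.2.2 ((c, t.2.2) :: Del)) s t) :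
         Forall2 (fun b t => P Gam b.2.2 ((c, t.2.2) :: Del)) s t :=
         match h with
         | List.Forall2_nil => List.Forall2_nil _
         | List.Forall2_cons _ _ _ _ hx h' => List.Forall2_cons _ _ (typed_nest_ind hx) (go _ _ h')
         end) bs ts ht) sum1 hp
  | TBranch Gam Del c r bs ts el hs ht => Hbra r el hs
      ((fix go s t (h : Forall2 (fun b t => typed (add_vals [:: t.2.1] Gam) b.2.2
                                              ((c, t.2.2) :: Del)) s t) :
         Forall2 (fun b t => P (add_vals [:: t.2.1] Gam) b.2.2 ((c, t.2.2) :: Del)) s t :=
         match h with
         | List.Forall2_nil => List.Forall2_nil _
         | List.Forall2_cons _ _ _ _ hx h' => List.Forall2_cons _ _ (typed_nest_ind hx) (go _ _ h')
         end) bs ts ht)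
  | TEnd Gam Del e u => Hend Gam e u
  | TConc Gam Q R Del Del' h1 h2 u => Hconc (typed_nest_ind h1) (typed_nest_ind h2) u
  | TRes Gam G Q Ts Del hp h' => Hres hp (typed_nest_ind h')
  | TDef Gam Ss Ts Q R Del h1 h2 => Hdef (typed_nest_ind h1) (typed_nest_ind h2)
  | TCall Gam X vs cs Ss Ts Del e1 e2 e3 e4 e5 => Hcall e1 e2 e3 e4 e5
  | TEq Gam Q Del Del' h1 e w => Heq (typed_nest_ind h1) e w
  end.
End TypedInd.

Lemma Forall2_assoc (A B : Type) (R : label * A -> label * B -> Prop)
    (bs : fam A) (ts : fam B) l :
  map fst bs = map fst ts -> Forall2 R bs ts ->
  match assoc l bs, assoc l ts with
  | Some x, Some y => R (l, x) (l, y) | None, None => True | _, _ => False end.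
Proof.
move=> + h; elim: h => //= -[l1 x] [l2 y] bs' ts' hxy _ IH [/= el e].
move: hxy; rewrite -el => hxy.
by case: eqP => [->|_]; last exact: IH.
Qed.

Lemma wf_typingP Del : wf_typing Del <->
  uniq (dom Del) /\ forall d T, assoc d Del = Some T -> wf_ltype 0 T.
Proof.
split=> [/andP[u /allIn h]|[u h]].
  by split=> // d T e; exact: (h _ (assoc_In e)).
rewrite /wf_typing u; apply/allIn => -[d T] dT; apply: (h d).
exact: In_assoc dT.
Qed.

Lemma wf_typing_cons c T Del : wf_typing ((c, T) :: Del) =
  [&& c \notin dom Del, wf_ltype 0 T & wf_typing Del].
Proof. by rewrite /wf_typing /= -!andbA; case: (c \notin _); case: (uniq _); rewrite //= andbF. Qed.

(** The syntax-directed form of typability: a global condition [ok] and one independent condition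
    for each entry of [Del]. [typed_inv] and [typable_typed] show that it is equivalent to [typed]
    for well-formed data. *)
Definition typable_for (Gam : sorting) (P : proc) (Del : typing) : Prop :=
  [/\ wf_typing Del, ok Gam P, {subset fc P <= dom Del} &
      forall d T, assoc d Del = Some T -> check Gam P d T].

Lemma fam_nonempty (A : Type) (bs : fam A) : wf_fam bs -> exists x, List.In x bs.
Proof. by case: bs => // b bs; exists b; left. Qed.

Lemma eq_typing_dom Del Del' : eq_typing Del Del' -> dom Del =i dom Del'.
Proof.
move=> h d; have := h d; rewrite /dom !assoc_mem /opt_rel.
by case: (assoc d Del); case: (assoc d Del').
Qed.

Lemma typed_sel_inv Gam Del c r (bs : fam ((prob * value) * proc))
    (ts : fam (iprob * sort * ltype)) :
  wf_fam bs -> map fst bs = map fst ts ->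
  Forall2 (fun b t => has_sort Gam b.2.1.2 t.2.1.2) bs ts ->
  Forall2 (fun b t => typable_for Gam b.2.2 ((c, t.2.2) :: Del)) bs ts ->
  (\sum_(b <- bs) sval b.2.1.1 = 1)%R ->
  Forall2 (fun b t => in_iprob b.2.1.1 t.2.1.1) bs ts ->
  typable_for Gam (PSel c r bs) ((c, LSel r ts) :: Del).
Proof.
move=> wbs el hs ht sum1 hp; have [b0 b0bs] := fam_nonempty wbs.
have [n0 ubs] := andP wbs; have uts : uniq (map fst ts) by rewrite -el.
have bsE b : List.In b bs -> assoc b.1 bs = Some b.2.
  by case: b => l x; apply: In_assoc.
have tsE l y : assoc l ts = Some y -> exists2 x, assoc l bs = Some x &
    typable_for Gam x.2 ((c, y.2) :: Del).
  by move=> e; have := Forall2_assoc l el ht; rewrite e; case: (assoc l bs) => // x; exists x.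
have bE b : List.In b bs -> exists2 y, assoc b.1 ts = Some y &
    typable_for Gam b.2.2 ((c, y.2) :: Del).
  move=> bb; have := Forall2_assoc b.1 el ht; rewrite bsE //.
  by case: (assoc b.1 ts) => // y; exists y.
(* A selection has at least one branch, and the typing of that branch already shows that [Del] is
   well formed and lacks [c]. *)
have [y0 _ [w0 _ _ _]] := bE _ b0bs.
move: w0; rewrite wf_typing_cons => /and3P[nc _ wDel]; split.
- rewrite wf_typing_cons nc wDel andbT /= /wf_fam uts andbT.
  rewrite -(size_map fst) -el size_map n0 /=; apply/allIn => -[l y] /(In_assoc uts) /tsE[x _ [+ _ _ _]].
  by rewrite wf_typing_cons => /and3P[].
- by rewrite /= sum1 eqxx; apply/allIn => b /bE[y _ []].
- move=> d; rewrite /= inE => /orP[/eqP->|]; first by rewrite inE eqxx.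
  by move=> /(mem_flattenP (f := fun b => fc b.2.2))[b /bE[y _ [_ _ h _]]] /h.
move=> d T; rewrite [assoc d _]/=; case: eqP => [->|/eqP dc] => [[<-]|dT].
  rewrite /= eqxx /=; apply/andP; split.
    rewrite eqxx; apply/fam_relP => l; move: (Forall2_assoc l el hs) (Forall2_assoc l el hp).
    by case: (assoc l bs) => [x|]; case: (assoc l ts) => [y|] //= /has_sortP-> ->; rewrite eqxx.
  apply/allIn => b /bE[y -> [_ _ _ h]]; apply: h => /=; by rewrite eqxx.
rewrite /= eq_sym (negPf dc) /=; apply/allIn => b /bE[y _ [_ _ _ h]].
by apply: h; rewrite /= (negPf dc).
Qed.

Lemma typed_bra_inv Gam Del c r (bs : fam (sort * proc)) (ts : fam (sort * ltype)) :
  wf_fam bs -> map fst bs = map fst ts ->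
  Forall2 (fun b t => b.2.1 = t.2.1) bs ts ->
  Forall2 (fun b t => typable_for (add_vals [:: t.2.1] Gam) b.2.2 ((c, t.2.2) :: Del)) bs ts ->
  typable_for Gam (PBra c r bs) ((c, LBra r ts) :: Del).
Proof.
move=> wbs el hs ht; have [b0 b0bs] := fam_nonempty wbs.
have [n0 ubs] := andP wbs; have uts : uniq (map fst ts) by rewrite -el.
have bsE b : List.In b bs -> assoc b.1 bs = Some b.2.
  by case: b => l x; apply: In_assoc.
have tsE l y : assoc l ts = Some y -> exists2 x, assoc l bs = Some x &
    typable_for (add_vals [:: x.1] Gam) x.2 ((c, y.2) :: Del).
  move=> e; have := Forall2_assoc l el ht; have := Forall2_assoc l el hs.
  by rewrite e; case: (assoc l bs) => // x /= <-; exists x.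
have bE b : List.In b bs -> exists2 y, assoc b.1 ts = Some y &
    typable_for (add_vals [:: b.2.1] Gam) b.2.2 ((c, y.2) :: Del).
  move=> bb; have := Forall2_assoc b.1 el ht; have := Forall2_assoc b.1 el hs.
  by rewrite bsE //; case: (assoc b.1 ts) => // y /= <-; exists y.
have [y0 _ [w0 _ _ _]] := bE _ b0bs.
move: w0; rewrite wf_typing_cons => /and3P[nc _ wDel]; split.
- rewrite wf_typing_cons nc wDel andbT /= /wf_fam uts andbT.
  rewrite -(size_map fst) -el size_map n0 /=; apply/allIn => -[l y] /(In_assoc uts) /tsE[x _ [+ _ _ _]].
  by rewrite wf_typing_cons => /and3P[].
- by apply/allIn => b /bE[y _ []].
- move=> d; rewrite /= inE => /orP[/eqP->|]; first by rewrite inE eqxx.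
  by move=> /(mem_flattenP (f := fun b => fc b.2.2))[b /bE[y _ [_ _ h _]]] /h.
move=> d T; rewrite [assoc d _]/=; case: eqP => [->|/eqP dc] => [[<-]|dT].
  rewrite /= eqxx /=; apply/andP; split.
    rewrite eqxx; apply/fam_relP => l; move: (Forall2_assoc l el hs).
    by case: (assoc l bs) => [x|]; case: (assoc l ts) => [y|] //= ->.
  apply/allIn => b /bE[y -> [_ _ _ h]]; apply: h => /=; by rewrite eqxx.
rewrite /= eq_sym (negPf dc) /=; apply/allIn => b /bE[y _ [_ _ _ h]].
by apply: h; rewrite /= (negPf dc).
Qed.

Lemma only_end_assoc Del d T : only_end Del -> assoc d Del = Some T -> T = LEnd.
Proof. by move=> /List.Forall_forall h e; exact: (h _ (assoc_In e)). Qed.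

Lemma teqb_refl T : wf_ltype 0 T -> teqb T T.
Proof. by move=> wT; apply/teqbP/type_eq_refl. Qed.

Lemma Forall2_size (A B : Type) (R : A -> B -> Prop) s t : Forall2 R s t -> size s = size t.
Proof. by elim=> //= x y s' t' _ _ ->. Qed.

Lemma Forall2_zip (A B : Type) (R : A -> B -> Prop) s t :
  Forall2 R s t <-> size s = size t /\ forall x, List.In x (zip s t) -> R x.1 x.2.
Proof.
split=> [h|]; first split; first exact: Forall2_size h.
  by elim: h => //= x y s' t' hxy _ IH z [<- //|/IH].
elim: s t => [|x s IHs] [|y t] [//= [e] h].
by constructor; [apply: (h (x, y)); left|apply: IHs; split=> // z zz; apply: h; right].
Qed.

Lemma shift_chan_inj : injective shift_chan.
Proof. by move=> [x|s r] [y|t q] //= [-> // ->]. Qed.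

Lemma dom_shift Del : dom (shift Del) = map shift_chan (dom Del).
Proof. by rewrite /dom /shift -!map_comp. Qed.

Lemma assoc_shift d Del : assoc (shift_chan d) (shift Del) = assoc d Del.
Proof.
by elim: Del => //= -[e T] Del IH; rewrite (inj_eq shift_chan_inj) IH.
Qed.

Lemma assoc_zip_map (K K' : eqType) (V : Type) (f : K -> K') k (s : seq K) (t : seq V) :
  injective f -> assoc (f k) [seq (f x.1, x.2) | x <- zip s t] = assoc k (zip s t).
Proof. by move=> fi; elim: s t => [|x s IH] [|y t] //=; rewrite (inj_eq fi) IH. Qed.

Lemma dom_zip_map (K K' : eqType) (V : Type) (f : K -> K') (s : seq K) (t : seq V) :
  size s = size t -> [seq x.1 | x <- [seq (f x.1, x.2) | x <- zip s t]] = map f s.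
Proof. by elim: s t => [|x s IH] [|y t] //= [/IH ->]. Qed.

Lemma dom_zip (K : eqType) (V : Type) (s : seq K) (t : seq V) :
  size s = size t -> map fst (zip s t) = s.
Proof. by elim: s t => [|x s IH] [|y t] //= [/IH ->]. Qed.

Lemma In_zip_assoc (K : eqType) (V : Type) x (s : seq K) (t : seq V) :
  uniq s -> size s = size t -> List.In x (zip s t) -> assoc x.1 (zip s t) = Some x.2.
Proof. by case: x => k v us e; apply: In_assoc; rewrite dom_zip. Qed.

(** By induction on the derivation. The rule [TEq] can occur anywhere, and it is absorbed because
    the per-channel condition is invariant under [type_eq]. *)
Lemma typed_inv Gam P Del : typed Gam P Del -> wf_sorting Gam -> wf_proc P ->
  typable_for Gam P Del.
Proof.
elim/typed_nest_ind=> {Gam P Del} [Gam Del c r bs ts el hs ht sum1 hp|Gam Del c r bs ts el hs ht|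
  Gam Del hE uD|Gam Q R Del Del' IHQ IHR u|Gam G Q Ts Del hp IHQ|Gam Ss Ts Q R Del IHQ IHR|
  Gam X vs cs Ss Ts Del eX hvs ecs hE u|Gam Q Del Del' IHQ e wDel'] wG /=.
- case/andP=> wbs /allIn wP; apply: typed_sel_inv => //.
  apply/Forall2_zip; have /Forall2_zip [e h] := ht; split=> // x xx; apply: h => //.
  apply: wP; elim: bs ts xx {el hs ht sum1 hp wbs e} => [|b bs IH] [|t ts] //=.
  by case=> [<-|/IH]; [left|right].
- case/andP=> wbs /allIn wP; apply: typed_bra_inv => //.
  apply/Forall2_zip; have /Forall2_zip [e h] := ht; split=> // x xx; apply: h => //.
  apply: wP; elim: bs ts xx {el hs ht wbs e} => [|b bs IH] [|t ts] //=.
  by case=> [<-|/IH]; [left|right].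
- move=> _; split=> //; last by move=> d T /(only_end_assoc hE) ->; exact: teqb_refl.
  by apply/wf_typingP; split=> // d T /(only_end_assoc hE) ->.
- case/andP=> wQ wR; have [wD okQ sQ cQ] := IHQ wG wQ; have [wD' okR sR cR] := IHR wG wR.
  have disj d : d \in dom Del -> d \notin dom Del'.
    move: u; rewrite /dom map_cat cat_uniq => /and3P[_ /hasPn h _] dD.
    by apply/negP => /h; rewrite /= dD.
  split.
  + by move: wD wD'; rewrite /wf_typing u all_cat => /andP[_ ->] /andP[_ ->].
  + by rewrite /= okQ okR !andbT; apply/allP => d /sQ /disj; apply: contra => /sR.
  + by move=> d; rewrite /dom map_cat !mem_cat => /orP[/sQ ->//|/sR ->]; rewrite orbT.
  + move=> d T; rewrite assoc_cat /=; case E: (assoc d Del) => [T'|].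
      move=> [<-]; have dD : d \in dom Del by rewrite /dom assoc_mem E.
      by case: ifP => [/sR|_]; [rewrite (negPf (disj _ dD))|exact: cQ].
    move=> dT; case: ifP => [_|/negbT dR]; first exact: cR.
    rewrite check_notin //; first by rewrite -(check_notin Gam T wR dR); exact: cR.
    by apply/negP => /sQ; rewrite /dom assoc_mem E.
- case/andP=> wfG wQ; have [wD okQ sQ cQ] := IHQ wG wQ.
  have eT := Forall2_size hp.
  have [uD wT] := (wf_typingP _).1 wD.
  have notS r : assoc (CRole 0 r) (shift Del) = None.
    by elim: (Del) => //= -[[x|s q] T] D IH /=.
  have asS d : assoc (shift_chan d) (shift Del ++ [seq (CRole 0 x.1, x.2) | x <- zip (pid G) Ts])
      = assoc d Del.
    rewrite assoc_cat assoc_shift; case: (assoc d Del) => //.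
    by elim: (pid G) (Ts) => [|q s IH] [|T t] //=; rewrite IH;
      have -> : (shift_chan d == CRole 0 q) = false by apply/eqP; case: (d).
  have asG r : assoc (CRole 0 r) (shift Del ++ [seq (CRole 0 x.1, x.2) | x <- zip (pid G) Ts])
      = assoc r (zip (pid G) Ts).
    by rewrite assoc_cat notS; apply: (assoc_zip_map (f := CRole 0)) => a b [].
  split.
  + apply/wf_typingP; split; last by move=> d T; rewrite -asS; exact: wT.
    move: uD; rewrite /dom map_cat cat_uniq => /andP[+ _].
    by rewrite -/(dom (shift Del)) dom_shift (map_inj_uniq shift_chan_inj).
  + rewrite /= okQ andbT; apply/andP; split; apply/allP.
      move=> r rG; have [T hT] : exists T, assoc r (zip (pid G) Ts) = Some T.
        by apply/assoc_memP; rewrite dom_zip.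
      have := (Forall2_zip _ _ _).1 hp => -[_ /(_ _ (assoc_In hT)) /= /(projP _ _ wfG) ->].
      by rewrite (wT (CRole 0 r)) ?asG // cQ // asG.
    move=> [x|[|s] r] // /sQ; rewrite /dom assoc_mem asG => h.
    by rewrite -(dom_zip eT) assoc_mem.
  + move=> d; rewrite mem_fc_new => /sQ; rewrite /dom !assoc_mem.
    by rewrite asS.
  + by move=> d T h; apply: cQ; rewrite asS.
- case/and3P=> wTs wQ wR.
  have wG' : wf_sorting (add_proc Ss Ts Gam) by rewrite /wf_sorting /= wTs.
  have [_ okQ sQ cQ] := IHQ wG' wQ; have [wD okR sR cR] := IHR wG' wR.
  split=> //; rewrite /= okQ okR !andbT; apply/andP; split.
    apply/allP => c /sQ; rewrite /dom dom_zip_map ?size_iota // => /mapP[x +  ->].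
    by rewrite mem_iota.
  apply/allIn => x xx; apply: cQ; rewrite (assoc_zip_map (f := CVar)); last by move=> a b [].
  by apply: In_zip_assoc xx; rewrite ?iota_uniq ?size_iota.
- move=> _; have dz := dom_zip ecs.
  have zE d : d \in cs -> assoc d Del = None.
    move: u; rewrite /dom map_cat dz cat_uniq => /and3P[_ /hasPn h _] dc.
    by have := h _ dc; rewrite /= assoc_mem; case: (assoc d Del).
  have wTs : all (wf_ltype 0) Ts.
    move: wG; rewrite /wf_sorting => /allIn /(_ (Ss, Ts)); apply.
    by elim: (sprocs Gam) X eX => [|y s IH] [|X] //= [] *; [left|right; apply: IH; eassumption].
  have asz d T : assoc d (zip cs Ts) = Some T -> wf_ltype 0 T.
    move=> e0; have := assoc_In e0; move/allIn: wTs => h; move: ecs h {e0}.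
    elim: (cs) (Ts) => [|c s IH] [|U t] //= [e] h; case=> [[_ <-]|]; first by apply: h; left.
    by apply: IH => // V tV; apply: h; right.
  split.
  + apply/wf_typingP; split=> // d T; rewrite assoc_cat.
    case E: (assoc d Del) => [U|]; last exact: asz.
    by rewrite (only_end_assoc hE E) => -[<-].
  + have [e h] := (Forall2_zip _ _ _).1 hvs.
    rewrite /= /call_ok eX /= ecs e !eqxx /=; move: u; rewrite /dom map_cat dz cat_uniq => /and3P[_ _ ->].
    by apply/allIn => x /h /has_sortP ->.
  + by move=> d dc; rewrite /dom map_cat mem_cat dz dc orbT.
  + move=> d T; rewrite assoc_cat /= /call_types eX /=; case E: (assoc d Del) => [U|].
      have dcs : d \notin cs by apply/negP => /zE; rewrite E.
      by rewrite assoc_zip_notin //= (only_end_assoc hE E) => -[<-]; exact: teqb_refl.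
    by move=> h; rewrite h /=; apply: teqb_refl; apply: asz h.
- move=> wQ; have [wD okQ sQ cQ] := IHQ wG wQ; split=> //.
    by move=> d /sQ; rewrite (eq_typing_dom e).
  move=> d T dT; have := e d; rewrite dT /opt_rel; case E: (assoc d Del) => [U|] // UT.
  exact: check_eq UT (cQ _ _ E).
Qed.

(** * From per-channel checks to typing derivations *)

Lemma Forall2_map (A B : Type) (R : A -> B -> Prop) (g : A -> B) s :
  (forall x, List.In x s -> R x (g x)) -> Forall2 R s (map g s).
Proof.
elim: s => //= x s IH h; constructor; first by apply: h; left.
by apply: IH => y ys; apply: h; right.
Qed.

Lemma dom_filter (p : pred chan) Del :
  dom [seq x <- Del | p x.1] = filter p (dom Del).
Proof. by rewrite /dom filter_map. Qed.

Lemma wf_typing_filter (p : pred chan) Del :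
  wf_typing Del -> wf_typing [seq x <- Del | p x.1].
Proof.
move/wf_typingP=> [u h]; apply/wf_typingP; rewrite dom_filter filter_uniq //.
by split=> // d T; rewrite assoc_filter; case: ifP => // _; exact: h.
Qed.

(** The rules for prefixes expect the subject's entry at the head of the typing with a type of a
    specific syntactic shape. This brings the entry of [c] to the front and exchanges its type for
    an equal one. *)
Lemma typed_replace Gam P Del c T U : wf_typing Del -> assoc c Del = Some T ->
  type_eq U T -> typed Gam P ((c, U) :: [seq x <- Del | x.1 != c]) -> typed Gam P Del.
Proof.
move=> wD cT UT h; apply: (TEq h _ wD) => d; rewrite /= (assoc_filter (fun x => x != c)).
case: eqP => [->|_] /=; first by rewrite cT.
case E: (assoc d Del) => [V|] //=; apply: type_eq_refl.
by have [_ h2] := (wf_typingP _).1 wD; exact: h2 E.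
Qed.

Lemma type_eq_sel_ext r ts ts' : wf_ltype 0 (LSel r ts') ->
  (forall l, assoc l ts = assoc l ts') -> type_eq (LSel r ts) (LSel r ts').
Proof.
move=> w h; have [hh hc] := (type_eqE _ _).1 (type_eq_refl w); apply/type_eqE.
split=> [|l lT].
  move: hh; rewrite /unf /= => /andP[-> /fam_relP h']; apply/fam_relP => l.
  by rewrite h; exact: h'.
rewrite /unf /= h; have := hc l; rewrite /unf /=; apply.
by move: lT; rewrite /unf /= !assoc_mem h.
Qed.

Lemma type_eq_bra_ext r ts ts' : wf_ltype 0 (LBra r ts') ->
  (forall l, assoc l ts = assoc l ts') -> type_eq (LBra r ts) (LBra r ts').
Proof.
move=> w h; have [hh hc] := (type_eqE _ _).1 (type_eq_refl w); apply/type_eqE.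
split=> [|l lT].
  move: hh; rewrite /unf /= => /andP[-> /fam_relP h']; apply/fam_relP => l.
  by rewrite h; exact: h'.
rewrite /unf /= h; have := hc l; rewrite /unf /=; apply.
by move: lT; rewrite /unf /= !assoc_mem h.
Qed.

Lemma typable_cont Gam Q Del c T U (s : seq chan) :
  wf_typing Del -> assoc c Del = Some T -> wf_ltype 0 U ->
  {subset s <= dom Del} -> {subset fc Q <= s} -> ok Gam Q -> check Gam Q c U ->
  (forall d V, d != c -> assoc d Del = Some V -> check Gam Q d V) ->
  typable_for Gam Q ((c, U) :: [seq x <- Del | x.1 != c]).
Proof.
move=> wD cT wU sD Qs okQ cc cD; split=> //.
- rewrite wf_typing_cons wU (@wf_typing_filter (fun x => x != c)) // (dom_filter (fun x => x != c)).
  by rewrite mem_filter eqxx.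
- move=> d /Qs /sD dD; rewrite /= inE -/(dom _) (dom_filter (fun x => x != c)) mem_filter dD.
  by case: eqP.
- move=> d V /=; rewrite (assoc_filter (fun x => x != c)).
  case: eqP => [-> [<-] //|/eqP dc]; exact: cD.
Qed.

Definition iprob01 : iprob := @IProb 0%R 1%R isT.

(** [TSelect] wants a literal selection whose branches are listed in the order of the process. The
    type of [c] is therefore unfolded and its branches listed again along [bs]; [TEq] restores the
    given type. *)
Lemma typable_sel Gam c r bs Del :
  wf_fam bs ->
  (forall b, List.In b bs -> forall Del', typable_for Gam b.2.2 Del' -> typed Gam b.2.2 Del') ->
  typable_for Gam (PSel c r bs) Del -> typed Gam (PSel c r bs) Del.
Proof.
move=> /andP[n0 ubs] IH [wD /= /andP[/eqP sum1 /allIn okP] sD cD].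
have [T cT] : exists T, assoc c Del = Some T.
  by apply/assoc_memP/sD; rewrite inE eqxx.
have [_ wDel] := (wf_typingP _).1 wD; have wT := wDel _ _ cT.
have := cD _ _ cT; rewrite eqxx /= => /andP[/sel_headP[lT [ts' eT hts]] /allIn cT'].
have bsE b : List.In b bs -> assoc b.1 bs = Some b.2 by case: b => l x; apply: In_assoc.
(* Never reached, since [bs] and [ts'] have the same labels. *)
pose dflt : iprob * sort * ltype := (iprob01, 0, LEnd).
pose g l := odflt dflt (assoc l ts').
pose ts := [seq (b.1, g b.1) | b <- bs].
have tsE l : assoc l ts = assoc l ts'.
  rewrite (assoc_map (fun k _ => g k)) /g; have := lT l; rewrite eT /= !assoc_mem.
  by case: (assoc l bs) => [x|]; case: (assoc l ts').
apply: (typed_replace wD cT (U := LSel r ts)).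
  apply: type_eq_trans (type_eq_sym (type_eq_unf wT)); rewrite eT.
  by apply: type_eq_sel_ext tsE; rewrite -eT; exact: wf_unf.
have tE b : List.In b bs -> exists y, [/\ g b.1 = y, assoc b.1 ts' = Some y,
    vsort Gam b.2.1.2 = Some y.1.2 & in_iprob b.2.1.1 y.1.1].
  by move=> bb; have [y [e1 e2 e3]] := hts _ _ (bsE _ bb); exists y; rewrite /g e1.
apply: TSelect; rewrite ?sum1 //.
- by rewrite -map_comp.
- by apply: Forall2_map => b /tE[y [/= -> _ e _]]; apply/has_sortP.
- apply: Forall2_map => b bb; apply: (IH _ bb); have [y [/= -> ey _ _]] := tE _ bb.
  have yE : child b.1 (unf T) = y.2 by rewrite eT /= ey.
  apply: (typable_cont wD cT (s := c :: flatten [seq fc b.2.2 | b <- bs])) => //.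
  + by rewrite -yE; apply/wf_child/wf_unf.
  + move=> d db; rewrite inE; apply/orP; right.
    exact: (mem_flatten_In (f := fun b => fc b.2.2) bb).
  + exact: okP.
  + by rewrite -yE; exact: cT'.
  + move=> d V dc dV; have := cD _ _ dV; rewrite eq_sym (negPf dc) /= => /allIn; exact.
- by apply: Forall2_map => b /tE[y [/= -> _ _ e]].
Qed.

Lemma typable_bra Gam c r bs Del :
  wf_fam bs ->
  (forall b, List.In b bs -> forall Del', typable_for (add_vals [:: b.2.1] Gam) b.2.2 Del' ->
     typed (add_vals [:: b.2.1] Gam) b.2.2 Del') ->
  typable_for Gam (PBra c r bs) Del -> typed Gam (PBra c r bs) Del.
Proof.
move=> /andP[n0 ubs] IH [wD /= /allIn okP sD cD].
have [T cT] : exists T, assoc c Del = Some T.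
  by apply/assoc_memP/sD; rewrite inE eqxx.
have [_ wDel] := (wf_typingP _).1 wD; have wT := wDel _ _ cT.
have := cD _ _ cT; rewrite eqxx /= => /andP[/bra_headP[lT [ts' eT hts]] /allIn cT'].
have bsE b : List.In b bs -> assoc b.1 bs = Some b.2 by case: b => l x; apply: In_assoc.
pose dflt : sort * ltype := (0, LEnd).
pose g l := odflt dflt (assoc l ts').
pose ts := [seq (b.1, g b.1) | b <- bs].
have tsE l : assoc l ts = assoc l ts'.
  rewrite (assoc_map (fun k _ => g k)) /g; have := lT l; rewrite eT /= !assoc_mem.
  by case: (assoc l bs) => [x|]; case: (assoc l ts').
apply: (typed_replace wD cT (U := LBra r ts)).
  apply: type_eq_trans (type_eq_sym (type_eq_unf wT)); rewrite eT.
  by apply: type_eq_bra_ext tsE; rewrite -eT; exact: wf_unf.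
have tE b : List.In b bs -> exists y, [/\ g b.1 = y, assoc b.1 ts' = Some y & b.2.1 = y.1].
  by move=> bb; have [y e1 e2] := hts _ _ (bsE _ bb); exists y; rewrite /g e1.
apply: TBranch.
- by rewrite -map_comp.
- by apply: Forall2_map => b /tE[y [/= -> _ e]].
- apply: Forall2_map => b bb; have [y [/= -> ey sy]] := tE _ bb; rewrite -sy.
  apply: (IH _ bb).
  have yE : child b.1 (unf T) = y.2 by rewrite eT /= ey.
  apply: (typable_cont wD cT (s := c :: flatten [seq fc b.2.2 | b <- bs])) => //.
  + by rewrite -yE; apply/wf_child/wf_unf.
  + move=> d db; rewrite inE; apply/orP; right.
    exact: (mem_flatten_In (f := fun b => fc b.2.2) bb).
  + exact: okP.
  + by rewrite -yE; exact: cT'.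
  + move=> d V dc dV; have := cD _ _ dV; rewrite eq_sym (negPf dc) /= => /allIn; exact.
Qed.

Lemma assoc_ends d (Del : typing) :
  assoc d [seq (x.1, LEnd) | x <- Del] = omap (fun _ => LEnd) (assoc d Del).
Proof. exact: (assoc_mapv (fun _ => LEnd)). Qed.

Lemma only_end_ends (Del : typing) : only_end [seq (x.1, LEnd) | x <- Del].
Proof. by apply/List.Forall_forall => _ /In_map[x _ ->]. Qed.

Lemma dom_ends (Del : typing) : dom [seq (x.1, LEnd) | x <- Del] = dom Del.
Proof. by rewrite /dom -map_comp. Qed.

(** By induction on the process. In each case the typing is first brought into the literal form that
    the rule concludes, and [TEq] relates this form to [Del] where they differ. *)
Lemma typable_typed Gam P Del : wf_sorting Gam -> wf_proc P ->
  typable_for Gam P Del -> typed Gam P Del.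
Proof.
elim/proc_nest_ind: P Gam Del =>
  [c r bs|c r bs|G P IH|Ss Ts P Q IHP IHQ|X vs cs||P Q IHP IHQ];
  [move=> /List.Forall_forall IH|move=> /List.Forall_forall IH|..] => Gam Del wG.
- case/andP=> wbs /allIn wP; apply: typable_sel => // b bb Del'.
  by apply: IH => //; exact: wP.
- case/andP=> wbs /allIn wP; apply: typable_bra => // b bb Del'.
  by apply: IH => //; exact: wP.
- case/andP=> wfG wP [wD /andP[/andP[/allP hG /allP hfc] okP] sD cD].
  have [uD wDel] := (wf_typingP _).1 wD.
  (* The default is never taken, because [hG] says that every participant has a projection. *)
  pose Ts := [seq odflt LEnd (projf G r) | r <- pid G].
  have sz : size (pid G) = size Ts by rewrite size_map.
  have uG : uniq (pid G) by exact: undup_uniq.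
  have TsE r : r \in pid G -> assoc r (zip (pid G) Ts) = projf G r.
    rewrite /Ts; elim: (pid G) hG {uG sz} => //= q s IHs h; rewrite inE.
    case: eqP => [-> _|_ /IHs ->//] /=.
      by have := h q (mem_head _ _); case: (projf G q).
    by move=> q' qs; apply: h; rewrite inE qs orbT.
  have notS r : assoc (CRole 0 r) (shift Del) = None.
    by elim: (Del) => //= -[[x|s q] T] D IHD /=.
  have asS d : assoc (shift_chan d) (shift Del ++ [seq (CRole 0 x.1, x.2) | x <- zip (pid G) Ts])
      = assoc d Del.
    rewrite assoc_cat assoc_shift; case: (assoc d Del) => //.
    elim: (pid G) (Ts) => [|q s IHs] [|T t] //=; rewrite IHs.
    by have -> : (shift_chan d == CRole 0 q) = false by apply/eqP; case: (d).
  have asG r : assoc (CRole 0 r) (shift Del ++ [seq (CRole 0 x.1, x.2) | x <- zip (pid G) Ts])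
      = assoc r (zip (pid G) Ts).
    by rewrite assoc_cat notS; apply: (assoc_zip_map (f := CRole 0)) => a b [].
  (* Below the binder a channel either comes from outside or belongs to the new session. The two
     parts of the typing are looked up accordingly. *)
  have chanE d : (exists d', d = shift_chan d') \/ (exists r, d = CRole 0 r).
    case: d => [x|[|s] r]; [left|right|left].
    + by exists (CVar x).
    + by exists r.
    + by exists (CRole s r).
  have asGE r T : assoc r (zip (pid G) Ts) = Some T ->
      wf_ltype 0 T && check Gam P (CRole 0 r) T.
    move=> e; have rG : r \in pid G by rewrite -(dom_zip sz) assoc_mem e.
    by have := hG _ rG; rewrite -(TsE _ rG) e.
  apply: (TRes (Ts := Ts)).
    apply: Forall2_map => r /In_mem rG; apply/(projP _ _ wfG).
    by have := hG _ rG; case: (projf G r).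
  apply: IH => //; split=> //.
  + apply/wf_typingP; split.
      rewrite /dom map_cat cat_uniq -/(dom (shift Del)) dom_shift (map_inj_uniq shift_chan_inj).
      rewrite uD dom_zip_map // map_inj_uniq ?uG ?andbT; last by move=> a b [].
      by apply/hasPn => _ /mapP[r _ ->]; apply/mapP => -[[]].
    move=> d T; case: (chanE d) => [[d' ->]|[r ->]]; rewrite ?asS ?asG; first exact: wDel.
    by move=> /asGE /andP[].
  + move=> d dP; rewrite /dom assoc_mem; move: dP.
    case: (chanE d) => [[d' ->]|[r ->]] dP; rewrite ?asS ?asG -assoc_mem.
      by apply: sD; rewrite mem_fc_new.
    by rewrite dom_zip //; exact: (hfc _ dP).
  + move=> d T; case: (chanE d) => [[d' ->]|[r ->]]; rewrite ?asS ?asG; first exact: cD.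
    by move=> /asGE /andP[].
- case/and3P=> wTs wP wQ [wD /and3P[/andP[/allP hfc /allIn hc] okP okQ] sD cD].
  have wG' : wf_sorting (add_proc Ss Ts Gam) by rewrite /wf_sorting /= wTs.
  have asE x : assoc (CVar x) [seq (CVar x.1, x.2) | x <- zip (iota 0 (size Ts)) Ts]
      = assoc x (zip (iota 0 (size Ts)) Ts).
    by apply: (assoc_zip_map (f := CVar)) => a b [].
  have asN s r : assoc (CRole s r) [seq (CVar x.1, x.2) | x <- zip (iota 0 (size Ts)) Ts] = None.
    by elim: (zip _ _) => //= x t ->.
  apply: TDef; last exact: IHQ.
  apply: IHP => //; split=> //.
  + apply/wf_typingP; split.
      by rewrite /dom dom_zip_map ?size_iota // map_inj_uniq ?iota_uniq // => a b [].
    move=> [x|s r] T; last by rewrite asN.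
    rewrite asE => e0; have := assoc_In e0; move/allIn: wTs => h; move: (iota _ _) {e0} => s.
    elim: (Ts) s h => [|U t IHt] [|y s] //= h; case=> [[_ <-]|]; first by apply: h; left.
    by apply: IHt => V tV; apply: h; right.
  + move=> d dP; have := hfc _ dP; case: d dP => // x _ xT.
    by rewrite /dom assoc_mem asE -assoc_mem dom_zip ?size_iota // mem_iota.
  + move=> [x|s r] T; last by rewrite asN.
    by rewrite asE => e0; exact: (hc _ (assoc_In e0)).
- move=> _ [wD /= + sD cD]; rewrite /call_ok.
  case E: (onth (sprocs Gam) X) => [[Ss Ts]|] //= /and4P[/eqP ecs ucs /eqP evs /allIn hvs].
  have [uD wDel] := (wf_typingP _).1 wD.
  (* [TCall] requires the remaining types to be literally [LEnd], whereas [check] only makes them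
     equal to it. *)
  pose Del1 := [seq (x.1, LEnd) | x <- [seq x <- Del | x.1 \notin cs]].
  apply: (TEq (Del := Del1 ++ zip cs Ts)) => //.
    apply: (TCall E _ ecs).
    + by apply/Forall2_zip; split=> // x /hvs /eqP /has_sortP.
    + exact: only_end_ends.
    + rewrite /dom map_cat -/(dom Del1) dom_ends (dom_filter (fun x => x \notin cs)) dom_zip //.
      rewrite cat_uniq filter_uniq // ucs andbT /=.
      by apply/hasPn => c cc; rewrite /= mem_filter cc.
  move=> d; rewrite assoc_cat assoc_ends (assoc_filter (fun x => x \notin cs)).
  case: (boolP (d \in cs)) => dcs /=.
    have := sD _ dcs; rewrite /dom assoc_mem; case E': (assoc d Del) => [T|] // _.
    have := cD _ _ E'; rewrite /call_types E /=; have := dcs; rewrite -{1}(dom_zip ecs) assoc_mem.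
    by case: (assoc d (zip cs Ts)) => //= U _ /teqbP; exact: type_eq_sym.
  case E': (assoc d Del) => [T|] /=; last by rewrite assoc_zip_notin.
  by have := cD _ _ E'; rewrite assoc_zip_notin //= => /teqbP; exact: type_eq_sym.
- move=> _ [wD _ sD cD]; have [uD wDel] := (wf_typingP _).1 wD.
  apply: (TEq (Del := [seq (x.1, LEnd) | x <- Del])) => //.
    by apply: TEnd; [exact: only_end_ends|rewrite dom_ends].
  move=> d; rewrite assoc_ends; case E: (assoc d Del) => [T|] //=.
  by have /teqbP := cD _ _ E; exact: type_eq_sym.
- case/andP=> wP wQ [wD /and3P[/allP hPQ okP okQ] sD cD].
  have [uD wDel] := (wf_typingP _).1 wD.
  (* The split mirrors the test made by [check]: channels used by neither component go to the left
     one, where they are ended. *)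
  apply: (TEq (Del := [seq x <- Del | x.1 \notin fc Q] ++ [seq x <- Del | x.1 \in fc Q])) => //.
    apply: TConc.
    + apply: IHP => //; split=> //; first exact: (@wf_typing_filter (fun x => x \notin fc Q)).
        move=> d dP; rewrite (dom_filter (fun x => x \notin fc Q)) mem_filter hPQ //=.
        by apply: sD; rewrite mem_cat dP.
      move=> d T; rewrite (assoc_filter (fun x => x \notin fc Q)); case: ifP => // dQ /cD /=.
      by rewrite (negPf dQ).
    + apply: IHQ => //; split=> //; first exact: (@wf_typing_filter (fun x => x \in fc Q)).
        move=> d dQ; rewrite (dom_filter (fun x => x \in fc Q)) mem_filter dQ.
        by apply: sD; rewrite mem_cat dQ orbT.
      move=> d T; rewrite (assoc_filter (fun x => x \in fc Q)); case: ifP => // dQ /cD /=.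
      by rewrite dQ.
    + rewrite /dom map_cat -!/(dom _) (dom_filter (fun x => x \notin fc Q)).
      rewrite (dom_filter (fun x => x \in fc Q)) cat_uniq !filter_uniq // andbT /=.
      by apply/hasPn => c; rewrite /= !mem_filter => /andP[->].
  move=> d; rewrite assoc_cat (assoc_filter (fun x => x \notin fc Q)).
  rewrite (assoc_filter (fun x => x \in fc Q)).
  case: (d \in fc Q) => /=; case E: (assoc d Del) => [T|] //=; apply: type_eq_refl; exact: wDel E.
Qed.

(** * Candidate types *)

(* A candidate for the type of a channel is a tree of flexible nodes, which are
   selections (with interval [iprob01]) and branchings, over fixed leaves.  A
   leaf is LEnd or LMu T with T closed, which denotes the same tree as T. *)

Definition is_node (T : ltype) : bool :=
  match T with LSel _ _ | LBra _ _ => true | _ => false end.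

(** A selection and a branching have no common instance, so the [LEnd] returned for such a pair is
    arbitrary. Two leaves met at the same place are equal whenever a type exists, so keeping the
    first one is no choice. *)
Fixpoint merge (T U : ltype) : ltype :=
  match T with
  | LSel r bs =>
      match U with
      | LSel _ _ => LSel r [seq (b.1, (b.2.1, merge b.2.2 (child b.1 U))) | b <- bs]
      | LBra _ _ => LEnd
      | _ => U
      end
  | LBra r bs =>
      match U with
      | LBra _ _ => LBra r [seq (b.1, (b.2.1, merge b.2.2 (child b.1 U))) | b <- bs]
      | LSel _ _ => LEnd
      | _ => U
      end
  | _ => T
  end.

Definition merge_all (Ts : seq ltype) : ltype :=
  if Ts is T :: Ts' then foldr merge T Ts' else LEnd.

(** The sort 0 given to a value without sort is a filler: the head test at that selection rejects
    every type. The annotation taken from a call is wrapped in [LMu] so that it is not mistaken for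
    a flexible node. *)
Fixpoint cand (Gam : sorting) (P : proc) (d : chan) : ltype :=
  match P with
  | PSel c r bs =>
      if c == d then
        LSel r [seq (b.1, ((iprob01, odflt 0 (vsort Gam b.2.1.2)), cand Gam b.2.2 d)) | b <- bs]
      else merge_all [seq cand Gam b.2.2 d | b <- bs]
  | PBra c r bs =>
      if c == d then
        LBra r [seq (b.1, (b.2.1, cand (add_vals [:: b.2.1] Gam) b.2.2 d)) | b <- bs]
      else merge_all [seq cand (add_vals [:: b.2.1] Gam) b.2.2 d | b <- bs]
  | PNew _ P' => cand Gam P' (shift_chan d)
  | PDef Ss Ts _ Q => cand (add_proc Ss Ts Gam) Q d
  | PCall X _ cs =>
      if assoc d (zip cs (call_types Gam X)) is Some T then LMu T else LEnd
  | PNil => LEnd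
  | PPar P' Q => if d \in fc Q then cand Gam Q d else cand Gam P' d
  end.

(** The first argument is the candidate: its intervals must be [iprob01], and those of the other
    type are ignored. *)
Definition flex_head := headg (fun d _ => iprob_eqb d iprob01).

(* [matches C T]: T is obtained from the candidate C by refining the intervals
   of its flexible nodes. *)
Fixpoint matches (C T : ltype) : bool :=
  match C with
  | LSel _ bs =>
      flex_head C (unf T) && all (fun b => matches b.2.2 (child b.1 (unf T))) bs
  | LBra _ bs =>
      flex_head C (unf T) && all (fun b => matches b.2.2 (child b.1 (unf T))) bs
  | _ => teqb C T
  end.

(* [finer C D]: every leaf of D lies below a leaf of C. *)
Fixpoint finer (C D : ltype) : bool :=
  match C with
  | LSel _ bs =>
      if D is LSel _ _ then all (fun b => finer b.2.2 (child b.1 D)) bs else false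
  | LBra _ bs =>
      if D is LBra _ _ then all (fun b => finer b.2.2 (child b.1 D)) bs else false
  | _ => true
  end.

Lemma flex_labels C T : flex_head C T -> labels C =i labels T.
Proof.
by case: C T => [r bs|r bs|?|?|] [r' bs'|r' bs'|?|?|] //= /andP[_ /fam_relP h] l;
  have := h l; rewrite !assoc_mem; case: (assoc l bs); case: (assoc l bs').
Qed.

Lemma matches_flex C T : matches C T -> is_node C -> flex_head C (unf T).
Proof. by case: C => // r bs /andP[]. Qed.

Lemma matches_child C T l : is_node C -> matches C T -> l \in labels C ->
  matches (child l C) (child l (unf T)).
Proof.
case: C => // r bs _ /andP[_ /allIn h].
  by move=> /child_In_sel -/(_ r) [x xbs ->]; exact: h xbs.
by move=> /child_In_bra -/(_ r) [x xbs ->]; exact: h xbs.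
Qed.

Lemma matches_leaf C T : ~~ is_node C -> matches C T = teqb C T.
Proof. by case: C. Qed.

Lemma child_map_sel l r (bs : fam (iprob * sort * ltype)) (f : label -> ltype -> ltype) :
  l \in map fst bs ->
  child l (LSel r [seq (b.1, (b.2.1, f b.1 b.2.2)) | b <- bs]) = f l (child l (LSel r bs)).
Proof.
move=> /assoc_memP [x ex] /=.
by rewrite (assoc_map (fun l b => (b.1, f l b.2))) ex.
Qed.

Lemma child_map_bra l r (bs : fam (sort * ltype)) (f : label -> ltype -> ltype) :
  l \in map fst bs ->
  child l (LBra r [seq (b.1, (b.2.1, f b.1 b.2.2)) | b <- bs]) = f l (child l (LBra r bs)).
Proof.
move=> /assoc_memP [x ex] /=.
by rewrite (assoc_map (fun l b => (b.1, f l b.2))) ex.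
Qed.

(** At a place where both candidates are nodes, [T] forces the same kind and the same labels.
    Everywhere else the result is one of the two leaves, and [T] equals that leaf. *)
Lemma matches_merge C D T : matches C T -> matches D T -> matches (merge C D) T.
Proof.
elim/ltype_nest_ind: C D T => [r bs|r bs|C _|n|] //; move=> /List.Forall_forall IH D T mC.
- case: D => [r' bs'|r' bs'|D|n|] // mD; last first.
    by have := matches_flex mD isT; have := matches_flex mC isT; case: (unf T).
  have fC := matches_flex mC isT; have fD := matches_flex mD isT.
  have /andP[_ /allIn hC] := mC; apply/andP; split.
    move: fC; case: (unf T) => //= r2 ts /andP[-> /fam_relP h]; apply/fam_relP => l.
    rewrite (assoc_map (fun k b => (b.1, merge b.2 (child k (LSel r' bs'))))).
    by have := h l; case: (assoc l bs).
  apply/allIn => _ /In_map[b bb ->] /=; apply: IH => //; first exact: hC.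
  apply: (@matches_child (LSel r' bs')) => //.
  by rewrite (flex_labels fD) -(flex_labels fC); apply: In_fst.
- case: D => [r' bs'|r' bs'|D|n|] // mD.
    by have := matches_flex mD isT; have := matches_flex mC isT; case: (unf T).
  have fC := matches_flex mC isT; have fD := matches_flex mD isT.
  have /andP[_ /allIn hC] := mC; apply/andP; split.
    move: fC; case: (unf T) => //= r2 ts /andP[-> /fam_relP h]; apply/fam_relP => l.
    rewrite (assoc_map (fun k b => (b.1, merge b.2 (child k (LBra r' bs'))))).
    by have := h l; case: (assoc l bs).
  apply/allIn => _ /In_map[b bb ->] /=; apply: IH => //; first exact: hC.
  apply: (@matches_child (LBra r' bs')) => //.
  by rewrite (flex_labels fD) -(flex_labels fC); apply: In_fst.
Qed.

(** A node of the merge is a node on both sides, so [A] can remain a node only where [C] and [D]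
    both are. The common instance [T] ensures that labels correspond, so children can be
    compared. *)
Lemma finer_merge A C D T : matches A T -> matches C T -> matches D T ->
  finer A (merge C D) -> finer A C && finer A D.
Proof.
elim/ltype_nest_ind: A C D T => [r bs|r bs|C _|n|] //; move=> /List.Forall_forall IH C D T mA.
- case: C => [r' bs'|r' bs'|C|n|] //; last by case: D.
  case: D => [r2 bs2|r2 bs2|D|n|] // mC mD /allIn h; rewrite -all_predI; apply/allIn => b bb /=.
  have := h b bb; have bl := In_fst bb.
  have fA := matches_flex mA isT; have fC := matches_flex mC isT; have fD := matches_flex mD isT.
  have bC : b.1 \in labels (LSel r' bs') by rewrite (flex_labels fC) -(flex_labels fA).
  have bD : b.1 \in labels (LSel r2 bs2) by rewrite (flex_labels fD) -(flex_labels fA).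
  rewrite (@child_map_sel b.1 r' bs' (fun k U => merge U (child k (LSel r2 bs2)))) //.
  apply: IH (child b.1 (unf T)) _ _ _ => //; try exact: matches_child.
  by have /andP[_ /allIn] := mA; apply.
- case: C => [r' bs'|r' bs'|C|n|] //; first by case: D.
  case: D => [r2 bs2|r2 bs2|D|n|] // mC mD /allIn h; rewrite -all_predI; apply/allIn => b bb /=.
  have := h b bb; have bl := In_fst bb.
  have fA := matches_flex mA isT; have fC := matches_flex mC isT; have fD := matches_flex mD isT.
  have bC : b.1 \in labels (LBra r' bs') by rewrite (flex_labels fC) -(flex_labels fA).
  have bD : b.1 \in labels (LBra r2 bs2) by rewrite (flex_labels fD) -(flex_labels fA).
  rewrite (@child_map_bra b.1 r' bs' (fun k U => merge U (child k (LBra r2 bs2)))) //.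
  apply: IH (child b.1 (unf T)) _ _ _ => //; try exact: matches_child.
  by have /andP[_ /allIn] := mA; apply.
Qed.

Lemma matches_merge_all Cs T : 0 < size Cs -> (forall C, List.In C Cs -> matches C T) ->
  matches (merge_all Cs) T.
Proof.
case: Cs => //= C Cs _; elim: Cs => [|D Cs IH] h /=; first by apply: h; left.
apply: matches_merge; first by apply: h; right; left.
by apply: IH => E [<-|EC]; apply: h; [left|right; right].
Qed.

Lemma finer_merge_all A Cs T : matches A T -> (forall C, List.In C Cs -> matches C T) ->
  finer A (merge_all Cs) -> forall C, List.In C Cs -> finer A C.
Proof.
move=> mA; case: Cs => //= C Cs; elim: Cs => [|D Cs IH] h /=; first by move=> f ? [<-|].
have h' E : C = E \/ List.In E Cs -> matches E T.
  by move=> [<-|EC]; apply: h; [left|right; right].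
have mD : matches D T by apply: h; right; left.
have mm : matches (foldr merge C Cs) T by apply: (@matches_merge_all (C :: Cs)).
by move=> /(finer_merge mA mD mm) /andP[fD /(IH h') fC] E [<-|[<-//|EC]]; apply: fC; [left|right].
Qed.

Lemma finer_refl k C : wf_ltype k C -> finer C C.
Proof.
elim/ltype_nest_ind: C k => //= r bs => /List.Forall_forall IH k /andP[/andP[_ ubs] /allIn h].
  apply/allIn => -[l x] bb; rewrite /= (In_assoc ubs bb).
  by apply: IH bb _ (h _ bb).
apply/allIn => -[l x] bb; rewrite /= (In_assoc ubs bb).
by apply: IH bb _ (h _ bb).
Qed.

Lemma finer_child C D l : is_node C -> finer C D -> l \in labels C ->
  is_node D /\ finer (child l C) (child l D).
Proof.
case: C => // r bs _; case: D => // r' bs' /allIn h.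
  by move=> /child_In_sel -/(_ r) [x xbs ->]; split=> //; exact: (h _ xbs).
by move=> /child_In_bra -/(_ r) [x xbs ->]; split=> //; exact: (h _ xbs).
Qed.

Lemma wf_merge T U : wf_ltype 0 T -> wf_ltype 0 U -> wf_ltype 0 (merge T U).
Proof.
elim/ltype_nest_ind: T U => [r bs|r bs|T _|n|] //; move=> /List.Forall_forall IH.
- case=> // r' bs' /andP[w /allIn h] wU /=; rewrite /wf_fam size_map -map_comp.
  move: w; rewrite /wf_fam => -> /=; apply/allIn => _ /In_map[b bb ->] /=.
  by apply: IH => //; [exact: h|exact: (@wf_child _ (LSel r' bs'))].
- case=> // r' bs' /andP[w /allIn h] wU /=; rewrite /wf_fam size_map -map_comp.
  move: w; rewrite /wf_fam => -> /=; apply/allIn => _ /In_map[b bb ->] /=.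
  by apply: IH => //; [exact: h|exact: (@wf_child _ (LBra r' bs'))].
Qed.

Lemma wf_merge_all Ts : (forall T, List.In T Ts -> wf_ltype 0 T) -> wf_ltype 0 (merge_all Ts).
Proof.
case: Ts => //= T Ts; elim: Ts => [|U Ts IH] h /=; first by apply: h; left.
apply: wf_merge; first by apply: h; right; left.
by apply: IH => V [<-|VT]; apply: h; [left|right; right].
Qed.

Lemma wf_call_types Gam X : wf_sorting Gam -> all (wf_ltype 0) (call_types Gam X).
Proof.
rewrite /call_types; case E: (onth _ X) => [x|] // /allIn /(_ x); apply.
by elim: (sprocs Gam) X E => [|y s IH] [|X] //= => [[->]|/IH]; [left|right].
Qed.

Lemma assoc_zip_all (K : eqType) (V : Type) (p : pred V) k (s : seq K) (t : seq V) v :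
  all p t -> assoc k (zip s t) = Some v -> p v.
Proof.
elim: s t => [|x s IHs] [|y t] //= /andP[py pt]; case: eqP => [_ [<-]|_] //.
exact: IHs.
Qed.

Lemma wf_mu T : wf_ltype 0 T -> wf_ltype 0 (LMu T).
Proof. by move=> wT; rewrite /= (wf_lunguarded _ wT) // (wf_ltype_weaken _ wT). Qed.

Lemma wf_cand Gam P d : wf_sorting Gam -> wf_proc P -> wf_ltype 0 (cand Gam P d).
Proof.
elim/proc_nest_ind: P Gam d =>
  [c r bs|c r bs|G P IH|Ss Ts P Q IHP IHQ|X vs cs||P Q IHP IHQ];
  [move=> /List.Forall_forall IH|move=> /List.Forall_forall IH|..] => Gam d wG //=.
- case/andP=> w /allIn h; case: ifP => _ /=; last first.
    by apply: wf_merge_all => _ /In_map[b bb ->]; apply: IH => //; exact: h.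
  move: w; rewrite /wf_fam size_map -map_comp => -> /=; apply/allIn => _ /In_map[b bb ->] /=.
  by apply: IH => //; exact: h.
- case/andP=> w /allIn h; case: ifP => _ /=; last first.
    by apply: wf_merge_all => _ /In_map[b bb ->]; apply: IH => //; exact: h.
  move: w; rewrite /wf_fam size_map -map_comp => -> /=; apply/allIn => _ /In_map[b bb ->] /=.
  by apply: IH => //; exact: h.
- by case/andP=> _; exact: IH.
- by case/and3P=> wTs _; apply: IHQ; rewrite /wf_sorting /= wTs.
- move=> _; case E: (assoc _ _) => [T|] //; apply: wf_mu.
  exact: assoc_zip_all (wf_call_types X wG) E.
- by case/andP=> wP wQ; case: ifP => _; [exact: IHQ|exact: IHP].
Qed.

(** The candidate is most general: the process dictates everything about a type for [d] except the
    intervals at its own selections, and [cand] records exactly the dictated part. *)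
Lemma matches_cand Gam P d T : wf_sorting Gam -> wf_proc P -> check Gam P d T ->
  matches (cand Gam P d) T.
Proof.
elim/proc_nest_ind: P Gam d T =>
  [c r bs|c r bs|G P IH|Ss Ts P Q IHP IHQ|X vs cs||P Q IHP IHQ];
  [move=> /List.Forall_forall IH|move=> /List.Forall_forall IH|..] => Gam d T wG //=.
- case/andP=> /andP[n0 ubs] /allIn h; case: eqP => _ /= => [/andP[hT /allIn cT]|/allIn cT]; last first.
    apply: matches_merge_all; rewrite ?size_map // => _ /In_map[b bb ->].
    by apply: IH (cT _ bb) => //; exact: h.
  move: hT; move eU: (unf T) cT => U cT; case: U eU cT => //= r' ts eU cT /andP[-> /fam_relP hT].
  apply/andP; split; last first.
    by apply/allIn => _ /In_map[b bb ->] /=; apply: IH (cT _ bb) => //; exact: h.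
  apply/fam_relP => l.
  have := assoc_mapv (fun x : prob * value * proc =>
    (iprob01, odflt 0 (vsort Gam x.1.2), cand Gam x.2 d)) l bs => ->.
  have := hT l; case: (assoc l bs) (assoc l ts) => [[[p v] P]|] [[[dl S0] V]|] //=.
  by case/andP=> /eqP-> _ /=; rewrite eqxx ?andbT //; apply/iprob_eqP.
- case/andP=> /andP[n0 ubs] /allIn h; case: eqP => _ /= => [/andP[hT /allIn cT]|/allIn cT]; last first.
    apply: matches_merge_all; rewrite ?size_map // => _ /In_map[b bb ->].
    by apply: IH (cT _ bb) => //; exact: h.
  move: hT; move eU: (unf T) cT => U cT; case: U eU cT => //= r' ts eU cT /andP[-> /fam_relP hT].
  apply/andP; split; last first.
    by apply/allIn => _ /In_map[b bb ->] /=; apply: IH (cT _ bb) => //; exact: h.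
  apply/fam_relP => l.
  have := assoc_mapv (fun x : sort * proc =>
    (x.1, cand (add_vals [:: x.1] Gam) x.2 d)) l bs => ->.
  by have := hT l; case: (assoc l bs) (assoc l ts) => [[p P]|] [[S0 V]|].
- by case/andP=> _; exact: IH.
- by case/and3P=> wTs _; apply: IHQ; rewrite /wf_sorting /= wTs.
- move=> _; case E: (assoc _ _) => [U|] //= /teqbP h; apply/teqbP; last exact: type_eq_sym.
  apply: type_eq_trans (type_eq_sym h); apply: type_eq_mu.
  exact: assoc_zip_all (wf_call_types X wG) E.
- by move=> _ /teqbP h; apply/teqbP/type_eq_sym.
- by case/andP=> wP wQ; case: ifP => _; [exact: IHQ|exact: IHP].
Qed.

Lemma in_iprob01 (p : prob) : in_iprob p iprob01.
Proof. exact: valP p. Qed.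

Lemma check_leaf Gam P d C T : ~~ is_node C -> matches C T -> check Gam P d T ->
  check Gam P d C.
Proof. by move=> nC; rewrite matches_leaf // => /teqbP /type_eq_sym; exact: check_eq. Qed.

(** A merged candidate is not the candidate of any single branch, so the induction speaks of an
    arbitrary [C] that stops descending no later than the candidate of the subprocess. At a leaf,
    [C] equals the known solution [T]; at a node, its intervals are [iprob01] and contain every
    probability. *)
Lemma check_finer Gam P d C T : wf_sorting Gam -> wf_proc P -> check Gam P d T ->
  matches C T -> finer C (cand Gam P d) -> check Gam P d C.
Proof.
elim/proc_nest_ind: P Gam d C T =>
  [c r bs|c r bs|G P IH|Ss Ts P Q IHP IHQ|X vs cs||P Q IHP IHQ];
  [move=> /List.Forall_forall IH|move=> /List.Forall_forall IH|..] => Gam d C T wG wP cPT mC;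
  (* The leaf case is settled here for all process forms at once; from now on [C] is a node. *)
  case nC: (is_node C); try (by move=> _; apply: check_leaf cPT; rewrite ?nC); move: wP (cPT) => /=.
- case/andP=> /andP[n0 ubs] /allIn wP; case: eqP => [ecd|_] /=; last first.
    move=> /allIn cT f; apply/allIn => b bb.
    have mC2 := mC; apply: IH (cT _ bb) mC2 _ => //; first exact: wP.
    (* For a prefix on another channel the candidate is a merge, and [C] is finer than each of its
       parts because they all have [T] as an instance. *)
    apply: (finer_merge_all mC _ f); last by apply/In_map; exists b.
    by move=> _ /In_map[b' bb' ->]; apply: matches_cand (cT _ bb') => //; exact: wP.
  case/andP=> hT /allIn cT f; have fC := matches_flex mC nC.
  have [lT [ts eT hts]] := sel_headP hT.
  have nmu : unf C = C by apply: unf_nmu; case: (C) nC.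
  have lab b : List.In b bs -> b.1 \in labels C.
    by move=> bb; rewrite (flex_labels fC) -lT; apply: In_fst.
  rewrite nmu; apply/andP; split.
    (* Labels and sorts of [C] are those of the head of [T], which passes the test; only the
       intervals differ. *)
    move: fC hT; rewrite eT; case: (C) => //= r' us /andP[/eqP-> /fam_relP h] /andP[_ /fam_relP h2].
    rewrite eqxx; apply/fam_relP => l; move: (h l) (h2 l).
    case: (assoc l us) (assoc l ts) (assoc l bs) => [[[dl s] U]|] [[[dl' s'] U']|] [[[p v] P]|] //=.
    case/andP=> /iprob_eqP-> /eqP-> /andP[-> _]; exact: in_iprob01.
  apply/allIn => b bb; apply: IH (cT _ bb) _ _ => //; first exact: wP.
    by apply: matches_child => //; exact: lab.
  have [_] := finer_child nC f (lab _ bb); rewrite /=.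
  have := assoc_mapv (fun x : prob * value * proc =>
    (iprob01, odflt 0 (vsort Gam x.1.2), cand Gam x.2 d)) b.1 bs => ->.
  by rewrite (In_assoc ubs (v := b.2)) //; case: b bb.
- case/andP=> /andP[n0 ubs] /allIn wP; case: eqP => [ecd|_] /=; last first.
    move=> /allIn cT f; apply/allIn => b bb.
    have mC2 := mC; apply: IH (cT _ bb) mC2 _ => //; first exact: wP.
    apply: (finer_merge_all mC _ f); last by apply/In_map; exists b.
    by move=> _ /In_map[b' bb' ->]; apply: matches_cand (cT _ bb') => //; exact: wP.
  case/andP=> hT /allIn cT f; have fC := matches_flex mC nC.
  have [lT [ts eT hts]] := bra_headP hT.
  have nmu : unf C = C by apply: unf_nmu; case: (C) nC.
  have lab b : List.In b bs -> b.1 \in labels C.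
    by move=> bb; rewrite (flex_labels fC) -lT; apply: In_fst.
  rewrite nmu; apply/andP; split.
    move: fC hT; rewrite eT; case: (C) => //= r' us /andP[/eqP-> /fam_relP h] /andP[_ /fam_relP h2].
    rewrite eqxx; apply/fam_relP => l; move: (h l) (h2 l).
    by case: (assoc l us) (assoc l ts) (assoc l bs) => [[s U]|] [[s' U']|] [[s2 P]|] //= /eqP->.
  apply/allIn => b bb; apply: IH (cT _ bb) _ _ => //; first exact: wP.
    by apply: matches_child => //; exact: lab.
  have [_] := finer_child nC f (lab _ bb); rewrite /=.
  have := assoc_mapv (fun x : sort * proc =>
    (x.1, cand (add_vals [:: x.1] Gam) x.2 d)) b.1 bs => ->.
  by rewrite (In_assoc ubs (v := b.2)) //; case: b bb.
- by case/andP=> _ wP cT; exact: IH cT mC.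
- case/and3P=> wTs _ wQ cT; apply: IHQ cT mC => //.
  by rewrite /wf_sorting /= wTs.
(* The candidate of a call is a leaf, and no node is finer than a leaf. *)
- by case: (assoc _ _) => [U|] _ _; case: (C) nC.
- by move=> _ _; case: (C) nC.
- by case/andP=> wP wQ; case: ifP => _ cT; [exact: IHQ cT mC|exact: IHP cT mC].
Qed.

Lemma check_cand Gam P d T : wf_sorting Gam -> wf_proc P -> check Gam P d T ->
  check Gam P d (cand Gam P d).
Proof.
move=> wG wP cT; apply: (check_finer wG wP cT); first exact: matches_cand.
exact: finer_refl (wf_cand d wG wP).
Qed.

(** * Inference and the decision of typability *)

Definition infer (Gam : sorting) (P : proc) : typing :=
  [seq (d, cand Gam P d) | d <- undup (fc P)].

(** When some channel has no type its candidate is meaningless, hence the check of the inferred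
    typing. By [check_cand] this check fails only if no type exists. *)
Definition typable (Gam : sorting) (P : proc) : bool :=
  ok Gam P && all (fun x => check Gam P x.1 x.2) (infer Gam P).

Lemma typable_infer Gam P : wf_sorting Gam -> wf_proc P -> typable Gam P ->
  typed Gam P (infer Gam P).
Proof.
move=> wG wP /andP[okP /allIn h]; apply: typable_typed => //.
have dE : dom (infer Gam P) = undup (fc P).
  by rewrite /dom /infer -map_comp map_id.
split=> //.
- rewrite /wf_typing dE undup_uniq /=; apply/allIn => _ /In_map[d _ ->].
  exact: wf_cand.
- by move=> d; rewrite dE mem_undup.
- by move=> d T dT; exact: (h _ (assoc_In dT)).
Qed.

Lemma typableP Gam P : wf_sorting Gam -> wf_proc P ->
  (exists Del, typed Gam P Del) <-> typable Gam P.
Proof.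
move=> wG wP; split=> [[Del h]|h]; last by exists (infer Gam P); exact: typable_infer.
have [_ okP sD cD] := typed_inv h wG wP; rewrite /typable okP /=.
apply/allIn => _ /In_map[d /In_mem + ->] /=; rewrite mem_undup => /sD.
by rewrite /dom assoc_mem; case E: (assoc d Del) => [T|] // _; exact: check_cand (cD _ _ E).
Qed.

(** * Computable functions *)

(** A class with one field and no wrapper: encodings found by inference are convertible to the
    prescribed ones, such as [enc_input] for pairs of a sorting and a process. *)
Class Enc (A : Type) := enc : A -> tree.

(** As with the numeral 0 and the empty list, [false] and [None] are encoded by [Nil], so a single
    [EIf] performs each of these case distinctions. These are also the answers expected by
    [decidable_on]. *)
Definition enc_bool (b : bool) : tree := if b then Cons Nil Nil else Nil.
Definition enc_pair (A B : Type) (eA : Enc A) (eB : Enc B) (p : A * B) : tree :=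
  Cons (eA p.1) (eB p.2).
Definition enc_option (A : Type) (eA : Enc A) (x : option A) : tree :=
  if x is Some a then Cons Nil (eA a) else Nil.
Definition enc_prob (p : prob) : tree := enc_rat (sval p).

#[global] Instance Enc_nat : Enc nat := enc_nat.
#[global] Instance Enc_bool : Enc bool := enc_bool.
#[global] Instance Enc_unit : Enc unit := fun _ => Nil.
#[global] Instance Enc_prod A B (eA : Enc A) (eB : Enc B) : Enc (A * B) := enc_pair eA eB.
#[global] Instance Enc_seq A (eA : Enc A) : Enc (seq A) := enc_seq eA.
#[global] Instance Enc_option A (eA : Enc A) : Enc (option A) := enc_option eA.
#[global] Instance Enc_prob : Enc prob := enc_prob.
#[global] Instance Enc_iprob : Enc iprob := enc_iprob.
#[global] Instance Enc_chan : Enc chan := enc_chan.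
#[global] Instance Enc_value : Enc value := enc_value.
#[global] Instance Enc_ltype : Enc ltype := enc_ltype.
#[global] Instance Enc_gtype : Enc gtype := enc_gtype.
#[global] Instance Enc_proc : Enc proc := enc_proc.
#[global] Instance Enc_sorting : Enc sorting := enc_sorting.

Variant cmp (A B : Type) (eA : Enc A) (eB : Enc B) (F : A -> B) : Prop :=
  Cmp g of forall a, run g (eA a) (eB (F a)).
Arguments cmp {A B eA eB} F.

Lemma cmp_ext A B (eA : Enc A) (eB : Enc B) (F G : A -> B) : F =1 G -> cmp F -> cmp G.
Proof. by move=> e [g h]; exists g => a; rewrite -e. Qed.

Lemma cmp_id A (eA : Enc A) : cmp (fun a : A => a).
Proof. by exists EArg => a; apply: eval_arg. Qed.

Fixpoint quote (t : tree) : expr :=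
  if t is Cons a b then ECons (quote a) (quote b) else ENil.

Lemma eval_quote f x t : eval f x (quote t) t.
Proof. by elim: t => [|a IHa b IHb] /=; constructor. Qed.

Lemma cmp_const A B (eA : Enc A) (eB : Enc B) (b : B) : cmp (fun _ : A => b).
Proof. by exists (quote (eB b)) => a; apply: eval_quote. Qed.

Lemma eval_call f x g (y t : tree) : run g y t -> eval f x EArg y -> eval f x (EApp g EArg) t.
Proof. by move=> h hy; apply: eval_app hy h. Qed.

(** Classes indexed by arity, so that the computability of a curried function is found from its head
    symbol; several arguments are passed as pairs nested to the right. *)
Class Cmp1 A B (eA : Enc A) (eB : Enc B) (F : A -> B) : Prop := cmp1P : cmp F.
Class Cmp2 A B C (eA : Enc A) (eB : Enc B) (eC : Enc C) (F : A -> B -> C) : Prop :=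
  cmp2P : cmp (fun p : A * B => F p.1 p.2).
Class Cmp3 A B C D (eA : Enc A) (eB : Enc B) (eC : Enc C) (eD : Enc D)
    (F : A -> B -> C -> D) : Prop :=
  cmp3P : cmp (fun p : A * (B * C) => F p.1 p.2.1 p.2.2).
Class Cmp4 A B C D E (eA : Enc A) (eB : Enc B) (eC : Enc C) (eD : Enc D) (eE : Enc E)
    (F : A -> B -> C -> D -> E) : Prop :=
  cmp4P : cmp (fun p : A * (B * (C * D)) => F p.1 p.2.1 p.2.2.1 p.2.2.2).
Arguments Cmp1 {A B eA eB} F.
Arguments Cmp2 {A B C eA eB eC} F.
Arguments Cmp3 {A B C D eA eB eC eD} F.
Arguments Cmp4 {A B C D E eA eB eC eD eE} F.

Section Closure.
Context (X A B : Type) (eX : Enc X) (eA : Enc A) (eB : Enc B).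

Lemma cmp_comp (F : A -> B) (f : X -> A) : cmp F -> cmp f -> cmp (fun x => F (f x)).
Proof.
move=> [g h] [g' h']; exists (EApp g (EApp g' EArg)) => x.
apply: eval_app (h _); apply: eval_app (h' _); exact: eval_arg.
Qed.

Lemma cmp_pair (f : X -> A) (f' : X -> B) : cmp f -> cmp f' -> cmp (fun x => (f x, f' x)).
Proof.
move=> [g h] [g' h']; exists (ECons (EApp g EArg) (EApp g' EArg)) => x.
by apply: eval_cons; apply: eval_app; [exact: eval_arg|exact: h|exact: eval_arg|exact: h'].
Qed.

Lemma cmp_app1 (F : A -> B) (f : X -> A) : Cmp1 F -> cmp f -> cmp (fun x => F (f x)).
Proof. exact: cmp_comp. Qed.

Lemma cmp_if (b : X -> bool) (f f' : X -> A) :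
  cmp b -> cmp f -> cmp f' -> cmp (fun x => if b x then f x else f' x).
Proof.
move=> [gb hb] [g h] [g' h']; exists (EIf (EApp gb EArg) (EApp g EArg) (EApp g' EArg)) => x.
have := hb x; case: (b x) => hx.
  apply: eval_if_true; first by apply: eval_call hx _; exact: eval_arg.
  by apply: eval_call (h x) _; exact: eval_arg.
apply: eval_if_false; first by apply: eval_call hx _; exact: eval_arg.
by apply: eval_call (h' x) _; exact: eval_arg.
Qed.

End Closure.

Section Closure2.
Context (X A B C D E : Type) (eX : Enc X) (eA : Enc A) (eB : Enc B) (eC : Enc C)
  (eD : Enc D) (eE : Enc E).

Lemma cmp_app2 (F : A -> B -> C) (f : X -> A) (g : X -> B) :
  Cmp2 F -> cmp f -> cmp g -> cmp (fun x => F (f x) (g x)).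
Proof. by move=> h hf hg; apply: (cmp_comp h (cmp_pair hf hg)). Qed.

Lemma cmp_app3 (F : A -> B -> C -> D) (f : X -> A) (g : X -> B) (k : X -> C) :
  Cmp3 F -> cmp f -> cmp g -> cmp k -> cmp (fun x => F (f x) (g x) (k x)).
Proof. by move=> h hf hg hk; apply: (cmp_comp h (cmp_pair hf (cmp_pair hg hk))). Qed.

Lemma cmp_app4 (F : A -> B -> C -> D -> E) (f : X -> A) (g : X -> B) (k : X -> C) (l : X -> D) :
  Cmp4 F -> cmp f -> cmp g -> cmp k -> cmp l -> cmp (fun x => F (f x) (g x) (k x) (l x)).
Proof.
by move=> h hf hg hk hl; apply: (cmp_comp h (cmp_pair hf (cmp_pair hg (cmp_pair hk hl)))).
Qed.

End Closure2.

#[global] Instance Cmp_fst A B (eA : Enc A) (eB : Enc B) : Cmp1 (@fst A B).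
Proof. by exists (EHd EArg) => a; apply: (eval_hd (t := enc a)); exact: eval_arg. Qed.
#[global] Instance Cmp_snd A B (eA : Enc A) (eB : Enc B) : Cmp1 (@snd A B).
Proof. by exists (ETl EArg) => a; apply: (eval_tl (t := enc a)); exact: eval_arg. Qed.
#[global] Instance Cmp_pair A B (eA : Enc A) (eB : Enc B) : Cmp2 (@pair A B).
Proof. by exists EArg => -[a b]; exact: eval_arg. Qed.
#[global] Instance Cmp_cons A (eA : Enc A) : Cmp2 (@cons A).
Proof. by exists EArg => -[a b]; exact: eval_arg. Qed.
#[global] Instance Cmp_Some A (eA : Enc A) : Cmp1 (@Some A).
Proof. by exists (ECons ENil EArg) => a; apply: eval_cons; constructor. Qed.
#[global] Instance Cmp_S : Cmp1 S.
Proof. by exists (ECons ENil EArg) => a; apply: eval_cons; constructor. Qed.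

Section Cases.
Context (X A B : Type) (eX : Enc X) (eA : Enc A) (eB : Enc B).

Lemma cmp_nat_case (n : X -> nat) (z : X -> A) (s : X -> nat -> A) :
  cmp n -> cmp z -> cmp (fun p : X * nat => s p.1 p.2) ->
  cmp (fun x => match n x with 0 => z x | m.+1 => s x m end).
Proof.
move=> [gn hn] [gz hz] [gs hs].
exists (EIf (EApp gn EArg) (EApp gs (ECons EArg (ETl (EApp gn EArg)))) (EApp gz EArg)) => x.
have hn' : forall f, eval f (eX x) (EApp gn EArg) (enc_nat (n x)).
  by move=> f; apply: eval_call (hn x) _; exact: eval_arg.
case: (n x) hn' => [|m] hn'.
  by apply: eval_if_false (hn' _) _; apply: eval_call (hz x) _; exact: eval_arg.
apply: eval_if_true (hn' _) _; apply: eval_app (hs (x, m)).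
by apply: eval_cons; [exact: eval_arg|apply: eval_tl (hn' _)].
Qed.

Lemma cmp_seq_case (s : X -> seq B) (z : X -> A) (c : X -> B -> seq B -> A) :
  cmp s -> cmp z -> cmp (fun p : X * (B * seq B) => c p.1 p.2.1 p.2.2) ->
  cmp (fun x => match s x with [::] => z x | b :: s' => c x b s' end).
Proof.
move=> [gn hn] [gz hz] [gs hs].
exists (EIf (EApp gn EArg) (EApp gs (ECons EArg (EApp gn EArg))) (EApp gz EArg)) => x.
have hn' : forall f, eval f (eX x) (EApp gn EArg) (enc_seq eB (s x)).
  by move=> f; apply: eval_call (hn x) _; exact: eval_arg.
case: (s x) hn' => [|b s'] hn'.
  by apply: eval_if_false (hn' _) _; apply: eval_call (hz x) _; exact: eval_arg.
apply: eval_if_true (hn' _) _; apply: eval_app (hs (x, (b, s'))).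
by apply: eval_cons; [exact: eval_arg|exact: hn'].
Qed.

Lemma cmp_option_case (s : X -> option B) (z : X -> A) (c : X -> B -> A) :
  cmp s -> cmp z -> cmp (fun p : X * B => c p.1 p.2) ->
  cmp (fun x => match s x with Some b => c x b | None => z x end).
Proof.
move=> [gn hn] [gz hz] [gs hs].
exists (EIf (EApp gn EArg) (EApp gs (ECons EArg (ETl (EApp gn EArg)))) (EApp gz EArg)) => x.
have hn' : forall f, eval f (eX x) (EApp gn EArg) (enc_option eB (s x)).
  by move=> f; apply: eval_call (hn x) _; exact: eval_arg.
case: (s x) hn' => [b|] hn'; last first.
  by apply: eval_if_false (hn' _) _; apply: eval_call (hz x) _; exact: eval_arg.
apply: eval_if_true (hn' _) _; apply: eval_app (hs (x, b)).
by apply: eval_cons; [exact: eval_arg|apply: eval_tl (hn' _)].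
Qed.

(** Tags are unary numerals, so dispatching walks down the tag and the list of handlers together. *)
Fixpoint switch (tag arg : expr) (es : seq expr) : expr :=
  if es is e :: es' then EIf tag (switch (ETl tag) arg es') (EApp e arg) else ENil.

Lemma eval_switch f x tag arg es i v t :
  eval f x tag (enc_nat i) -> i < size es -> eval f x arg v -> run (nth ENil es i) v t ->
  eval f x (switch tag arg es) t.
Proof.
move=> htag hi harg; elim: es i tag htag hi => //= e es IH [|i] tag htag hi ht.
  by apply: eval_if_false htag _; apply: eval_app harg ht.
by apply: eval_if_true (htag) _; apply: IH ht => //; apply: eval_tl htag.
Qed.

(* Case analysis on a value encoded as a pair of a tag and a payload. *)
Lemma cmp_switch (T : Type) (eT : Enc T) (t : X -> T) (es : seq expr) (F : X -> A) :
  cmp t ->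
  (forall x, exists i v, [/\ eT (t x) = Cons (enc_nat i) v, i < size es &
                             run (nth ENil es i) (Cons (eX x) v) (eA (F x))]) ->
  cmp F.
Proof.
move=> [g h] hF.
exists (switch (EHd (EApp g EArg)) (ECons EArg (ETl (EApp g EArg))) es) => x.
have [i [v [e hi hr]]] := hF x; have := h x; rewrite e => hx.
have hx' f : eval f (eX x) (EApp g EArg) (Cons (enc_nat i) v).
  by apply: eval_call hx _; exact: eval_arg.
apply: eval_switch hr => //; first exact: eval_hd (hx' _).
by apply: eval_cons; [exact: eval_arg|exact: eval_tl (hx' _)].
Qed.

Lemma cmp_chan_case (c : X -> chan) (f : X -> nat -> A) (g : X -> nat -> role -> A) :
  cmp c -> cmp (fun p : X * nat => f p.1 p.2) ->
  cmp (fun p : X * (nat * nat) => g p.1 p.2.1 p.2.2) ->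
  cmp (fun x => match c x with CVar n => f x n | CRole s r => g x s r end).
Proof.
move=> hc [f' hf] [g' hg]; apply: (cmp_switch (es := [:: f'; g']) hc) => x.
case: (c x) => [n|s r]; [exists 0, (enc_nat n)|exists 1, (Cons (enc_nat s) (enc_nat r))].
  by split=> //; exact: (hf (x, n)).
by split=> //; exact: (hg (x, (s, r))).
Qed.

Lemma cmp_value_case (c : X -> value) (f : X -> nat -> A) (g : X -> sort -> nat -> A) :
  cmp c -> cmp (fun p : X * nat => f p.1 p.2) ->
  cmp (fun p : X * (nat * nat) => g p.1 p.2.1 p.2.2) ->
  cmp (fun x => match c x with VVar n => f x n | VLit s r => g x s r end).
Proof.
move=> hc [f' hf] [g' hg]; apply: (cmp_switch (es := [:: f'; g']) hc) => x.
case: (c x) => [n|s r]; [exists 0, (enc_nat n)|exists 1, (Cons (enc_nat s) (enc_nat r))].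
  by split=> //; exact: (hf (x, n)).
by split=> //; exact: (hg (x, (s, r))).
Qed.

Lemma cmp_ltype_case (t : X -> ltype) (fs : X -> role -> fam (iprob * sort * ltype) -> A)
    (fb : X -> role -> fam (sort * ltype) -> A) (fm : X -> ltype -> A) (fv : X -> nat -> A)
    (fe : X -> A) :
  cmp t ->
  cmp (fun p : X * (role * fam (iprob * sort * ltype)) => fs p.1 p.2.1 p.2.2) ->
  cmp (fun p : X * (role * fam (sort * ltype)) => fb p.1 p.2.1 p.2.2) ->
  cmp (fun p : X * ltype => fm p.1 p.2) -> cmp (fun p : X * nat => fv p.1 p.2) -> cmp fe ->
  cmp (fun x => match t x with
                | LSel r bs => fs x r bs | LBra r bs => fb x r bs | LMu T => fm x T
                | LVar n => fv x n | LEnd => fe x end).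
Proof.
move=> ht [gs hs] [gb hb] [gm hm] [gv hv] [ge he].
(* A constructor without arguments still carries a payload [Nil]; [EHd] discards it, as the last
   handler expects only the context. *)
apply: (cmp_switch (es := [:: gs; gb; gm; gv; EApp ge (EHd EArg)]) ht) => x.
case: (t x) => [r bs|r bs|T|n|].
- by exists 0, (Cons (enc_nat r) (enc_fam enc_isort enc_ltype bs)); split=> //; exact: (hs (x, (r, bs))).
- by exists 1, (Cons (enc_nat r) (enc_fam enc_nat enc_ltype bs)); split=> //; exact: (hb (x, (r, bs))).
- by exists 2, (enc_ltype T); split=> //; exact: (hm (x, T)).
- by exists 3, (enc_nat n); split=> //; exact: (hv (x, n)).
- exists 4, Nil; split=> //; apply: eval_app (he x).
  by apply: (eval_hd (t := Cons (eX x) Nil)); exact: eval_arg.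
Qed.

Lemma cmp_gtype_case (t : X -> gtype)
    (fs : X -> role -> role -> fam (iprob * sort * gtype) -> A)
    (fm : X -> gtype -> A) (fv : X -> nat -> A) (fe : X -> A) :
  cmp t ->
  cmp (fun p : X * (role * (role * fam (iprob * sort * gtype))) =>
         fs p.1 p.2.1 p.2.2.1 p.2.2.2) ->
  cmp (fun p : X * gtype => fm p.1 p.2) -> cmp (fun p : X * nat => fv p.1 p.2) -> cmp fe ->
  cmp (fun x => match t x with
                | GMsg p q bs => fs x p q bs | GMu T => fm x T
                | GVar n => fv x n | GEnd => fe x end).
Proof.
move=> ht [gs hs] [gm hm] [gv hv] [ge he].
apply: (cmp_switch (es := [:: gs; gm; gv; EApp ge (EHd EArg)]) ht) => x.
case: (t x) => [p q bs|T|n|].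
- exists 0, (Cons (enc_nat p) (Cons (enc_nat q) (enc_fam enc_isort enc_gtype bs))).
  by split=> //; exact: (hs (x, (p, (q, bs)))).
- by exists 1, (enc_gtype T); split=> //; exact: (hm (x, T)).
- by exists 2, (enc_nat n); split=> //; exact: (hv (x, n)).
- exists 3, Nil; split=> //; apply: eval_app (he x).
  by apply: (eval_hd (t := Cons (eX x) Nil)); exact: eval_arg.
Qed.

Lemma cmp_proc_case (t : X -> proc)
    (fs : X -> chan -> role -> fam ((prob * value) * proc) -> A)
    (fb : X -> chan -> role -> fam (sort * proc) -> A)
    (fn : X -> gtype -> proc -> A)
    (fd : X -> seq sort -> seq ltype -> proc -> proc -> A)
    (fk : X -> nat -> seq value -> seq chan -> A) (fe : X -> A)
    (fp : X -> proc -> proc -> A) :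
  cmp t ->
  cmp (fun p : X * (chan * (role * fam ((prob * value) * proc))) =>
         fs p.1 p.2.1 p.2.2.1 p.2.2.2) ->
  cmp (fun p : X * (chan * (role * fam (sort * proc))) => fb p.1 p.2.1 p.2.2.1 p.2.2.2) ->
  cmp (fun p : X * (gtype * proc) => fn p.1 p.2.1 p.2.2) ->
  cmp (fun p : X * ((seq sort * seq ltype) * (proc * proc)) =>
         fd p.1 p.2.1.1 p.2.1.2 p.2.2.1 p.2.2.2) ->
  cmp (fun p : X * (nat * (seq value * seq chan)) => fk p.1 p.2.1 p.2.2.1 p.2.2.2) ->
  cmp fe ->
  cmp (fun p : X * (proc * proc) => fp p.1 p.2.1 p.2.2) ->
  cmp (fun x => match t x with
                | PSel c r bs => fs x c r bs | PBra c r bs => fb x c r bs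
                | PNew G P => fn x G P | PDef Ss Ts P Q => fd x Ss Ts P Q
                | PCall Y vs cs => fk x Y vs cs | PNil => fe x | PPar P Q => fp x P Q end).
Proof.
move=> ht [gs hs] [gb hb] [gn hn] [gd hd] [gk hk] [ge he] [gp hp].
apply: (cmp_switch (es := [:: gs; gb; gn; gd; gk; EApp ge (EHd EArg); gp]) ht) => x.
case: (t x) => [c r bs|c r bs|G P|Ss Ts P Q|Y vs cs||P Q].
- exists 0, (Cons (enc_chan c) (Cons (enc_nat r) (enc_fam enc_pvalue enc_proc bs))).
  by split=> //; exact: (hs (x, (c, (r, bs)))).
- exists 1, (Cons (enc_chan c) (Cons (enc_nat r) (enc_fam enc_nat enc_proc bs))).
  by split=> //; exact: (hb (x, (c, (r, bs)))).
- by exists 2, (Cons (enc_gtype G) (enc_proc P)); split=> //; exact: (hn (x, (G, P))).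
- exists 3, (Cons (Cons (enc_seq enc_nat Ss) (enc_seq enc_ltype Ts))
                  (Cons (enc_proc P) (enc_proc Q))).
  by split=> //; exact: (hd (x, ((Ss, Ts), (P, Q)))).
- exists 4, (Cons (enc_nat Y) (Cons (enc_seq enc_value vs) (enc_seq enc_chan cs))).
  by split=> //; exact: (hk (x, (Y, (vs, cs)))).
- exists 5, Nil; split=> //; apply: eval_app (he x).
  by apply: (eval_hd (t := Cons (eX x) Nil)); exact: eval_arg.
- by exists 6, (Cons (enc_proc P) (enc_proc Q)); split=> //; exact: (hp (x, (P, Q))).
Qed.

End Cases.

(* One program computes F on inputs [Cons Nil a] and [map F] on inputs
   [Cons (Cons Nil Nil) s]. *)
Lemma cmp_rec A B (eA : Enc A) (eB : Enc B) (m : A -> nat) (kids : A -> seq A)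
    (body : A -> seq B -> B) (F : A -> B) :
  cmp kids -> cmp (fun p : A * seq B => body p.1 p.2) ->
  (forall a, List.Forall (fun a' => m a' < m a) (kids a)) ->
  (forall a, F a = body a [seq F a' | a' <- kids a]) -> cmp F.
Proof.
move=> [gk hk] [gb hb] hm hF.
(* [ERec] can only call the body as a whole, so mapping over the kids has to be a second mode of the
   same program. *)
pose f := EIf (EHd EArg)
  (EIf (ETl EArg)
     (ECons (ERec (ECons ENil (EHd (ETl EArg))))
            (ERec (ECons (ECons ENil ENil) (ETl (ETl EArg)))))
     ENil)
  (EApp gb (ECons (ETl EArg) (ERec (ECons (ECons ENil ENil) (EApp gk (ETl EArg)))))).
have hd1 x y : eval f (Cons x y) (EHd EArg) x.
  by apply: (eval_hd (t := Cons x y)); exact: eval_arg.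
have tl1 x y : eval f (Cons x y) (ETl EArg) y.
  by apply: (eval_tl (t := Cons x y)); exact: eval_arg.
have hs s : List.Forall (fun a => run f (Cons Nil (eA a)) (eB (F a))) s ->
    run f (Cons (Cons Nil Nil) (enc_seq eA s)) (enc_seq eB (map F s)).
  elim=> [|a s' ha _ IH].
    by apply: eval_if_true (hd1 _ _) _; apply: eval_if_false (tl1 _ _) _; exact: eval_nil.
  apply: eval_if_true (hd1 _ _) _; apply: eval_if_true (tl1 _ _) _.
  apply: eval_cons.
    apply: eval_rec ha; apply: eval_cons; first exact: eval_nil.
    by apply: (eval_hd (t := Cons (eA a) (enc_seq eA s'))); exact: tl1.
  apply: eval_rec IH; apply: eval_cons; first by apply: eval_cons; exact: eval_nil.
  by apply: (eval_tl (t := Cons (eA a) (enc_seq eA s'))); exact: tl1.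
(* Only this claim needs induction on the measure: [hs] takes the correctness on each element of the
   list as a hypothesis. *)
have hf a : run f (Cons Nil (eA a)) (eB (F a)).
  move En: (m a) => n; elim/ltn_ind: n a En => n IH a En.
  apply: eval_if_false (hd1 _ _) _; rewrite hF; apply: eval_app (hb (a, _)).
  apply: eval_cons; first exact: tl1.
  apply: eval_rec (hs (kids a) _); last first.
    by have := hm a; apply: List.Forall_impl => b; rewrite En => /IH; apply.
  apply: eval_cons; first by apply: eval_cons; exact: eval_nil.
  by apply: eval_app (hk a); exact: tl1.
exists (EApp f (ECons ENil EArg)) => a; apply: eval_app (hf a).
by apply: eval_cons; [exact: eval_nil|exact: eval_arg].
Qed.

(** * Automation of computability proofs and list iterators *)

(** Arities are tried from the largest down, and [match] moves on when no instance is found for the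
    head. *)
Ltac cmp_app :=
  match goal with
  | |- cmp (fun x => ?F (@?a x) (@?b x) (@?c x) (@?d x)) =>
      let h := constr:(_ : Cmp4 F) in refine (cmp_app4 (f := a) (g := b) (k := c) (l := d) h _ _ _ _)
  | |- cmp (fun x => ?F (@?a x) (@?b x) (@?c x)) =>
      let h := constr:(_ : Cmp3 F) in refine (cmp_app3 (f := a) (g := b) (k := c) h _ _ _)
  | |- cmp (fun x => ?F (@?a x) (@?b x)) =>
      let h := constr:(_ : Cmp2 F) in refine (cmp_app2 (f := a) (g := b) h _ _)
  | |- cmp (fun x => ?F (@?a x)) =>
      let h := constr:(_ : Cmp1 F) in refine (cmp_app1 (f := a) h _)
  end.

Ltac cmp_case := first
  [ refine (cmp_if _ _ _) | refine (cmp_nat_case _ _ _) | refine (cmp_seq_case _ _ _)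
  | refine (cmp_option_case _ _ _) | refine (cmp_chan_case _ _ _)
  | refine (cmp_value_case _ _ _) | refine (cmp_ltype_case _ _ _ _ _ _)
  | refine (cmp_gtype_case _ _ _ _ _) | refine (cmp_proc_case _ _ _ _ _ _ _ _) ].

(** A hook, redefined once the iterators on lists have been shown computable. *)
Ltac cmp_iterator := fail.

Ltac cmp_step :=
  cbv beta;
  lazymatch goal with
  | |- cmp (fun x => x) => exact (cmp_id _)
  | |- cmp (fun _ => ?c) => exact (cmp_const _ _ c)
  | |- cmp (fun _ => _) => first [cmp_iterator | cmp_app | cmp_case]
  | |- cmp ?F => first [exact (_ : Cmp1 F) | change (cmp (fun x => F x)); first [cmp_iterator | cmp_app]]
  end.

Ltac cmp_auto := repeat cmp_step.

Section Lists.
Context (X A B : Type) (eX : Enc X) (eA : Enc A) (eB : Enc B).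

Lemma cmp_foldr (f : X -> A -> B -> B) (z : X -> B) (s : X -> seq A) :
  cmp (fun p : X * (A * B) => f p.1 p.2.1 p.2.2) -> cmp z -> cmp s ->
  cmp (fun x => foldr (f x) (z x) (s x)).
Proof.
move=> hf hz hs.
have h : cmp (fun p : X * seq A => foldr (f p.1) (z p.1) p.2).
  (* Programs have no closures, so the parameters [x] of the folded function travel along with the
     list. *)
  refine (cmp_rec (m := fun p : X * seq A => size p.2)
    (kids := fun p => if p.2 is a :: s' then [:: (p.1, s')] else [::])
    (body := fun p r => if p.2 is a :: s' then
                          if r is b :: _ then f p.1 a b else z p.1
                        else z p.1) _ _ _ _).
  - by cmp_auto.
  - cmp_step.
    + by cmp_auto.
    + by refine (cmp_comp hz _); cmp_auto.
    + cmp_step.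
      * by cmp_auto.
      * by refine (cmp_comp hz _); cmp_auto.
      * refine (cmp_comp (f := fun p : X * seq A * seq B * (A * seq A) * (B * seq B) =>
          (p.1.1.1.1, (p.1.2.1, p.2.1))) hf _).
        by cmp_auto.
  - by move=> [x [|a s']] //=; constructor.
  - by move=> [x [|a s']].
refine (cmp_comp (f := fun x => (x, s x)) h (cmp_pair _ hs)); exact: cmp_id.
Qed.

End Lists.

Section Lists2.
Context (X A B : Type) (eX : Enc X) (eA : Enc A) (eB : Enc B).

Lemma cmp_map (f : X -> A -> B) (s : X -> seq A) :
  cmp (fun p : X * A => f p.1 p.2) -> cmp s -> cmp (fun x => [seq f x a | a <- s x]).
Proof.
move=> hf hs; apply: (cmp_ext (F := fun x => foldr (fun a r => f x a :: r) [::] (s x))) => [x|].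
  by elim: (s x) => //= a t ->.
apply: (cmp_foldr (f := fun x a r => f x a :: r)) => //; last exact: cmp_const.
cmp_app; last by cmp_auto.
by refine (cmp_comp (f := fun p : X * (A * seq B) => (p.1, p.2.1)) hf _); cmp_auto.
Qed.

Lemma cmp_all (f : X -> A -> bool) (s : X -> seq A) :
  cmp (fun p : X * A => f p.1 p.2) -> cmp s -> cmp (fun x => all (f x) (s x)).
Proof.
move=> hf hs; apply: (cmp_ext (F := fun x => foldr (fun a r => if f x a then r else false) true (s x))) => [x|].
  by elim: (s x) => //= a t ->.
apply: (cmp_foldr (f := fun x a r => if f x a then r else false)) => //; last exact: cmp_const.
refine (cmp_if _ _ _); try by cmp_auto.
by refine (cmp_comp (f := fun p : X * (A * bool) => (p.1, p.2.1)) hf _); cmp_auto.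
Qed.

Lemma cmp_has (f : X -> A -> bool) (s : X -> seq A) :
  cmp (fun p : X * A => f p.1 p.2) -> cmp s -> cmp (fun x => has (f x) (s x)).
Proof.
move=> hf hs; apply: (cmp_ext (F := fun x => foldr (fun a r => if f x a then true else r) false (s x))) => [x|].
  by elim: (s x) => //= a t ->.
apply: (cmp_foldr (f := fun x a r => if f x a then true else r)) => //; last exact: cmp_const.
refine (cmp_if _ _ _); try by cmp_auto.
by refine (cmp_comp (f := fun p : X * (A * bool) => (p.1, p.2.1)) hf _); cmp_auto.
Qed.

Lemma cmp_pmap (f : X -> A -> option B) (s : X -> seq A) :
  cmp (fun p : X * A => f p.1 p.2) -> cmp s -> cmp (fun x => pmap (f x) (s x)).
Proof.
move=> hf hs; apply: (cmp_ext (F := fun x => foldr (fun a r => if f x a is Some b then b :: r else r) [::] (s x))) => [x|].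
  by elim: (s x) => //= a t ->; case: (f x a).
apply: (cmp_foldr (f := fun x a r => if f x a is Some b then b :: r else r)) => //; last exact: cmp_const.
refine (cmp_option_case _ _ _); try by cmp_auto.
by refine (cmp_comp (f := fun p : X * (A * seq B) => (p.1, p.2.1)) hf _); cmp_auto.
Qed.

Lemma cmp_iter (n : X -> nat) (f : X -> A -> A) (z : X -> A) :
  cmp n -> cmp (fun p : X * A => f p.1 p.2) -> cmp z -> cmp (fun x => iter (n x) (f x) (z x)).
Proof.
move=> hn hf hz; apply: (cmp_ext (F := fun x => foldr (fun (_ : unit) => f x) (z x) (nseq (n x) tt))) => [x|].
  by elim: (n x) => //= m ->.
apply: (cmp_foldr (f := fun x (_ : unit) => f x)) => //.
  by refine (cmp_comp (f := fun p : X * (unit * A) => (p.1, p.2.2)) hf _); cmp_auto.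
(* The list of [n] units and the numeral [n] are the same tree, so iteration is a fold over the
   numeral itself. *)
have h : cmp (fun n => nseq n tt).
  exists EArg => k; have -> : Enc_seq Enc_unit (nseq k tt) = enc_nat k by elim: k => //= k ->.
  exact: eval_arg.
exact: (cmp_comp h hn).
Qed.

End Lists2.

Ltac cmp_iterator ::=
  lazymatch goal with
  | |- cmp (fun x => foldr (@?f x) (@?z x) (@?s x)) =>
      refine (@cmp_foldr _ _ _ _ _ _ f z s _ _ _)
  | |- cmp (fun x => map (@?f x) (@?s x)) => refine (@cmp_map _ _ _ _ _ _ f s _ _)
  | |- cmp (fun x => all (@?f x) (@?s x)) => refine (@cmp_all _ _ _ _ f s _ _)
  | |- cmp (fun x => has (@?f x) (@?s x)) => refine (@cmp_has _ _ _ _ f s _ _)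
  | |- cmp (fun x => pmap (@?f x) (@?s x)) => refine (@cmp_pmap _ _ _ _ _ _ f s _ _)
  | |- cmp (fun x => iter (@?n x) (@?f x) (@?z x)) => refine (@cmp_iter _ _ _ _ n f z _ _ _)
  end.

(** * Booleans, arithmetic and basic list functions *)

#[global] Instance Cmp_negb : Cmp1 negb.
Proof. by apply: (cmp_ext (F := fun b : bool => if b then false else true)); [case|cmp_auto]. Qed.
#[global] Instance Cmp_andb : Cmp2 andb.
Proof. by rewrite /Cmp2 /andb; cmp_auto. Qed.
#[global] Instance Cmp_orb : Cmp2 orb.
Proof. by rewrite /Cmp2 /orb; cmp_auto. Qed.
#[global] Instance Cmp_implb : Cmp2 implb.
Proof. by rewrite /Cmp2 /implb; cmp_auto. Qed.
#[global] Instance Cmp_predn : Cmp1 predn.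
Proof. by apply: (cmp_ext (F := fun n => if n is m.+1 then m else 0)); [case|cmp_auto]. Qed.
#[global] Instance Cmp_addn : Cmp2 addn.
Proof.
apply: (cmp_ext (F := fun p : nat * nat => iter p.1 S p.2)); last by cmp_auto.
by move=> [m n] /=; elim: m => //= m ->.
Qed.
#[global] Instance Cmp_muln : Cmp2 muln.
Proof.
apply: (cmp_ext (F := fun p : nat * nat => iter p.1 (addn p.2) 0)); last by cmp_auto.
by move=> [m n] /=; elim: m => //= m ->.
Qed.
#[global] Instance Cmp_subn : Cmp2 subn.
Proof.
apply: (cmp_ext (F := fun p : nat * nat => iter p.2 predn p.1)); last by cmp_auto.
by move=> [m n] /=; elim: n => [|n /= ->]; rewrite ?subn0 ?subnS.
Qed.
#[global] Instance Cmp_leq : Cmp2 leq.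
Proof.
apply: (cmp_ext (F := fun p : nat * nat => if p.1 - p.2 is _.+1 then false else true));
  last by cmp_auto.
by move=> [m n] /=; rewrite /leq; case: (m - n).
Qed.
#[global] Instance Cmp_eqn : Cmp2 (@eq_op nat).
Proof.
apply: (cmp_ext (F := fun p : nat * nat => (p.1 <= p.2) && (p.2 <= p.1))); last by cmp_auto.
by move=> [m n] /=; rewrite eqn_leq.
Qed.
#[global] Instance Cmp_eqchan : Cmp2 (@eq_op chan).
Proof.
apply: (cmp_ext (F := fun p : chan * chan =>
  match p.1 with
  | CVar x => if p.2 is CVar y then x == y else false
  | CRole s r => if p.2 is CRole t q then (s == t) && (r == q) else false
  end)); last by cmp_auto.
by move=> [[x|s r] [y|t q]].
Qed.
#[global] Instance Cmp_eqopt : Cmp2 (@eq_op (option nat)).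
Proof.
apply: (cmp_ext (F := fun p : option nat * option nat =>
  match p.1 with
  | Some x => if p.2 is Some y then x == y else false
  | None => if p.2 is Some _ then false else true
  end)); last by cmp_auto.
by move=> [[x|] [y|]] /=.
Qed.

#[global] Instance Cmp_size A (eA : Enc A) : Cmp1 (@size A).
Proof.
apply: (cmp_ext (F := fun s : seq A => foldr (fun _ n => n.+1) 0 s)); last by cmp_auto.
by elim=> //= a s ->.
Qed.
#[global] Instance Cmp_sumn : Cmp1 sumn.
Proof. by rewrite /Cmp1 /sumn; cmp_auto. Qed.
#[global] Instance Cmp_cat A (eA : Enc A) : Cmp2 (@cat A).
Proof.
apply: (cmp_ext (F := fun p : seq A * seq A => foldr cons p.2 p.1)); last by cmp_auto.
by move=> [s t] /=; elim: s => //= a s ->.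
Qed.
#[global] Instance Cmp_flatten A (eA : Enc A) : Cmp1 (@flatten A).
Proof. by rewrite /Cmp1 /flatten; cmp_auto. Qed.
#[global] Instance Cmp_odflt A (eA : Enc A) : Cmp2 (@odflt A).
Proof. by apply: (cmp_ext (F := fun p : A * option A => if p.2 is Some a then a else p.1)); [case=> d []|cmp_auto]. Qed.

#[global] Instance Cmp_iota : Cmp2 iota.
Proof.
refine (cmp_rec (m := fun p : nat * nat => p.2)
  (kids := fun p => if p.2 is n.+1 then [:: (p.1.+1, n)] else [::])
  (body := fun p r => if p.2 is n.+1 then if r is s :: _ then p.1 :: s else [::] else [::])
  _ _ _ _).
- by cmp_auto.
- by cmp_auto.
- by move=> [m [|n]] /=; constructor.
- by move=> [m [|n]].
Qed.
#[global] Instance Cmp_zip A B (eA : Enc A) (eB : Enc B) : Cmp2 (@zip A B).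
Proof.
refine (cmp_rec (m := fun p : seq A * seq B => size p.1)
  (kids := fun p => if p.1 is x :: s then if p.2 is y :: t then [:: (s, t)] else [::] else [::])
  (body := fun p r => if p.1 is x :: s then if p.2 is y :: t then
       if r is u :: _ then (x, y) :: u else [::] else [::] else [::]) _ _ _ _).
- by cmp_auto.
- by cmp_auto.
- by move=> [[|x s] [|y t]] /=; constructor.
- by move=> [[|x s] [|y t]].
Qed.
#[global] Instance Cmp_onth A (eA : Enc A) : Cmp2 (@onth A).
Proof.
refine (cmp_rec (m := fun p : seq A * nat => size p.1)
  (kids := fun p => if p.1 is x :: s then if p.2 is n.+1 then [:: (s, n)] else [::] else [::])
  (body := fun p r => if p.1 is x :: s then if p.2 is n.+1 then
       if r is u :: _ then u else None else Some x else None) _ _ _ _).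
- by cmp_auto.
- by cmp_auto.
- by move=> [[|x s] [|n]] /=; constructor.
- by move=> [[|x s] [|n]].
Qed.

Section EqLists.
Context (K : eqType) (eK : Enc K) (hK : Cmp2 (@eq_op K)).

Lemma cmp_mem X (eX : Enc X) (x : X -> K) (s : X -> seq K) :
  cmp x -> cmp s -> cmp (fun a => x a \in s a).
Proof.
move=> hx hs; apply: (cmp_ext (F := fun a => has (fun y => x a == y) (s a))) => [a|].
  by elim: (s a) => //= y t ->.
refine (cmp_has (f := fun a y => x a == y) _ hs).
by cmp_app; [refine (cmp_comp hx _)|]; cmp_auto.
Qed.

#[global] Instance Cmp_undup : Cmp1 (@undup K).
Proof.
(* A fold sees only the result for the tail, so membership is tested there; removing duplicates does
   not change it. *)
apply: (cmp_ext (F := foldr (fun x u => if x \in u then u else x :: u) [::])).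
  by elim=> //= x s ->; rewrite mem_undup.
cmp_step; [|by cmp_auto..].
refine (cmp_if _ _ _); try by cmp_auto.
by apply: cmp_mem; cmp_auto.
Qed.
#[global] Instance Cmp_uniq : Cmp1 (@uniq K).
Proof.
apply: (cmp_ext (F := fun s : seq K => ~~ (size (undup s) < size s))); last by cmp_auto.
by move=> s; rewrite ltn_size_undup negbK.
Qed.
#[global] Instance Cmp_assoc V (eV : Enc V) : Cmp2 (@assoc K V).
Proof.
apply: (cmp_ext (F := fun p : K * seq (K * V) =>
  foldr (fun kv acc => if p.1 == kv.1 then Some kv.2 else acc) None p.2)); last by cmp_auto.
by move=> [k s] /=; elim: s => //= -[k' v] s ->.
Qed.
End EqLists.

Ltac cmp_iterator ::=
  lazymatch goal with
  | |- cmp (fun x => foldr (@?f x) (@?z x) (@?s x)) =>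
      refine (@cmp_foldr _ _ _ _ _ _ f z s _ _ _)
  | |- cmp (fun x => map (@?f x) (@?s x)) => refine (@cmp_map _ _ _ _ _ _ f s _ _)
  | |- cmp (fun x => all (@?f x) (@?s x)) => refine (@cmp_all _ _ _ _ f s _ _)
  | |- cmp (fun x => has (@?f x) (@?s x)) => refine (@cmp_has _ _ _ _ f s _ _)
  | |- cmp (fun x => pmap (@?f x) (@?s x)) => refine (@cmp_pmap _ _ _ _ _ _ f s _ _)
  | |- cmp (fun x => iter (@?n x) (@?f x) (@?z x)) => refine (@cmp_iter _ _ _ _ n f z _ _ _)
  | |- cmp (fun x => @in_mem _ _ _) => refine (cmp_mem _ _ _)
  end.

(** * Programs for the type system *)

Definition nnum (q : rat) : nat := `|numq q|%N.
Definition nden (q : rat) : nat := `|denq q|%N.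

Lemma nnumE (q : rat) : (0 <= q)%R -> q = ((nnum q)%:R / (nden q)%:R)%R.
Proof.
move=> q0; rewrite -[LHS]divq_num_den /nnum /nden.
have en : (`|numq q|%N : int) = numq q by rewrite gez0_abs // numq_ge0.
have ed : (`|denq q|%N : int) = denq q by rewrite gez0_abs // ltW // denq_gt0.
by rewrite -{1}en -{1}ed.
Qed.

Lemma nden_gt0 q : 0 < nden q.
Proof. by rewrite /nden absz_gt0 denq_neq0. Qed.

(** Rationals are stored in lowest terms, so equality is equality of the two encoded components. *)
Lemma eq_rat_nat (p q : rat) : (0 <= p)%R -> (0 <= q)%R ->
  (p == q) = (nnum p == nnum q) && (nden p == nden q).
Proof.
move=> p0 q0; apply/eqP/andP => [->|[/eqP en /eqP ed]]; first by rewrite !eqxx.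
by rewrite (nnumE p0) (nnumE q0) en ed.
Qed.

Lemma le_frac (a b c d : nat) : 0 < b -> 0 < d ->
  (a%:R / b%:R <= c%:R / d%:R :> rat)%R = (a * d <= c * b).
Proof.
move=> b0 d0; rewrite ler_pdivrMr ?ltr0n // mulrAC ler_pdivlMr ?ltr0n //.
by rewrite -!natrM ler_nat.
Qed.

(** Cross multiplication reduces the comparison of encoded probabilities to arithmetic on natural
    numbers. *)
Lemma le_rat_nat (p q : rat) : (0 <= p)%R -> (0 <= q)%R ->
  (p <= q)%R = (nnum p * nden q <= nnum q * nden p).
Proof.
by move=> p0 q0; rewrite {1}(nnumE p0) {1}(nnumE q0) le_frac ?nden_gt0.
Qed.

Definition prob_num (p : prob) := nnum (sval p).
Definition prob_den (p : prob) := nden (sval p).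
Definition lo_num (d : iprob) := nnum (ilo d).
Definition lo_den (d : iprob) := nden (ilo d).
Definition hi_num (d : iprob) := nnum (ihi d).
Definition hi_den (d : iprob) := nden (ihi d).

#[global] Instance Cmp_prob_num : Cmp1 prob_num.
Proof. by exists (EHd EArg) => p; apply: (eval_hd (t := enc p)); exact: eval_arg. Qed.
#[global] Instance Cmp_prob_den : Cmp1 prob_den.
Proof. by exists (ETl EArg) => p; apply: (eval_tl (t := enc p)); exact: eval_arg. Qed.

#[global] Instance Cmp_lo_num : Cmp1 lo_num.
Proof.
exists (EHd (EHd EArg)) => d; apply: (eval_hd (t := enc_rat (ilo d))).
by apply: (eval_hd (t := enc d)); exact: eval_arg.
Qed.
#[global] Instance Cmp_lo_den : Cmp1 lo_den.
Proof.
exists (ETl (EHd EArg)) => d; apply: (eval_tl (t := enc_rat (ilo d))).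
by apply: (eval_hd (t := enc d)); exact: eval_arg.
Qed.
#[global] Instance Cmp_hi_num : Cmp1 hi_num.
Proof.
exists (EHd (ETl EArg)) => d; apply: (eval_hd (t := enc_rat (ihi d))).
by apply: (eval_tl (t := enc d)); exact: eval_arg.
Qed.
#[global] Instance Cmp_hi_den : Cmp1 hi_den.
Proof.
exists (ETl (ETl EArg)) => d; apply: (eval_tl (t := enc_rat (ihi d))).
by apply: (eval_tl (t := enc d)); exact: eval_arg.
Qed.

Lemma ilo_ge0 d : (0 <= ilo d)%R.
Proof. by case: d => a b /= /and3P[]. Qed.

Lemma ihi_ge0 d : (0 <= ihi d)%R.
Proof. by case: d => a b /= /and3P[a0 ab _]; exact: le_trans ab. Qed.

Lemma prob_ge0 (p : prob) : (0 <= sval p)%R.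
Proof. by case: p => p /= /andP[]. Qed.

#[global] Instance Cmp_iprob_eqb : Cmp2 iprob_eqb.
Proof.
apply: (cmp_ext (F := fun p : iprob * iprob =>
  ((lo_num p.1 == lo_num p.2) && (lo_den p.1 == lo_den p.2)) &&
  ((hi_num p.1 == hi_num p.2) && (hi_den p.1 == hi_den p.2)))); last by cmp_auto.
by move=> [d d'] /=; rewrite /iprob_eqb !eq_rat_nat ?ilo_ge0 ?ihi_ge0.
Qed.

#[global] Instance Cmp_in_iprob : Cmp2 in_iprob.
Proof.
apply: (cmp_ext (F := fun p : prob * iprob =>
  (lo_num p.2 * prob_den p.1 <= prob_num p.1 * lo_den p.2) &&
  (prob_num p.1 * hi_den p.2 <= hi_num p.2 * prob_den p.1))); last by cmp_auto.
by move=> [p d] /=; rewrite /in_iprob (le_rat_nat (ilo_ge0 d) (prob_ge0 p))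
  (le_rat_nat (prob_ge0 p) (ihi_ge0 d)).
Qed.

(** The sum is accumulated as an unreduced fraction, numerator and denominator in a pair. The
    program needs no greatest common divisors, and the total is 1 when both components coincide. *)
Definition sum1 (bs : fam ((prob * value) * proc)) : bool :=
  let s := foldr (fun (b : label * (prob * value * proc)) (acc : nat * nat) =>
     (prob_num b.2.1.1 * acc.2 + acc.1 * prob_den b.2.1.1, prob_den b.2.1.1 * acc.2))
     (0, 1) bs in s.1 == s.2.

Lemma sum1E bs : sum1 bs = (\sum_(b <- bs) sval b.2.1.1 == 1)%R.
Proof.
rewrite /sum1; set f := (fun b acc => _).
have [h0 ->] : 0 < (foldr f (0, 1) bs).2 /\
   (\sum_(b <- bs) sval b.2.1.1 = (foldr f (0, 1) bs).1%:R / (foldr f (0, 1) bs).2%:R)%R.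
  elim: bs => [|b bs [IH0 IH]] /=; first by rewrite big_nil mul0r.
  rewrite big_cons IH {1}(nnumE (prob_ge0 _)) muln_gt0 IH0 nden_gt0; split=> //.
  by rewrite addf_div ?pnatr_eq0 -?lt0n ?nden_gt0 // natrD !natrM.
have n0 : ((foldr f (0, 1) bs).2%:R != 0 :> rat)%R by rewrite pnatr_eq0 -lt0n.
by rewrite -(inj_eq (mulIf n0)) divfK // mul1r eqr_nat.
Qed.

#[global] Instance Cmp_sum1 : Cmp1 sum1.
Proof. by rewrite /Cmp1 /sum1; cmp_auto. Qed.

(** * Constructors and accessors of the syntax *)

Lemma cmp_tag A B (eA : Enc A) (eB : Enc B) (F : A -> B) (i : nat) :
  (forall a, eB (F a) = Cons (enc_nat i) (eA a)) -> cmp F.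
Proof.
move=> h; exists (ECons (quote (enc_nat i)) EArg) => a; rewrite h.
by apply: eval_cons; [exact: eval_quote|exact: eval_arg].
Qed.
#[global] Instance Cmp_LSel : Cmp2 LSel.
Proof. by apply: (cmp_tag (i := 0)); case. Qed.
#[global] Instance Cmp_LBra : Cmp2 LBra.
Proof. by apply: (cmp_tag (i := 1)); case. Qed.
#[global] Instance Cmp_LMu : Cmp1 LMu.
Proof. exact: (cmp_tag (i := 2)). Qed.
#[global] Instance Cmp_LVar : Cmp1 LVar.
Proof. exact: (cmp_tag (i := 3)). Qed.
#[global] Instance Cmp_CVar : Cmp1 CVar.
Proof. exact: (cmp_tag (i := 0)). Qed.
#[global] Instance Cmp_CRole : Cmp2 CRole.
Proof. by apply: (cmp_tag (i := 1)); case. Qed.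
#[global] Instance Cmp_svals : Cmp1 svals.
Proof. by exists (EHd EArg) => p; apply: (eval_hd (t := enc p)); exact: eval_arg. Qed.
#[global] Instance Cmp_sprocs : Cmp1 sprocs.
Proof. by exists (ETl EArg) => p; apply: (eval_tl (t := enc p)); exact: eval_arg. Qed.
#[global] Instance Cmp_Sorting : Cmp2 Sorting.
Proof. by exists EArg => -[s t]; exact: eval_arg. Qed.
#[global] Instance Cmp_add_vals : Cmp2 add_vals.
Proof. by rewrite /Cmp2 /add_vals; cmp_auto. Qed.
#[global] Instance Cmp_add_proc : Cmp3 add_proc.
Proof. by rewrite /Cmp3 /add_proc; cmp_auto. Qed.
#[global] Instance Cmp_vsort : Cmp2 vsort.
Proof. by rewrite /Cmp2 /vsort; cmp_auto. Qed.
#[global] Instance Cmp_call_types : Cmp2 call_types.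
Proof. by rewrite /Cmp2 /call_types; cmp_auto. Qed.
#[global] Instance Cmp_shift_chan : Cmp1 shift_chan.
Proof. by rewrite /Cmp1 /shift_chan; cmp_auto. Qed.
#[global] Instance Cmp_unshift_chan : Cmp1 unshift_chan.
Proof. by rewrite /Cmp1 /unshift_chan; cmp_auto. Qed.
#[global] Instance Cmp_labels : Cmp1 labels.
Proof. by rewrite /Cmp1 /labels; cmp_auto. Qed.
#[global] Instance Cmp_child : Cmp2 child.
Proof. by rewrite /Cmp2 /child; cmp_auto. Qed.
#[global] Instance Cmp_head A (eA : Enc A) : Cmp2 (@head A).
Proof. by rewrite /Cmp2 /head; cmp_auto. Qed.

(** * Recursive functions on types and processes *)

(** A common measure for the recursions on local types, global types and processes: the size of the
    encoding. *)
Fixpoint tsize (t : tree) : nat := if t is Cons a b then (tsize a + tsize b).+1 else 0.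

Lemma tsize_fam A B (eA : Enc A) (eB : Enc B) (bs : seq (nat * (A * B))) b :
  List.In b bs -> tsize (eB b.2.2) < tsize (enc_fam eA eB bs).
Proof.
by rewrite /enc_fam; elim: bs => //= c bs IH [->|/IH]; lia.
Qed.

Lemma Forall_map (A B : Type) (P : B -> Prop) (f : A -> B) s :
  (forall x, List.In x s -> P (f x)) -> List.Forall P (map f s).
Proof. by move=> h; apply/List.Forall_forall => _ /In_map[x xs ->]; exact: h. Qed.

(** The body of a [cmp_rec] receives a family and, separately, the results for its branches; zipping
    them rebuilds the family. *)
Lemma zip_map (A B C : Type) (f : A -> B) (g : A * B -> C) (s : seq A) :
  [seq g x | x <- zip s (map f s)] = [seq g (x, f x) | x <- s].
Proof. by elim: s => //= x s ->. Qed.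

Lemma tsize_sel r bs b : List.In b bs ->
  tsize (enc_ltype b.2.2) < tsize (enc_ltype (LSel r bs)).
Proof.
move=> bb; apply: leq_trans (tsize_fam enc_isort enc_ltype bb) _.
by rewrite /= -/enc_ltype; lia.
Qed.

Lemma tsize_bra r bs b : List.In b bs ->
  tsize (enc_ltype b.2.2) < tsize (enc_ltype (LBra r bs)).
Proof.
move=> bb; apply: leq_trans (tsize_fam enc_nat enc_ltype bb) _.
by rewrite /= -/enc_ltype; lia.
Qed.

Lemma tsize_msg p q bs b : List.In b bs ->
  tsize (enc_gtype b.2.2) < tsize (enc_gtype (GMsg p q bs)).
Proof.
move=> bb; apply: leq_trans (tsize_fam enc_isort enc_gtype bb) _.
by rewrite /= -/enc_gtype; lia.
Qed.

Lemma tsize_psel c r bs b : List.In b bs ->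
  tsize (enc_proc b.2.2) < tsize (enc_proc (PSel c r bs)).
Proof.
move=> bb; apply: leq_trans (tsize_fam enc_pvalue enc_proc bb) _.
by rewrite /= -/enc_proc; lia.
Qed.

Lemma tsize_pbra c r bs b : List.In b bs ->
  tsize (enc_proc b.2.2) < tsize (enc_proc (PBra c r bs)).
Proof.
move=> bb; apply: leq_trans (tsize_fam enc_nat enc_proc bb) _.
by rewrite /= -/enc_proc; lia.
Qed.

Ltac kids_decrease :=
  match goal with |- List.Forall ?p ?s => let t := eval simpl in s in change (List.Forall p t) end;
  first [ by []
        | by constructor => //=; lia
        | by constructor => /=; [lia | constructor => //=; lia]
        | by apply: Forall_map; let bb := fresh "bb" in intros ? bb; cbn [fst snd]; first
            [ apply: tsize_sel; exact: bb | apply: tsize_bra; exact: bb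
            | apply: tsize_msg; exact: bb | apply: tsize_psel; exact: bb
            | apply: tsize_pbra; exact: bb ] ].

#[global] Instance Cmp_lsize : Cmp1 lsize.
Proof.
refine (cmp_rec (m := fun T => tsize (enc_ltype T))
  (kids := fun T => match T with
     | LSel _ bs => [seq b.2.2 | b <- bs] | LBra _ bs => [seq b.2.2 | b <- bs]
     | LMu T' => [:: T'] | _ => [::] end)
  (body := fun T r => match T with
     | LSel _ _ => (sumn r).+1 | LBra _ _ => (sumn r).+1 | LMu _ => (head 0 r).+1
     | _ => 1 end) _ _ _ _).
- by cmp_auto.
- by cmp_auto.
- by case=> [r bs|r bs|T|n|]; kids_decrease.
- by case=> [r bs|r bs|T|n|] //=; rewrite -map_comp.
Qed.

#[global] Instance Cmp_llift : Cmp3 llift.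
Proof.
refine (cmp_rec (m := fun p : nat * (nat * ltype) => tsize (enc_ltype p.2.2))
  (kids := fun p => match p.2.2 with
     | LSel _ bs => [seq (p.1, (p.2.1, b.2.2)) | b <- bs]
     | LBra _ bs => [seq (p.1, (p.2.1, b.2.2)) | b <- bs]
     | LMu T => [:: (p.1, (p.2.1.+1, T))] | _ => [::] end)
  (body := fun p r => match p.2.2 with
     | LSel q bs => LSel q [seq (x.1.1, (x.1.2.1, x.2)) | x <- zip bs r]
     | LBra q bs => LBra q [seq (x.1.1, (x.1.2.1, x.2)) | x <- zip bs r]
     | LMu _ => LMu (head LEnd r)
     | LVar n => LVar (if n < p.2.1 then n else n + p.1)
     | LEnd => LEnd end) _ _ _ _).
- by cmp_auto.
- by cmp_auto.
- by case=> [d [k [r bs|r bs|T|n|]]]; kids_decrease.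
- by case=> [d [k [r bs|r bs|T|n|]]] //=; rewrite -map_comp zip_map.
Qed.

#[global] Instance Cmp_lsubst : Cmp3 lsubst.
Proof.
refine (cmp_rec (m := fun p : nat * (ltype * ltype) => tsize (enc_ltype p.2.2))
  (kids := fun p => match p.2.2 with
     | LSel _ bs => [seq (p.1, (p.2.1, b.2.2)) | b <- bs]
     | LBra _ bs => [seq (p.1, (p.2.1, b.2.2)) | b <- bs]
     | LMu T => [:: (p.1.+1, (p.2.1, T))] | _ => [::] end)
  (body := fun p r => match p.2.2 with
     | LSel q bs => LSel q [seq (x.1.1, (x.1.2.1, x.2)) | x <- zip bs r]
     | LBra q bs => LBra q [seq (x.1.1, (x.1.2.1, x.2)) | x <- zip bs r]
     | LMu _ => LMu (head LEnd r)
     | LVar n => if n < p.1 then LVar n else if n == p.1 then llift p.1 0 p.2.1 else LVar n.-1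
     | LEnd => LEnd end) _ _ _ _).
- by cmp_auto.
- by cmp_auto.
- by case=> [d [k [r bs|r bs|T|n|]]]; kids_decrease.
- by case=> [d [k [r bs|r bs|T|n|]]] //=; rewrite -map_comp zip_map.
Qed.

#[global] Instance Cmp_lstep : Cmp1 lstep.
Proof. by rewrite /Cmp1 /lstep; cmp_auto. Qed.

#[global] Instance Cmp_mus : Cmp1 mus.
Proof.
refine (cmp_rec (m := fun T => tsize (enc_ltype T))
  (kids := fun T => if T is LMu T' then [:: T'] else [::])
  (body := fun T r => if T is LMu _ then (head 0 r).+1 else 0) _ _ _ _).
- by cmp_auto.
- by cmp_auto.
- by case=> [r bs|r bs|T|n|]; kids_decrease.
- by case.
Qed.

#[global] Instance Cmp_unf : Cmp1 unf.
Proof. by rewrite /Cmp1 /unf; cmp_auto. Qed.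

#[global] Instance Cmp_headeq : Cmp2 headeq.
Proof. by rewrite /Cmp2 /headeq /headg /fam_rel; cmp_auto. Qed.

(** The measure is the depth rather than the size of the types, because unfolding can enlarge
    them. *)
#[global] Instance Cmp_teqn : Cmp3 teqn.
Proof.
refine (cmp_rec (m := fun p : nat * (ltype * ltype) => p.1)
  (kids := fun p => if p.1 is n.+1 then
     [seq (n, (child l (unf p.2.1), child l (unf p.2.2))) | l <- labels (unf p.2.1)]
     else [::])
  (body := fun p r => if p.1 is n.+1 then
     headeq (unf p.2.1) (unf p.2.2) && all (fun b => b) r else true) _ _ _ _).
- by cmp_auto.
- by cmp_auto.
- by case=> [[|n] [T U]] //=; apply: Forall_map.
- by case=> [[|n] [T U]] //=; rewrite !all_map.
Qed.

#[global] Instance Cmp_teqb : Cmp2 teqb.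
Proof. by rewrite /Cmp2 /teqb; cmp_auto. Qed.

#[global] Instance Cmp_lunguarded : Cmp2 lunguarded.
Proof.
refine (cmp_rec (m := fun p : nat * ltype => tsize (enc_ltype p.2))
  (kids := fun p => if p.2 is LMu T' then [:: (p.1.+1, T')] else [::])
  (body := fun p r => match p.2 with
     | LMu _ => head false r | LVar m => m == p.1 | _ => false end) _ _ _ _).
- by cmp_auto.
- by cmp_auto.
- by case=> [k [r bs|r bs|T|n|]]; kids_decrease.
- by case=> [k []].
Qed.

#[global] Instance Cmp_wf_ltype : Cmp2 wf_ltype.
Proof.
refine (cmp_rec (m := fun p : nat * ltype => tsize (enc_ltype p.2))
  (kids := fun p => match p.2 with
     | LSel _ bs => [seq (p.1, b.2.2) | b <- bs]
     | LBra _ bs => [seq (p.1, b.2.2) | b <- bs]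
     | LMu T => [:: (p.1.+1, T)] | _ => [::] end)
  (body := fun p r => match p.2 with
     | LSel q bs => (0 < size bs) && uniq [seq b.1 | b <- bs] && all (fun b => b) r
     | LBra q bs => (0 < size bs) && uniq [seq b.1 | b <- bs] && all (fun b => b) r
     | LMu T => ~~ lunguarded 0 T && all (fun b => b) r
     | LVar n => n < p.1
     | LEnd => true end) _ _ _ _).
- by cmp_auto.
- by cmp_auto.
- by case=> [k [r bs|r bs|T|n|]]; kids_decrease.
- by case=> [k [r bs|r bs|T|n|]] //=; rewrite ?all_map ?andbT.
Qed.

#[global] Instance Cmp_roles : Cmp1 roles.
Proof.
refine (cmp_rec (m := fun G => tsize (enc_gtype G))
  (kids := fun G => match G with
     | GMsg _ _ bs => [seq b.2.2 | b <- bs] | GMu G' => [:: G'] | _ => [::] end)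
  (body := fun G r => match G with
     | GMsg p q _ => p :: q :: flatten r | GMu _ => head [::] r | _ => [::] end) _ _ _ _).
- by cmp_auto.
- by cmp_auto.
- by case=> [p q bs|G|n|]; kids_decrease.
- by case=> [p q bs|G|n|] //=; rewrite -map_comp.
Qed.

#[global] Instance Cmp_pid : Cmp1 pid.
Proof. by rewrite /Cmp1 /pid; cmp_auto. Qed.

#[global] Instance Cmp_gclosed : Cmp2 gclosed.
Proof.
refine (cmp_rec (m := fun p : nat * gtype => tsize (enc_gtype p.2))
  (kids := fun p => match p.2 with
     | GMsg _ _ bs => [seq (p.1, b.2.2) | b <- bs] | GMu G' => [:: (p.1.+1, G')]
     | _ => [::] end)
  (body := fun p r => match p.2 with
     | GMsg _ _ _ => all (fun b => b) r | GMu _ => all (fun b => b) r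
     | GVar n => n < p.1 | _ => true end) _ _ _ _).
- by cmp_auto.
- by cmp_auto.
- by case=> [k [p q bs|G|n|]]; kids_decrease.
- by case=> [k [p q bs|G|n|]] //=; rewrite ?all_map ?andbT.
Qed.

#[global] Instance Cmp_sequence A (eA : Enc A) : Cmp1 (@sequence A).
Proof. by rewrite /Cmp1 /sequence; cmp_auto. Qed.

#[global] Instance Cmp_projf : Cmp2 projf.
Proof.
refine (cmp_rec (m := fun p : gtype * role => tsize (enc_gtype p.1))
  (kids := fun p => match p.1 with
     | GMsg _ _ bs => [seq (b.2.2, p.2) | b <- bs] | GMu G' => [:: (G', p.2)]
     | _ => [::] end)
  (body := fun x rs => match x.1 with
     | GMsg p q bs =>
         if sequence rs is Some Ts then
           if x.2 == p then Some (LSel q [seq (x.1.1, (x.1.2.1, x.2)) | x <- zip bs Ts])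
           else if x.2 == q then
             Some (LBra p [seq (x.1.1, (x.1.2.1.2, x.2)) | x <- zip bs Ts])
           else if Ts is T :: Ts' then if all (teqb T) Ts' then Some T else None else None
         else None
     | GMu G =>
         if (x.2 \in pid G) || ~~ gclosed 1 G then
           if head None rs is Some T then Some (LMu T) else None
         else Some LEnd
     | GVar n => Some (LVar n)
     | GEnd => Some LEnd end) _ _ _ _).
- by cmp_auto.
- by cmp_auto.
- by case=> [[p q bs|G|n|] r]; kids_decrease.
- by case=> [[p q bs|G|n|] r] //=; rewrite -map_comp.
Qed.

#[global] Instance Cmp_merge : Cmp2 merge.
Proof.
refine (cmp_rec (m := fun p : ltype * ltype => tsize (enc_ltype p.1))
  (kids := fun p => match p.1 with
     | LSel _ bs => if p.2 is LSel _ _ then [seq (b.2.2, child b.1 p.2) | b <- bs] else [::]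
     | LBra _ bs => if p.2 is LBra _ _ then [seq (b.2.2, child b.1 p.2) | b <- bs] else [::]
     | _ => [::] end)
  (body := fun p rs => match p.1 with
     | LSel r bs => match p.2 with
         | LSel _ _ => LSel r [seq (x.1.1, (x.1.2.1, x.2)) | x <- zip bs rs]
         | LBra _ _ => LEnd | _ => p.2 end
     | LBra r bs => match p.2 with
         | LBra _ _ => LBra r [seq (x.1.1, (x.1.2.1, x.2)) | x <- zip bs rs]
         | LSel _ _ => LEnd | _ => p.2 end
     | _ => p.1 end) _ _ _ _).
- by cmp_auto.
- by cmp_auto.
- by case=> [[r bs|r bs|T|n|] [r' bs'|r' bs'|T'|n'|]]; kids_decrease.
- by case=> [[r bs|r bs|T|n|] [r' bs'|r' bs'|T'|n'|]] //=; rewrite -map_comp zip_map.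
Qed.

#[global] Instance Cmp_merge_all : Cmp1 merge_all.
Proof. by rewrite /Cmp1 /merge_all; cmp_auto. Qed.

#[global] Instance Cmp_fc : Cmp1 fc.
Proof.
refine (cmp_rec (m := fun P => tsize (enc_proc P))
  (kids := fun P => match P with
     | PSel _ _ bs => [seq b.2.2 | b <- bs] | PBra _ _ bs => [seq b.2.2 | b <- bs]
     | PNew _ P' => [:: P'] | PDef _ _ _ Q => [:: Q] | PPar P' Q => [:: P'; Q]
     | _ => [::] end)
  (body := fun P rs => match P with
     | PSel c _ _ => c :: flatten rs | PBra c _ _ => c :: flatten rs
     | PNew _ _ => pmap unshift_chan (flatten rs) | PDef _ _ _ _ => flatten rs
     | PCall _ _ cs => cs | PNil => [::] | PPar _ _ => flatten rs end) _ _ _ _).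
- by cmp_auto.
- by cmp_auto.
- by case=> [c r bs|c r bs|G P|Ss Ts P Q|X vs cs||P Q]; kids_decrease.
- by case=> [c r bs|c r bs|G P|Ss Ts P Q|X vs cs||P Q] //=; rewrite -?map_comp ?cats0.
Qed.

#[global] Instance Cmp_sel_head : Cmp4 sel_head.
Proof. by rewrite /Cmp4 /sel_head /fam_rel; cmp_auto. Qed.

#[global] Instance Cmp_bra_head : Cmp3 bra_head.
Proof. by rewrite /Cmp3 /bra_head /fam_rel; cmp_auto. Qed.

#[global] Instance Cmp_check : Cmp4 check.
Proof.
refine (cmp_rec (m := fun p : sorting * (proc * (chan * ltype)) => tsize (enc_proc p.2.1))
  (kids := fun p => match p.2.1 with
     | PSel c r bs =>
         [seq (p.1, (b.2.2, (p.2.2.1, if c == p.2.2.1 then child b.1 (unf p.2.2.2)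
                                      else p.2.2.2))) | b <- bs]
     | PBra c r bs =>
         [seq (add_vals [:: b.2.1] p.1,
               (b.2.2, (p.2.2.1, if c == p.2.2.1 then child b.1 (unf p.2.2.2)
                                 else p.2.2.2))) | b <- bs]
     | PNew _ P' => [:: (p.1, (P', (shift_chan p.2.2.1, p.2.2.2)))]
     | PDef Ss Ts _ Q => [:: (add_proc Ss Ts p.1, (Q, p.2.2))]
     | PPar P' Q => [:: (p.1, (if p.2.2.1 \in fc Q then Q else P', p.2.2))]
     | _ => [::] end)
  (body := fun p rs => match p.2.1 with
     | PSel c r bs =>
         ((c == p.2.2.1) ==> sel_head p.1 r bs (unf p.2.2.2)) && all (fun b => b) rs
     | PBra c r bs => ((c == p.2.2.1) ==> bra_head r bs (unf p.2.2.2)) && all (fun b => b) rs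
     | PCall X _ cs => teqb p.2.2.2 (odflt LEnd (assoc p.2.2.1 (zip cs (call_types p.1 X))))
     | PNil => teqb p.2.2.2 LEnd
     | _ => all (fun b => b) rs end) _ _ _ _).
- by cmp_auto.
- by cmp_auto.
- case=> [Gam [[c r bs|c r bs|G P|Ss Ts P Q|X vs cs||P Q] [d T]]]; try kids_decrease.
  by constructor => //=; case: ifP; lia.
- case=> [Gam [[c r bs|c r bs|G P|Ss Ts P Q|X vs cs||P Q] [d T]]] //=;
    rewrite ?all_map ?andbT //.
  by case: ifP.
Qed.

#[global] Instance Cmp_cand : Cmp3 cand.
Proof.
refine (cmp_rec (m := fun p : sorting * (proc * chan) => tsize (enc_proc p.2.1))
  (kids := fun p => match p.2.1 with
     | PSel c r bs => [seq (p.1, (b.2.2, p.2.2)) | b <- bs]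
     | PBra c r bs => [seq (add_vals [:: b.2.1] p.1, (b.2.2, p.2.2)) | b <- bs]
     | PNew _ P' => [:: (p.1, (P', shift_chan p.2.2))]
     | PDef Ss Ts _ Q => [:: (add_proc Ss Ts p.1, (Q, p.2.2))]
     | PPar P' Q => [:: (p.1, (if p.2.2 \in fc Q then Q else P', p.2.2))]
     | _ => [::] end)
  (body := fun p rs => match p.2.1 with
     | PSel c r bs =>
         if c == p.2.2 then
           LSel r [seq (x.1.1, ((iprob01, odflt 0 (vsort p.1 x.1.2.1.2)), x.2)) | x <- zip bs rs]
         else merge_all rs
     | PBra c r bs =>
         if c == p.2.2 then LBra r [seq (x.1.1, (x.1.2.1, x.2)) | x <- zip bs rs]
         else merge_all rs
     | PCall X _ cs =>
         if assoc p.2.2 (zip cs (call_types p.1 X)) is Some T then LMu T else LEnd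
     | PNil => LEnd
     | _ => head LEnd rs end) _ _ _ _).
- by cmp_auto.
- by cmp_auto.
- case=> [Gam [[c r bs|c r bs|G P|Ss Ts P Q|X vs cs||P Q] d]]; try kids_decrease.
  by constructor => //=; case: ifP; lia.
- case=> [Gam [[c r bs|c r bs|G P|Ss Ts P Q|X vs cs||P Q] d]] //=;
    rewrite -?map_comp ?zip_map //.
  by case: ifP.
Qed.

#[global] Instance Cmp_new_ok : Cmp3 new_ok.
Proof. by rewrite /Cmp3 /new_ok; cmp_auto. Qed.

#[global] Instance Cmp_def_ok : Cmp3 def_ok.
Proof. by rewrite /Cmp3 /def_ok; cmp_auto. Qed.

#[global] Instance Cmp_call_ok : Cmp4 call_ok.
Proof. by rewrite /Cmp4 /call_ok; cmp_auto. Qed.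

#[global] Instance Cmp_ok : Cmp2 ok.
Proof.
refine (cmp_rec (m := fun p : sorting * proc => tsize (enc_proc p.2))
  (kids := fun p => match p.2 with
     | PSel _ _ bs => [seq (p.1, b.2.2) | b <- bs]
     | PBra _ _ bs => [seq (add_vals [:: b.2.1] p.1, b.2.2) | b <- bs]
     | PNew _ P' => [:: (p.1, P')]
     | PDef Ss Ts P' Q =>
         [:: (add_vals Ss (add_proc Ss Ts p.1), P'); (add_proc Ss Ts p.1, Q)]
     | PPar P' Q => [:: (p.1, P'); (p.1, Q)]
     | _ => [::] end)
  (body := fun p rs => match p.2 with
     | PSel _ _ bs => sum1 bs && all (fun b => b) rs
     | PNew G P' => new_ok p.1 G P' && all (fun b => b) rs
     | PDef Ss Ts P' _ =>
         def_ok (add_vals Ss (add_proc Ss Ts p.1)) Ts P' && all (fun b => b) rs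
     | PCall X vs cs => call_ok p.1 X vs cs
     | PPar P' Q => all (fun c => c \notin fc Q) (fc P') && all (fun b => b) rs
     | _ => all (fun b => b) rs end) _ _ _ _).
- by cmp_auto.
- by cmp_auto.
- by case=> [Gam [c r bs|c r bs|G P|Ss Ts P Q|X vs cs||P Q]]; kids_decrease.
- by case=> [Gam [c r bs|c r bs|G P|Ss Ts P Q|X vs cs||P Q]] //=;
    rewrite ?all_map ?sum1E ?andbT.
Qed.

#[global] Instance Cmp_infer : Cmp2 infer.
Proof. by rewrite /Cmp2 /infer; cmp_auto. Qed.

#[global] Instance Cmp_typable : Cmp2 typable.
Proof. by rewrite /Cmp2 /typable; cmp_auto. Qed.

Theorem theorem1 :
  decidable_on enc_input
    (fun x : sorting * proc => wf_sorting x.1 /\ wf_proc x.2)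
    (fun x : sorting * proc => exists Del : typing, typed x.1 x.2 Del)
  /\
  exists f : expr, forall (Gam : sorting) (P : proc),
    wf_sorting Gam -> wf_proc P ->
    (exists Del : typing, typed Gam P Del) ->
    exists Del : typing,
      run f (enc_input (Gam, P)) (enc_typing Del) /\ typed Gam P Del.
Proof.
split.
  (* The program for [typable] is itself the decision procedure, since the encoded Booleans are the
     required answers. *)
  have [f hf] := Cmp_typable; exists f => -[Gam P] /= [wG wP]; have := hf (Gam, P).
  by case E: (typable Gam P) => /= h; [left|right]; split=> //; rewrite typableP // E.
have [f hf] := Cmp_infer; exists f => Gam P wG wP /(typableP wG wP) h.
by exists (infer Gam P); split; [exact: (hf (Gam, P))|exact: typable_infer].
Qed.
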